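(* Let $X$ be a space of homogeneous type with a fixed system $\mathscr Q$ of dyadic cubes, $E$ a UMD Banach space and $1<p<\infty$. Let $\lambda$ and $M$ be positive integers, and let $\mathscr S_\lambda^{(m)}(A)$ be stripes, $\{h_A\}$, $\{g^{(m)}_{A,\lambda}\}$ function systems, and $S_\lambda^{(m)}$ the associated stripe operators ($A\in\mathscr Q$, $1\le m\le M$), all as defined in the context. Then there exists a constant $C$ such that $$\|S_\lambda^{(m)}f\|_{L^p_E(X)}\le C\,\|S_\lambda^{(n)}f\|_{L^p_E(X)},\qquad f\in\overline{\operatorname{span}}\{h_Q:Q\in\mathscr Q\},$$ for all $1\le m,n\le M$. The constant $C$ depends only on $p$, $X$ and $E$ (and on the fixed constants $K_1$ and $C_g$ of the setting); in particular it does not depend on $\lambda$ and $M$.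
   Context: Space of homogeneous type: $X$ is a set with a quasimetric $d:X\times X\to[0,\infty)$, i.e. $d(x,y)=0\Leftrightarrow x=y$, $d(x,y)=d(y,x)$, $d(x,y)\le K_X(d(x,z)+d(z,y))$ with a constant $K_X\ge1$. $B(x,r)=\{y\in X:d(x,y)<r\}$. A set $A\subset X$ is open if for every $x\in A$ there is $r>0$ with $B(x,r)\subset A$; all balls are assumed open. $|\cdot|$ is a Borel measure satisfying the doubling condition $0<|B(x,2r)|\le C_d|B(x,r)|<\infty$ for all $x\in X$, $r>0$. Dyadic cubes: $\mathscr Q=\bigcup_{n\in\mathbb Z}\mathscr Q_n$ is a fixed system of open subsets of $X$ (the Christ/David dyadic cubes), with centers $m_A\in A$ for $A\in\mathscr Q$ and constants $0<q<1$, $C_1,C_2,C_3,\eta>0$, $N\in\mathbb N$ such that: (1) $X=\bigcup_{A\in\mathscr Q_n}A$ up to null sets for each $n$; (2) for $A\in\mathscr Q_k$, $B\in\mathscr Q_n$, $k\le n$, either $B\subset A$ or $A\cap B=\emptyset$; (3) for $B\in\mathscr Q_n$ and $k\le n$ there is exactly one $A\in\mathscr Q_k$ with $B\subset A$; (4) $B(m_A,C_1q^n)\subset A\subset B(m_A,C_2q^n)$ for $A\in\mathscr Q_n$; (5) for $A\in\mathscr Q_n$, $\partial_tA=\{x\in A:d(x,X\setminus A)\le tq^n\}$ satisfies $|\partial_tA|<C_3t^\eta|A|$, where $d(x,B)=\inf_{b\in B}d(x,b)$; (6) each $\mathscr Q_n$ is countable; (7) each $A\in\mathscr Q_n$ contains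 at most $N$ cubes of $\mathscr Q_{n+1}$; (8) each $A\in\mathscr Q_n$ is, up to null sets, a union of at most $N$ cubes of $\mathscr Q_{n+1}$. $\operatorname{lev}A=n$ for $A\in\mathscr Q_n$ (a cube is understood together with its level). ''Depending only on $X$'' means depending only on the space of homogeneous type and its fixed dyadic system. For a collection $\mathscr C$ of sets, $\mathscr C^*$ denotes the union of its members; $\mathscr C$ is nested if $A\cap B\in\{A,B,\emptyset\}$ for all $A,B\in\mathscr C$. Stripes: for $A\in\mathscr Q$ and $1\le m\le M$, $\mathscr S_\lambda^{(m)}(A)$ is a subset of $\{B\in\mathscr Q:B\subset A,\ \operatorname{lev}B=\operatorname{lev}A+\lambda\}$ such that (S1) $A=\bigcup_{m=1}^M\mathscr S_\lambda^{(m)}(A)^*$ is a disjoint union (up to null sets); (S2) there is an absolute constant $K_1$ with $|\mathscr S_\lambda^{(m)}(A)^*|\le K_1|\mathscr S_\lambda^{(n)}(A)^*|$ for $1\le m,n\le M$; (S3) for each fixed $m$, $\{\mathscr S_\lambda^{(m)}(A)^*:A\in\mathscr Q\}$ is nested; (S4) there are constants $\varepsilon>0$ and $K_2$ depending only on $X$ such that for all $1\le m\le M$, $|\mathscr E_j^{(m)}(A)^*|\le K_2q^{j\varepsilon}|A|$ for $0\le j\le\lambda-1$, where $\mathscr E_j^{(m)}(A)=\{B\in\mathscr Q_{\operatorname{lev}A+j}:B\cap\mathscr S_\lambda^{(m)}(A)^*\ne\emptyset\}$. Function systems (scalar-valued functions in $L^p(X)$): $\{h_A:A\in\mathscr Q\}$,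 nonzero, with (M1) $\operatorname{supp}h_A\subset A$; (M2) $\{h_A:A\in\mathscr Q\}$ constitutes a martingale difference sequence. And $\{g_{A,\lambda}^{(m)}:A\in\mathscr Q\}$, $1\le m\le M$, with (G1) $\operatorname{supp}g_{A,\lambda}^{(m)}\subset\mathscr S_\lambda^{(m)}(A)^*$; (G2) $\{g_{A,\lambda}^{(m)}:1\le m\le M,A\in\mathscr Q\}$ constitutes a martingale difference sequence; (G3) $\|g_{A,\lambda}^{(m)}\|_\infty\le C_g\frac1{|\mathscr S_\lambda^{(n)}(A)^*|}\int|g_{A,\lambda}^{(n)}|$ for all $A\in\mathscr Q$, $1\le m,n\le M$, $m\ne n$, with some constant $C_g\ge1$. (Martingale difference sequence: in a suitable ordering and with respect to a suitable filtration of $\sigma$-finite $\sigma$-algebras.) Stripe operator: $S_\lambda^{(m)}$ is the linear extension (with coefficients in $E$) of $S_\lambda^{(m)}h_A=g_{A,\lambda}^{(m)}$, $A\in\mathscr Q$. For $f=\sum_Qf_Qh_Q$ ($f_Q\in E$) in $\overline{\operatorname{span}}\{h_Q:Q\in\mathscr Q\}$, the closure in the Bochner space $L^p_E(X)$ of finite sums, $S_\lambda^{(m)}f=\sum_Qf_Qg^{(m)}_{Q,\lambda}$ (unconditional convergence in $L^p_E(X)$), with $\|S_\lambda^{(m)}f\|_{L_E^p(X)}=\infty$ if this series does not converge. *)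

(* Defs.v *)
From HB Require Import structures.
From mathcomp Require Import all_boot all_order all_algebra.
From mathcomp Require Import finmap.
From mathcomp Require Import all_classical all_reals all_analysis.
From mathcomp.real_closed Require Import complex.
Set Implicit Arguments.
Unset Strict Implicit.
Unset Printing Implicit Defensive.
Import Order.TTheory GRing.Theory Num.Theory.
Import numFieldNormedType.Exports.
Local Open Scope classical_set_scope.
Local Open Scope ring_scope.

(* Banach spaces and scalar functions may be real or complex.  The library's
   norms on a normed module over K take values in K, hence [toreal] below. *)
Inductive scalar_kind := real_scalars | complex_scalars.

Definition scalars (R : realType) (k : scalar_kind) : numFieldType :=
  match k with
  | real_scalars => R
  | complex_scalars => R[i]
  end.

Definition toreal (R : realType) (k : scalar_kind) : scalars R k -> R :=
  match k with
  | real_scalars => fun z => z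
  | complex_scalars => fun z => complex.Re z
  end.

Definition ofreal (R : realType) (k : scalar_kind) : R -> scalars R k :=
  match k with
  | real_scalars => fun r => r
  | complex_scalars => fun r => Complex r 0
  end.

Definition vnorm (R : realType) (k : scalar_kind)
  (E : normedModType (scalars R k)) (v : E) : R := toreal `|v|.

(* A list of pairs (A, v) stands for the step function \sum 1_A v. *)
Definition step_fun (R : realType) (k : scalar_kind)
    (E : normedModType (scalars R k)) (T : Type) (s : seq (set T * E)) : T -> E :=
  fun x => \sum_(a <- s) \1_(a.1) x *: a.2.

Definition strongly_measurable (R : realType) (k : scalar_kind)
    (E : normedModType (scalars R k)) (T : Type) (F : set (set T))
    (f : T -> E) : Prop :=
  exists2 s : nat -> seq (set T * E),
    forall n a, a \in s n -> F a.1
  & forall x, step_fun (s n) x @[n --> \oo] --> f x.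

Section bochner.
Context (R : realType) (k : scalar_kind) (E : normedModType (scalars R k)).
Context (disp : measure_display) (T : measurableType disp).
Variable mu : {measure set T -> \bar R}.

Definition Lp_norm (p : \bar R) (f : T -> E) : \bar R :=
  Lnorm mu p (fun x => (vnorm (f x))%:E).

Definition in_Lp (p : R) (f : T -> E) : Prop :=
  strongly_measurable measurable f /\ (Lp_norm p%:E f < +oo)%E.

(* [v] is the Bochner integral of [f] over [B]. *)
Definition is_bochner_integral (B : set T) (f : T -> E) (v : E) : Prop :=
  strongly_measurable measurable f /\
  exists s : nat -> seq (set T * E),
    [/\ forall n a, a \in s n -> measurable a.1 /\ (mu a.1 < +oo)%E,
        (\int[mu]_(x in B) (vnorm (f x - step_fun (s n) x)%R)%:E)%E
          @[n --> \oo] --> 0%E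
      & \sum_(a <- s n) ofreal k (fine (mu (a.1 `&` B))) *: a.2
          @[n --> \oo] --> v].

Definition sigma_finite_subalgebra (F : set (set T)) : Prop :=
  [/\ sigma_algebra setT F, F `<=` measurable
    & exists2 A : nat -> set T, \bigcup_n A n = setT
      & forall n, F (A n) /\ (mu (A n) < +oo)%E].

(* [g] is a version of the conditional expectation of [f] given [F], for
   [F] sigma-finite and [f] integrable on sets of finite measure. *)
Definition is_cond_exp (F : set (set T)) (f g : T -> E) : Prop :=
  strongly_measurable F g /\
  forall B, F B -> (mu B < +oo)%E ->
    exists2 v, is_bochner_integral B f v & is_bochner_integral B g v.

(* No condition is put on a first difference: it plays the role of the initial
   term of the martingale. *)
Record martingale_difference (p : R) (I : Type) (le : rel I)
    (F : I -> set (set T)) (d : I -> T -> E) : Prop := {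
  mdiff_sigma_finite : forall i, sigma_finite_subalgebra (F i) ;
  mdiff_filtration : forall i j, le i j -> F i `<=` F j ;
  mdiff_Lp : forall i, in_Lp p (d i) ;
  mdiff_adapted : forall i, strongly_measurable (F i) (d i) ;
  mdiff_cond_exp : forall i j, le i j -> i <> j ->
    is_cond_exp (F i) (d j) (fun=> 0)
}.

(* The order must be allowed to be an arbitrary linear order: a Haar system
   over all dyadic levels in Z has infinitely many members on each level. *)
Definition martingale_difference_family (p : R) (I : Type)
    (d : I -> T -> E) : Prop :=
  exists (le : rel I) (F : I -> set (set T)),
    [/\ total le, transitive le, antisymmetric le
      & martingale_difference p le F d].

Definition unconditional_sum (p : R) (I : choiceType) (u : I -> T -> E)
    (f : T -> E) : Prop :=
  in_Lp p f /\
  forall e : R, 0 < e -> exists J0 : {fset I}, forall J : {fset I},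
    (J0 `<=` J)%fset ->
    (Lp_norm p%:E (fun x => (f x - \sum_(i <- J) u i x)%R) < e%:E)%E.

Definition tensor (h : T -> (scalars R k)^o) (c : E) : T -> E :=
  fun x => h x *: c.

Definition in_closed_span (p : R) (I : choiceType)
    (h : I -> T -> (scalars R k)^o) (f : T -> E) : Prop :=
  in_Lp p f /\
  forall e : R, 0 < e -> exists (J : {fset I}) (c : I -> E),
    (Lp_norm p%:E (fun x => (f x - \sum_(i <- J) tensor (h i) (c i) x)%R)
      < e%:E)%E.

(* [F] is the image of [f] under the linear extension of h_i |-> g_i. *)
Definition transfer_graph (p : R) (I : choiceType)
    (h g : I -> T -> (scalars R k)^o) (f F : T -> E) : Prop :=
  exists2 c : I -> E, unconditional_sum p (fun i => tensor (h i) (c i)) f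
                    & unconditional_sum p (fun i => tensor (g i) (c i)) F.

(* The norm of the image of [f], which is unique up to null sets; it is +oo
   (infimum of the empty set) when the image series does not converge. *)
Definition transfer_norm (p : R) (I : choiceType)
    (h g : I -> T -> (scalars R k)^o) (f : T -> E) : \bar R :=
  ereal_inf [set Lp_norm p%:E F | F in transfer_graph p h g f].

End bochner.

Definition umd (R : realType) (k : scalar_kind)
    (E : completeNormedModType (scalars R k)) : Prop :=
  forall p : R, 1 < p -> exists beta : R,
  forall (disp : measure_display) (T : measurableType disp)
    (mu : {measure set T -> \bar R}) (n : nat)
    (F : 'I_n -> set (set T)) (d : 'I_n -> T -> E),
  martingale_difference mu p (fun i j : 'I_n => (i <= j)%N) F d ->
  forall s : 'I_n -> bool,
  (Lp_norm mu p%:E (fun x => (\sum_(i < n) (-1) ^+ s i *: d i x)%R)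
    <= beta%:E * Lp_norm mu p%:E (fun x => (\sum_(i < n) d i x)%R))%E.

Definition qball (R : realType) (X : Type) (d : X -> X -> R) (x : X) (r : R) :
  set X := [set y | d x y < r].

Definition qopen (R : realType) (X : Type) (d : X -> X -> R) (A : set X) : Prop :=
  forall x, A x -> exists2 r : R, 0 < r & qball d x r `<=` A.

Record homogeneous_space (R : realType) (disp : measure_display)
    (X : measurableType disp) := HomogeneousSpace {
  dist : X -> X -> R ;
  vol : {measure set X -> \bar R} ;
  quasi_const : R ;
  doubling_const : R ;
  dist_ge0 : forall x y, 0 <= dist x y ;
  dist_eq0 : forall x y, dist x y = 0 <-> x = y ;
  dist_sym : forall x y, dist x y = dist y x ;
  quasi_const_ge1 : 1 <= quasi_const ;
  dist_triangle : forall x y z,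
    dist x y <= quasi_const * (dist x z + dist z y) ;
  ball_open : forall x r, qopen dist (qball dist x r) ;
  measurable_borel : (measurable : set (set X)) = <<s qopen dist >> ;
  vol_ball_gt0 : forall x r, 0 < r -> (0 < vol (qball dist x (2 * r)))%E ;
  vol_doubling : forall x r, 0 < r ->
    (vol (qball dist x (2 * r)) <= doubling_const%:E * vol (qball dist x r))%E ;
  vol_ball_fin : forall x r, 0 < r ->
    (doubling_const%:E * vol (qball dist x r) < +oo)%E
}.

(* The distance to the complement is an extended real: it is +oo for A = X. *)
Definition inner_boundary (R : realType) (X : Type) (d : X -> X -> R)
    (A : set X) (r : R) : set X :=
  [set x | A x /\ (ereal_inf [set (d x b)%:E | b in ~` A] <= r%:E)%E].

Record dyadic_system (R : realType) (disp : measure_display)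
    (X : measurableType disp) (H : homogeneous_space R X) := DyadicSystem {
  cubes_at : int -> set (set X) ;
  center : int -> set X -> X ;
  ratio : R ;
  C_in : R ;
  C_out : R ;
  C_bd : R ;
  bd_exp : R ;
  max_children : nat ;
  ratio_gt0 : 0 < ratio ;
  ratio_lt1 : ratio < 1 ;
  C_in_gt0 : 0 < C_in ;
  C_out_gt0 : 0 < C_out ;
  C_bd_gt0 : 0 < C_bd ;
  bd_exp_gt0 : 0 < bd_exp ;
  cube_open : forall n A, cubes_at n A -> qopen (dist H) A ;
  center_in : forall n A, cubes_at n A -> A (center n A) ;
  cubes_cover : forall n,
    (vol H).-negligible (~` \bigcup_(A in cubes_at n) A) ;
  cubes_nested : forall k n A B, k <= n -> cubes_at k A -> cubes_at n B ->
    B `<=` A \/ A `&` B = set0 ;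
  cubes_parent : forall k n B, k <= n -> cubes_at n B ->
    exists! A, cubes_at k A /\ B `<=` A ;
  cube_ball_in : forall n A, cubes_at n A ->
    qball (dist H) (center n A) (C_in * ratio ^ n) `<=` A ;
  cube_ball_out : forall n A, cubes_at n A ->
    A `<=` qball (dist H) (center n A) (C_out * ratio ^ n) ;
  cube_boundary : forall n A (t : R), cubes_at n A -> 0 < t ->
    (vol H (inner_boundary (dist H) A (t * ratio ^ n))
      < (C_bd * t `^ bd_exp)%:E * vol H A)%E ;
  cubes_countable : forall n, countable (cubes_at n) ;
  cube_children_le : forall n A, cubes_at n A ->
    ([set B | cubes_at (n + 1) B /\ B `<=` A] #<= `I_max_children)%card ;
  cube_children_cover : forall n A, cubes_at n A ->
    exists C : set (set X), [/\ C `<=` cubes_at (n + 1), (C #<= `I_max_children)%card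
      & (vol H).-negligible (A `+` \bigcup_(B in C) B)]
}.

(* A cube carries its level: the same subset of X may be a cube of several
   levels, and then counts as several cubes. *)
Definition cube (R : realType) (disp : measure_display)
    (X : measurableType disp) (H : homogeneous_space R X)
    (Q : dyadic_system H) : choiceType :=
  set_type [set c : int * set X | cubes_at Q c.1 c.2].

Definition nested (X : Type) (C : set (set X)) : Prop :=
  forall A B, C A -> C B -> [\/ A `&` B = A, A `&` B = B | A `&` B = set0].

Section stripes.
Context (R : realType) (disp : measure_display) (X : measurableType disp).
Context (H : homogeneous_space R X) (Q : dyadic_system H).

Definition lev (A : cube Q) : int := (val A).1.
Definition carrier (A : cube Q) : set X := (val A).2.

Definition star (C : set (cube Q)) : set X := \bigcup_(B in C) carrier B.

Definition stripe_hull (S : cube Q -> set (cube Q)) (j : nat) (A : cube Q) :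
    set (cube Q) :=
  [set B | lev B = lev A + j%:Z /\ carrier B `&` star (S A) !=set0].

Record stripes (K1 K2 eps : R) (lambda M : nat)
    (S : 'I_M -> cube Q -> set (cube Q)) : Prop := {
  stripe_sub : forall m A B, S m A B ->
    carrier B `<=` carrier A /\ lev B = lev A + lambda%:Z ;
  stripe_cover : forall A,
    (vol H).-negligible (carrier A `+` \bigcup_m star (S m A)) ;
  stripe_disjoint : forall A m n, m != n ->
    (vol H).-negligible (star (S m A) `&` star (S n A)) ;
  stripe_comparable : forall A m n,
    (vol H (star (S m A)) <= K1%:E * vol H (star (S n A)))%E ;
  stripe_nested : forall m, nested (range (fun A => star (S m A))) ;
  stripe_hull_le : forall m A (j : nat), (j < lambda)%N ->
    (vol H (star (stripe_hull (S m) j A))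
      <= (K2 * ratio Q `^ (j%:R * eps))%:E * vol H (carrier A))%E
}.

Record base_system (k : scalar_kind) (p : R)
    (h : cube Q -> X -> (scalars R k)^o) : Prop := {
  base_nonzero : forall A, ~ {ae vol H, forall x, h A x = 0} ;
  base_supp : forall A, {ae vol H, forall x, ~ carrier A x -> h A x = 0} ;
  base_mds : martingale_difference_family (vol H) p h
}.

Record stripe_functions (k : scalar_kind) (p Cg : R) (M : nat)
    (S : 'I_M -> cube Q -> set (cube Q))
    (g : 'I_M -> cube Q -> X -> (scalars R k)^o) : Prop := {
  stripe_fun_supp : forall m A,
    {ae vol H, forall x, ~ star (S m A) x -> g m A x = 0} ;
  stripe_fun_mds : martingale_difference_family (vol H) p
    (fun mA : 'I_M * cube Q => g mA.1 mA.2) ;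
  stripe_fun_bound : forall m n A, m != n ->
    (Lp_norm (vol H) +oo (g m A)
      <= (Cg / fine (vol H (star (S n A))))%:E
         * \int[vol H]_x (vnorm (g n A x))%:E)%E
}.

End stripes.

(* Main.v *)
Require Import Defs.
From HB Require Import structures.
From mathcomp Require Import all_boot all_order all_algebra.
From mathcomp Require Import finmap perm.
From mathcomp Require Import all_classical all_reals all_analysis.
From mathcomp Require Import measurable_realfun ess_sup_inf.
From mathcomp.real_closed Require Import complex.
From mathcomp Require Import ring lra zify.
Set Implicit Arguments.
Unset Strict Implicit.
Unset Printing Implicit Defensive.
Import Order.TTheory GRing.Theory Num.Theory.
Import numFieldNormedType.Exports.
Local Open Scope classical_set_scope.
Local Open Scope ring_scope.

(** The strategy is the one of Figiel's rearrangement theorems: randomise, replace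
functions by indicators, and move indicators by Stein's inequality.

Write U_A and V_A for the unions of the m-th and of the n-th stripe of a cube A,
and b_A for the mean of |g^n_A| over V_A.  The UMD property makes the norm of a
finite sum of the c_A g^m_A comparable with the average, over random signs r_A,
of the norm of the sum of the r_A c_A g^m_A ([energy_le_rademacher],
[rademacher_le_energy]).  Under random signs sums can be compared pointwise:
decreasing the moduli of the scalar factors decreases the average up to a
constant ([contraction]).  The bounds on the g^m_A and g^n_A give
|g^m_A| <= Cg b_A on U_A, and |g^n_A| >= b_A / 2 on a part W_A of V_A that has a
fixed proportion of the measure ([large_part_fvol]).  What remains is to pass from
the indicators of the U_A to those of the W_A.

Stein's inequality ([stein]) replaces the indicators of a laminar family D_A by
those of subsets W_A carrying a proportion delta of their measure.  Consider the
sum f of the r_A v_A 1_{W_A} and a filtration revealing, in the order of decreasing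
sets, alternately a set D_A and a sign r_A.  The increment of f at the time when
r_A is revealed is r_A v_A times the conditional expectation of 1_{W_A}, which is
at least delta on D_A; and the UMD property allows to keep every second increment
only ([odd_increments]).  Only finitely many sets matter, so this martingale lives
on a finite set: sign vectors times patterns of membership.

The sets U_A are nested, but the unions of U_A and V_A need not be: a cube less
than lambda levels below A may meet several stripes of A.  The decay of the hulls
shows that the stripes of such cubes that meet a stripe of A have small total
measure compared with it, once only levels far apart are kept.  So the cubes are split according to the residue of their level modulo a
large L and to the parity of the block of lambda consecutive levels they belong to.
Within one of these 2 L groups, deleting from the stripes of A those of the deeper
cubes of the same block costs a small proportion ([removed_small]), and what is left
of the union of U_A and V_A is a laminar family, the cores ([core_laminar]).  Then
1_{U_A} is replaced by its remaining part, which is at most the indicator of the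
core, which is replaced by the remaining part of W_A ([group_rademacher]).  Neither
the number of groups nor the constants involve lambda or M.

Finally the estimate for finite sums is carried over to series: it makes the image
series Cauchy for unconditional convergence, and the Bochner space is complete
([fast_cauchy_lim], [unconditional_comparison]).  Norms are handled through the
integral of their p-th powers, called energy below, for which crude quasi-triangle
inequalities suffice. *)

(** * Real scalars inside real or complex scalars *)

Section scalars.
Context (R : realType) (k : scalar_kind).
Local Notation K := (scalars R k).
Local Notation ofr := (@ofreal R k).

Lemma ofrealD a b : ofr (a + b) = ofr a + ofr b.
Proof. by case: k => //=; apply/eqP; rewrite eq_complex /= addr0 !eqxx. Qed.

Lemma ofreal0 : ofr 0 = 0.
Proof. by case: k. Qed.

Lemma ofreal1 : ofr 1 = 1.
Proof. by case: k. Qed.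

Lemma ofrealN a : ofr (- a) = - ofr a.
Proof. by case: k => //=; apply/eqP; rewrite eq_complex /= oppr0 !eqxx. Qed.

Lemma ofrealM a b : ofr (a * b) = ofr a * ofr b.
Proof.
case: k => //=; apply/eqP; rewrite eq_complex /=.
by rewrite !(mulr0, mul0r, subr0, addr0) !eqxx.
Qed.

Lemma ofrealK a : toreal (ofr a) = a.
Proof. by case: k. Qed.

Lemma ofreal_inj : injective ofr.
Proof. exact: can_inj ofrealK. Qed.

Lemma ofreal_eq0 a : (ofr a == 0) = (a == 0).
Proof. by rewrite -ofreal0 (inj_eq ofreal_inj). Qed.

Lemma ofrealV a : ofr a^-1 = (ofr a)^-1.
Proof.
have [->|a0] := eqVneq a 0; first by rewrite invr0 ofreal0 invr0.
have oa0 : ofr a != 0 by rewrite ofreal_eq0.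
by apply: (mulfI oa0); rewrite -ofrealM !mulfV // ofreal1.
Qed.

Lemma ofreal_sum I (r : seq I) (P : pred I) (F : I -> R) :
  ofr (\sum_(i <- r | P i) F i) = \sum_(i <- r | P i) ofr (F i).
Proof. exact: (big_morph ofr ofrealD ofreal0). Qed.

Lemma ofrealMn a n : ofr (a *+ n) = ofr a *+ n.
Proof. by elim: n => [|n IH]; rewrite ?mulr0n ?ofreal0 // !mulrS ofrealD IH. Qed.

Lemma ofreal_nat n : ofr n%:R = n%:R.
Proof. by rewrite ofrealMn ofreal1. Qed.

Lemma ofreal_sign (b : bool) : ofr ((-1) ^+ b) = (-1) ^+ b.
Proof. by case: b; rewrite ?expr1 ?expr0 ?ofrealN ofreal1. Qed.

Lemma ofreal_le a b : (ofr a <= ofr b) = (a <= b).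
Proof. by case: k => //=; rewrite lecE /= eqxx. Qed.

Lemma ofreal_lt a b : (ofr a < ofr b) = (a < b).
Proof. by case: k => //=; rewrite ltcE /= eqxx. Qed.

Lemma ofreal_ge0 a : (0 <= ofr a) = (0 <= a).
Proof. by rewrite -ofreal0 ofreal_le. Qed.

Lemma norm_ofreal a : `|ofr a| = ofr `|a|.
Proof.
have [a0|a0] := leP 0 a; first by rewrite !ger0_norm ?ofreal_ge0.
rewrite !ltr0_norm // ?ofrealN //.
by rewrite -ofreal0 ofreal_lt.
Qed.

Lemma torealK (z : K) : 0 <= z -> ofr (toreal z) = z.
Proof.
case: k z => //= z z0; apply/eqP; rewrite eq_complex /= eqxx /=.
by move: z0; rewrite lecE /= => /andP[/eqP-> _].
Qed.

Variable E : normedModType K.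
Implicit Types u v : E.

Lemma vnormK v : `|v| = ofr (vnorm v).
Proof. by rewrite /vnorm torealK. Qed.

Lemma vnorm_ge0 v : 0 <= vnorm v.
Proof. by rewrite -ofreal_ge0 -vnormK. Qed.

Lemma vnorm0 : vnorm (0 : E) = 0.
Proof. by apply: ofreal_inj; rewrite -vnormK normr0 ofreal0. Qed.

Lemma vnorm_eq0 v : (vnorm v == 0) = (v == 0).
Proof. by rewrite -ofreal_eq0 -vnormK normr_eq0. Qed.

Lemma vnormN v : vnorm (- v) = vnorm v.
Proof. by rewrite /vnorm normrN. Qed.

Lemma vnormD u v : vnorm (u + v) <= vnorm u + vnorm v.
Proof. by rewrite -ofreal_le ofrealD -!vnormK ler_normD. Qed.

Lemma vnormC u v : vnorm (u - v) = vnorm (v - u).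
Proof. by rewrite -vnormN opprB. Qed.

Lemma vnormZ (a : K) v : vnorm (a *: v) = vnorm (a : K^o) * vnorm v.
Proof.
by apply: ofreal_inj; rewrite ofrealM -(vnormK (a *: v)) normrZ vnormK [in RHS]/vnorm torealK.
Qed.

Lemma vnormZr (a : R) v : vnorm (ofr a *: v) = `|a| * vnorm v.
Proof.
rewrite vnormZ; congr (_ * _); apply: ofreal_inj; rewrite /vnorm torealK //.
exact: norm_ofreal.
Qed.

Lemma vnorm_lip u v : `|vnorm u - vnorm v| <= vnorm (u - v).
Proof.
have h x y : vnorm x - vnorm y <= vnorm (x - y :> E).
  by rewrite lerBlDr -{1}(subrK y x) vnormD.
by rewrite ler_norml h andbT lerNl opprB vnormC h.
Qed.

Lemma cvg_vnormP (u : nat -> E) (l : E) :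
  u n @[n --> \oo] --> l <->
  forall e : R, 0 < e -> exists N, forall n, (N <= n)%N -> vnorm (l - u n) < e.
Proof.
split=> [/cvgrPdist_lt H e e0|H].
  have e0' : 0 < ofr e by rewrite -ofreal0 ofreal_lt.
  have [N _ HN] := H _ e0'.
  by exists N => n /HN /=; rewrite vnormK ofreal_lt.
apply/cvgrPdist_lt => e e0.
have eE : ofr (toreal e) = e by rewrite torealK // ltW.
have e0' : 0 < toreal e by rewrite -ofreal_lt eE ofreal0.
have [N HN] := H _ e0'.
by exists N => // n /= /HN; rewrite vnormK -{2}eE ofreal_lt.
Qed.

End scalars.

(** * Random signs and the contraction principle *)

Definition pnorm (R : realType) (k : scalar_kind) (E : normedModType (scalars R k))
  (p : R) (v : E) : R := vnorm v `^ p.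

Definition rademacher_sum (R : realType) (k : scalar_kind)
    (E : normedModType (scalars R k)) (I : finType) (v : I -> E)
    (s : {ffun I -> bool}) : E :=
  \sum_i (-1) ^+ s i *: v i.

Definition flip (I : finType) (i : I) (s : {ffun I -> bool}) : {ffun I -> bool} :=
  [ffun j => s j (+) (j == i)].

Lemma flipK (I : finType) (i : I) : involutive (flip i).
Proof. by move=> s; apply/ffunP => j; rewrite !ffunE addbK. Qed.

Section pnorm.
Context (R : realType) (k : scalar_kind).
Local Notation K := (scalars R k).
Variables (E : normedModType K) (p : R).
Hypothesis p1 : 1 <= p.
Local Notation ofr := (@ofreal R k).
Implicit Types (u v : E) (a c : R).

Let p0 : 0 < p. Proof. by rewrite (lt_le_trans _ p1). Qed.

Lemma powR_homo a c : 0 <= a -> a <= c -> a `^ p <= c `^ p.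
Proof.
by move=> a0 ac; rewrite ge0_ler_powR ?nnegrE ?(ltW p0) ?(le_trans a0).
Qed.

Lemma pnorm_ge0 v : 0 <= pnorm p v.
Proof. exact: powR_ge0. Qed.

Lemma pnorm0 : pnorm p (0 : E) = 0.
Proof. by rewrite /pnorm vnorm0 powR0 // gt_eqF. Qed.

Lemma pnormN v : pnorm p (- v) = pnorm p v.
Proof. by rewrite /pnorm vnormN. Qed.

Lemma pnormZ (a : K) v : pnorm p (a *: v) = pnorm p (a : K^o) * pnorm p v.
Proof. by rewrite /pnorm vnormZ powRM // vnorm_ge0. Qed.

Lemma pnormZr a v : pnorm p (ofr a *: v) = `|a| `^ p * pnorm p v.
Proof. by rewrite /pnorm vnormZr powRM // vnorm_ge0. Qed.

Lemma pnormD u v : pnorm p (u + v) <= 2 `^ p * (pnorm p u + pnorm p v).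
Proof.
rewrite /pnorm; wlog uv : u v / vnorm u <= vnorm v.
  move=> H; have [|/ltW] := leP (vnorm u) (vnorm v); first exact: H.
  by rewrite addrC [X in _ * X]addrC; exact: H.
apply: (@le_trans _ _ ((2 * vnorm v) `^ p)).
  apply: powR_homo; rewrite ?vnorm_ge0 // (le_trans (vnormD _ _)) //.
  by rewrite mulr2n mulrDl mul1r lerD2r.
rewrite powRM ?vnorm_ge0 // ler_wpM2l ?powR_ge0 //.
by rewrite lerDr powR_ge0.
Qed.

Lemma pnormB u v : pnorm p (u - v) <= 2 `^ p * (pnorm p u + pnorm p v).
Proof. by rewrite -(pnormN v) pnormD. Qed.

Lemma pnorm_sum (I : Type) (r : seq I) (F : I -> E) :
  pnorm p (\sum_(i <- r) F i)
    <= (size r)%:R `^ p * \sum_(i <- r) pnorm p (F i).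
Proof.
have H (M : R) : 0 <= M -> (forall i, List.In i r -> vnorm (F i) <= M) ->
    vnorm (\sum_(i <- r) F i) <= (size r)%:R * M.
  move=> M0; elim: r => [|i r IH] H; first by rewrite big_nil vnorm0 mul0r.
  rewrite big_cons (le_trans (vnormD _ _)) //= -natr1 mulrDl mul1r addrC.
  by apply: lerD; [apply: IH => j jr; apply: H; right | apply: H; left].
pose M := \big[Num.max/0]_(i <- r) vnorm (F i).
have M0 : 0 <= M by exact: bigmax_ge_id.
have MF i : List.In i r -> vnorm (F i) <= M.
  rewrite /M; elim: r {H M M0} => //= j r IH [->|/IH {}IH]; rewrite big_cons.
    by rewrite le_max lexx.
  by rewrite le_max IH orbT.
have MS : M `^ p <= \sum_(i <- r) pnorm p (F i).
  rewrite /M; elim: r {H M M0 MF} => [|j r IH].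
    by rewrite !big_nil powR0 // gt_eqF.
  rewrite !big_cons maxEle; case: ifP => _.
    by rewrite (le_trans IH) // lerDr pnorm_ge0.
  by rewrite lerDl sumr_ge0 // => i _; exact: pnorm_ge0.
rewrite (@le_trans _ _ (((size r)%:R * M) `^ p)) //.
  by apply: powR_homo; rewrite ?vnorm_ge0 //; exact: H.
by rewrite powRM // ler_wpM2l ?powR_ge0.
Qed.

(** The vector is the convex combination of u + v and u - v with the same weights. *)
Lemma pnorm_convex u v a : `|a| <= 1 ->
  pnorm p (u + ofr a *: v)
    <= (1 + a) / 2 * pnorm p (u + v) + (1 - a) / 2 * pnorm p (u - v).
Proof.
rewrite ler_norml => /andP[a1 a2].
pose t := (1 + a) / 2.
have t0 : 0 <= t by rewrite /t; lra.
have t1 : t <= 1 by rewrite /t; lra.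
have -> : (1 - a) / 2 = 1 - t by rewrite /t; lra.
have -> : u + ofr a *: v = ofr t *: (u + v) + ofr (1 - t) *: (u - v).
  rewrite scalerDr scalerBr addrACA -scalerDl -ofrealD -scalerBl -ofrealN -ofrealD.
  rewrite [t + (1 - t)](_ : _ = 1) ?ofreal1 ?scale1r; last by lra.
  by rewrite [t + - (1 - t)](_ : _ = a) // /t; lra.
rewrite /pnorm.
apply: (@le_trans _ _ ((t * vnorm (u + v) + (1 - t) * vnorm (u - v)) `^ p)).
  apply: powR_homo; rewrite ?vnorm_ge0 // (le_trans (vnormD _ _)) //.
  by rewrite !vnormZr ger0_norm // ger0_norm // subr_ge0.
have := @convex_powR R p p1 (Itv01 t0 t1) (vnorm (u + v)) (vnorm (u - v)).
rewrite !inE /= !in_itv /= !vnorm_ge0 => /(_ isT isT).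
by rewrite !convRE /=.
Qed.

Section contraction.
Variable I : finType.
Implicit Types (w : I -> E) (s : {ffun I -> bool}).

Definition rademacher_norm w : R := \sum_s pnorm p (rademacher_sum w s).

Lemma rademacher_norm_ge0 w : 0 <= rademacher_norm w.
Proof. by apply: sumr_ge0 => s _; exact: pnorm_ge0. Qed.

Lemma eq_rademacher_norm w w' : w =1 w' -> rademacher_norm w = rademacher_norm w'.
Proof.
move=> ww'; apply: eq_bigr => s _; congr pnorm.
by apply: eq_bigr => i _; rewrite ww'.
Qed.

Lemma rademacher_sumD w w' s : rademacher_sum (fun i => w i + w' i) s =
  rademacher_sum w s + rademacher_sum w' s.
Proof. by rewrite -big_split; apply: eq_bigr => i _; rewrite scalerDr. Qed.

Lemma rademacher_sumZ (a : K) w s : rademacher_sum (fun i => a *: w i) s =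
  a *: rademacher_sum w s.
Proof.
by rewrite scaler_sumr; apply: eq_bigr => i _; rewrite !scalerA mulrC.
Qed.

(** Averaging over the flip of one sign writes a multiple a *: v of one summand
    as a convex combination of v and - v. *)
Lemma contraction_one w (i : I) a : `|a| <= 1 ->
  rademacher_norm (fun j => if j == i then ofr a *: w j else w j)
    <= rademacher_norm w.
Proof.
move=> a1; set w' := fun j => _.
pose u s := \sum_(j | j != i) (-1) ^+ s j *: w j.
have E1 s : rademacher_sum w s = u s + (-1) ^+ s i *: w i.
  by rewrite /rademacher_sum (bigD1 i) //= addrC.
have E2 s : rademacher_sum w (flip i s) = u s - (-1) ^+ s i *: w i.
  rewrite /rademacher_sum (bigD1 i) //= addrC; congr (_ + _).
    by apply: eq_bigr => j ji; rewrite ffunE (negPf ji) addbF.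
  by rewrite ffunE eqxx addbT signrN scaleNr.
have E3 s : rademacher_sum w' s = u s + ofr a *: ((-1) ^+ s i *: w i).
  rewrite /rademacher_sum (bigD1 i) //= addrC; congr (_ + _).
    by apply: eq_bigr => j ji; rewrite /w' (negPf ji).
  by rewrite /w' eqxx !scalerA mulrC.
have flip_sum : \sum_s pnorm p (rademacher_sum w (flip i s)) = rademacher_norm w.
  by rewrite [RHS](reindex_inj (can_inj (flipK i))).
apply: (@le_trans _ _ (\sum_s ((1 + a) / 2 * pnorm p (rademacher_sum w s)
    + (1 - a) / 2 * pnorm p (rademacher_sum w (flip i s))))).
  by apply: ler_sum => s _; rewrite E1 E2 E3; exact: pnorm_convex.
rewrite big_split /= -!mulr_sumr flip_sum -/(rademacher_norm w) -mulrDl.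
by rewrite [X in X * _](_ : _ = 1) ?mul1r //; lra.
Qed.

Lemma contraction_real w (a : I -> R) : (forall i, `|a i| <= 1) ->
  rademacher_norm (fun i => ofr (a i) *: w i) <= rademacher_norm w.
Proof.
move=> a1.
have H (r : seq I) :
    rademacher_norm (fun i => if i \in r then ofr (a i) *: w i else w i)
      <= rademacher_norm w.
  elim: r => [|i r IH]; first by rewrite (@eq_rademacher_norm _ w).
  apply: le_trans IH; have [ir|ir] := boolP (i \in r).
    rewrite le_eqVlt; apply/orP; left; apply/eqP/eq_rademacher_norm => j.
    by rewrite in_cons; case: eqVneq => // ->; rewrite ir.
  set w' := (X in _ <= rademacher_norm X).
  rewrite (le_trans _ (contraction_one w' i (a1 i))) //.
  rewrite le_eqVlt; apply/orP; left; apply/eqP/eq_rademacher_norm => j.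
  by rewrite in_cons /w'; case: eqVneq => //= ->; rewrite (negPf ir).
rewrite (le_trans _ (H (enum I))) // le_eqVlt; apply/orP; left.
by apply/eqP/eq_rademacher_norm => j; rewrite mem_enum.
Qed.

End contraction.
End pnorm.

(** For complex multipliers the real and the imaginary parts are contracted
    separately, which costs the factor 2 ^ p * 2. *)
Lemma contraction (R : realType) (k : scalar_kind)
    (E : normedModType (scalars R k)) (p c : R) (I : finType) (w : I -> E)
    (a : I -> scalars R k) :
  1 <= p -> (forall i, vnorm (a i : (scalars R k)^o) <= c) ->
  rademacher_norm p (fun i => a i *: w i)
    <= 2 `^ p * 2 * c `^ p * rademacher_norm p w.
Proof.
move=> p1 ac; have p0 : 0 < p by rewrite (lt_le_trans _ p1).
have N0 := rademacher_norm_ge0 p w.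
have [c0|c0] := leP c 0.
  have -> : rademacher_norm p (fun i => a i *: w i) = 0.
    apply: big1 => s _; rewrite /rademacher_sum big1 ?pnorm0 // => i _.
    have := ac i; move=> /le_trans/(_ c0) a0.
    have : vnorm (a i : (scalars R k)^o) == 0 by rewrite eq_le a0 vnorm_ge0.
    by rewrite vnorm_eq0 => /eqP ->; rewrite scale0r scaler0.
  by rewrite !mulr_ge0 // powR_ge0.
have real_case (b : I -> R) : (forall i, `|b i| <= c) ->
    rademacher_norm p (fun i => ofreal k (b i) *: w i)
      <= c `^ p * rademacher_norm p w.
  move=> bc; rewrite (@eq_rademacher_norm _ _ _ _ _ _
    (fun i => ofreal k (b i / c) *: (ofreal k c *: w i))); last first.
    by move=> i; rewrite scalerA -ofrealM divfK // gt_eqF.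
  rewrite (le_trans (contraction_real p1 _ _)) //.
    by move=> i; rewrite normrM normfV (gtr0_norm c0) ler_pdivrMr // mul1r.
  rewrite /rademacher_norm mulr_sumr le_eqVlt; apply/orP; left; apply/eqP.
  by apply: eq_bigr => s _; rewrite rademacher_sumZ pnormZr gtr0_norm.
case: k E w a ac N0 real_case => E w a ac N0 real_case.
  rewrite (le_trans (real_case a _)) //.
  have h : 1 <= 2 `^ p * 2 :> R.
    have := @ler_powR R 2 _ 0 p (ltW p0); rewrite powRr0 ler1n => /(_ isT).
    by lra.
  by rewrite -[_ * 2 * _ * _]mulrA ler_peMl // mulr_ge0 // powR_ge0.
pose re i := complex.Re (a i); pose im i := complex.Im (a i).
have bnd i : `|re i| <= c /\ `|im i| <= c.
  have := ac i; rewrite /vnorm /= /re /im; case: (a i) => x y /=. move=> H.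
  split; apply: le_trans H; rewrite -sqrtr_sqr ler_sqrt ?addr_ge0 ?sqr_ge0 //.
    by rewrite lerDl sqr_ge0.
  by rewrite lerDr sqr_ge0.
pose j : scalars R complex_scalars := ('i%C : R[i]).
have -> : rademacher_norm p (fun i => a i *: w i) = rademacher_norm p (fun i =>
    ofreal complex_scalars (re i) *: w i
    + j *: (ofreal complex_scalars (im i) *: w i)).
  apply: eq_rademacher_norm => i; rewrite scalerA -scalerDl; congr (_ *: _).
  rewrite /= /re /im; case: (a i) => x y /=; apply/eqP; rewrite eq_complex /=.
  by rewrite !(mul0r, mulr0, mul1r, subr0, addr0, add0r) !eqxx.
apply: (@le_trans _ _ (\sum_s 2 `^ p *
   (pnorm p (rademacher_sum (fun i => ofreal complex_scalars (re i) *: w i) s)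
   + pnorm p (rademacher_sum (fun i => ofreal complex_scalars (im i) *: w i) s)))).
  apply: ler_sum => s _; rewrite rademacher_sumD (rademacher_sumZ j).
  rewrite (le_trans (pnormD p1 _ _)) // ler_wpM2l ?powR_ge0 // lerD2l.
  rewrite pnormZ [X in X * _](_ : _ = 1) ?mul1r //.
  by rewrite /pnorm /vnorm /= expr0n expr1n add0r sqrtr1 powR1.
rewrite -mulr_sumr big_split /= -!mulrA ler_wpM2l ?powR_ge0 //.
rewrite (mulr_natl _ 2) mulr2n lerD //.
  by apply: real_case => i; have [] := bnd i.
by apply: real_case => i; have [] := bnd i.
Qed.

(** * Strongly measurable functions and the integral of the p-th power of the norm *)

Definition energy (R : realType) (k : scalar_kind) (E : normedModType (scalars R k))
    (disp : measure_display) (T : measurableType disp)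
    (mu : {measure set T -> \bar R}) (p : R) (f : T -> E) : \bar R :=
  (\int[mu]_x (pnorm p (f x))%:E)%E.

Section strongly_measurable.
Context (R : realType) (k : scalar_kind).
Local Notation K := (scalars R k).
Variables (E : normedModType K).
Context (T : Type) (F : set (set T)).
Local Notation sm := (@strongly_measurable R k E T F).
Implicit Types (f g : T -> E).

Lemma step_fun_cat (s t : seq (set T * E)) x :
  step_fun (s ++ t) x = step_fun s x + step_fun t x.
Proof. by rewrite /step_fun big_cat. Qed.

Lemma strongly_measurableD f g : sm f -> sm g -> sm (fun x => f x + g x).
Proof.
move=> [s sF sf] [t tF tg]; exists (fun n => s n ++ t n).
  by move=> n a; rewrite mem_cat => /orP[/sF|/tF].
move=> x; under eq_fun do rewrite step_fun_cat.
by apply: cvgD; [exact: sf | exact: tg].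
Qed.

Lemma strongly_measurable0 : sm (fun=> 0).
Proof.
exists (fun=> [::]) => // x; rewrite /step_fun.
by under eq_fun do rewrite big_nil; exact: cvg_cst.
Qed.

Lemma strongly_measurable_sum (I : Type) (r : seq I) (u : I -> T -> E) :
  (forall i, sm (u i)) -> sm (fun x => \sum_(i <- r) u i x).
Proof.
move=> ui; elim: r => [|i r IH].
  by under eq_fun do rewrite big_nil; exact: strongly_measurable0.
by under eq_fun do rewrite big_cons; exact: strongly_measurableD.
Qed.

Lemma strongly_measurableZ (c : K) f : sm f -> sm (fun x => c *: f x).
Proof.
move=> [s sF sf]; exists (fun n => [seq (a.1, c *: a.2) | a <- s n]).
  by move=> n _ /mapP[a /sF ? ->].
move=> x; rewrite [X in X @ _](_ : _ = fun n => c *: step_fun (s n) x).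
  by apply: cvgZl_tmp; exact: sf.
apply/funext => n; rewrite /step_fun big_map scaler_sumr.
by apply: eq_bigr => a _ /=; rewrite !scalerA mulrC.
Qed.

Lemma strongly_measurableB f g : sm f -> sm g -> sm (fun x => f x - g x).
Proof.
move=> sf sg; under eq_fun do rewrite -scaleN1r.
by apply: strongly_measurableD => //; exact: strongly_measurableZ.
Qed.

Lemma strongly_measurable_indic (A : set T) (v : E) : F A ->
  sm (fun x => \1_A x *: v).
Proof.
move=> FA; exists (fun=> [:: (A, v)]); first by move=> n a; rewrite inE => /eqP->.
move=> x; rewrite /step_fun; under eq_fun do rewrite big_cons big_nil addr0.
exact: cvg_cst.
Qed.

Lemma strongly_measurable_tensor (h : T -> K^o) (c : E) :
  @strongly_measurable R k K^o T F h -> sm (fun x => (h x : K) *: c).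
Proof.
move=> [s sF sh]; exists (fun n => [seq (a.1, (a.2 : K) *: c) | a <- s n]).
  by move=> n _ /mapP[a /sF ? ->].
move=> x; rewrite [X in X @ _](_ : _ = fun n => (step_fun (s n) x : K) *: c).
  by apply: cvgZr_tmp; exact: sh.
apply/funext => n; rewrite /step_fun big_map scaler_suml.
by apply: eq_bigr => a _ /=; rewrite scalerA.
Qed.

End strongly_measurable.

Section energy.
Context (R : realType) (k : scalar_kind).
Local Notation K := (scalars R k).
Variables (E : normedModType K).
Context (disp : measure_display) (T : measurableType disp).
Variables (mu : {measure set T -> \bar R}) (p : R).
Hypothesis p1 : 1 <= p.
Local Notation sm := (@strongly_measurable R k E T measurable).
Local Notation energy := (energy mu p).
Implicit Types (f g : T -> E).

Let p0 : 0 < p. Proof. by rewrite (lt_le_trans _ p1). Qed.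

(** Any function of a step function takes finitely many values on measurable
    sets; this is generalised over phi so that the list can be consumed. *)
Lemma measurable_step_fun (s : seq (set T * E)) (phi : E -> R) :
  (forall a, a \in s -> measurable a.1) ->
  measurable_fun setT (fun x => phi (step_fun s x)).
Proof.
elim: s phi => [|a s IH] phi sm.
  by rewrite /step_fun; under eq_fun do rewrite big_nil; exact: measurable_cst.
have ma : measurable a.1 by apply: sm; rewrite mem_head.
have ms b : b \in s -> measurable b.1 by move=> bs; apply: sm; rewrite inE bs orbT.
have -> : (fun x => phi (step_fun (a :: s) x)) = (fun x =>
    if x \in a.1 then phi (a.2 + step_fun s x) else phi (step_fun s x)).
  apply/funext => x; rewrite /step_fun big_cons indicE.
  by case: ifP => _; rewrite ?scale1r ?scale0r ?add0r.
apply: measurable_fun_ifT; last 2 first.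
- exact: (IH (fun v => phi (a.2 + v))).
- exact: IH.
apply: (measurable_fun_bool true) => /=.
rewrite setTI [X in measurable X](_ : _ = a.1) //.
by apply/seteqP; split => x; [exact: set_mem | exact: mem_set].
Qed.

Lemma measurable_vnorm f : sm f -> measurable_fun setT (fun x => vnorm (f x)).
Proof.
move=> [s sF sf]; apply: (measurable_fun_cvg
    (h := fun n x => vnorm (step_fun (s n) x))) => //.
  by move=> n; apply: measurable_step_fun => a /sF.
move=> x _; apply/cvgrPdist_lt => e e0.
have [N HN] := (cvg_vnormP _ _).1 (sf x) e e0.
by exists N => // n /= /HN; apply: le_lt_trans; exact: vnorm_lip.
Qed.

Lemma measurable_pnorm f : sm f -> measurable_fun setT (fun x => pnorm p (f x)).
Proof.
move=> /measurable_vnorm mf.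
exact: (@measurableT_comp _ _ _ _ _ _ (@powR R ^~ p)).
Qed.

Lemma measurable_epnorm f : sm f ->
  measurable_fun setT (fun x => (pnorm p (f x))%:E).
Proof. by move=> /measurable_pnorm mf; exact: measurableT_comp. Qed.

Lemma energy_ge0 f : (0 <= energy f)%E.
Proof. by apply: integral_ge0 => x _; rewrite lee_fin pnorm_ge0. Qed.

Lemma energyZr (c : R) f : sm f ->
  energy (fun x => ofreal k c *: f x) = ((`|c| `^ p)%:E * energy f)%E.
Proof.
move=> mf; rewrite /energy -ge0_integralZl_EFin ?powR_ge0 //; last 2 first.
- by move=> x _; rewrite lee_fin pnorm_ge0.
- exact: measurable_epnorm.
by apply: eq_integral => x _; rewrite pnormZr EFinM.
Qed.

Lemma energy_sum (I : Type) (r : seq I) (u : I -> T -> E) :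
  (forall i, sm (u i)) ->
  (energy (fun x => (\sum_(i <- r) u i x)%R)
    <= ((size r)%:R `^ p)%:E * \sum_(i <- r) energy (u i))%E.
Proof.
move=> mu_; rewrite -ge0_integral_sum //; last 2 first.
- by move=> i; exact: measurable_epnorm.
- by move=> i x _; rewrite lee_fin pnorm_ge0.
have ms : measurable_fun setT (fun x => (\sum_(i <- r) (pnorm p (u i x))%:E)%E).
  by apply: emeasurable_sum => i; exact: measurable_epnorm.
rewrite -ge0_integralZl_EFin ?powR_ge0 //; last first.
  by move=> x _; apply: sume_ge0 => i _; rewrite lee_fin pnorm_ge0.
apply: ge0_le_integral => //.
- by move=> x _; rewrite lee_fin pnorm_ge0.
- exact/measurable_epnorm/strongly_measurable_sum.
- exact: measurable_funeM.
by move=> x _; rewrite sumEFin -EFinM lee_fin; exact: pnorm_sum.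
Qed.

Lemma energyD f g : sm f -> sm g ->
  (energy (fun x => (f x + g x)%R) <= (2 `^ p)%:E * (energy f + energy g))%E.
Proof.
move=> mf mg; rewrite -ge0_integralD //; last 4 first.
- by move=> x _; rewrite lee_fin pnorm_ge0.
- exact: measurable_epnorm.
- by move=> x _; rewrite lee_fin pnorm_ge0.
- exact: measurable_epnorm.
have mfg : measurable_fun setT (fun x => ((pnorm p (f x))%:E + (pnorm p (g x))%:E)%E).
  by apply: emeasurable_funD; exact: measurable_epnorm.
rewrite -ge0_integralZl_EFin ?powR_ge0 //; last first.
  by move=> x _; rewrite -EFinD lee_fin addr_ge0 // pnorm_ge0.
apply: ge0_le_integral => //.
- by move=> x _; rewrite lee_fin pnorm_ge0.
- exact/measurable_epnorm/strongly_measurableD.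
- exact: measurable_funeM.
by move=> x _; rewrite -EFinD -EFinM lee_fin; exact: pnormD.
Qed.

Lemma energyN f : energy (fun x => - f x) = energy f.
Proof. by apply: eq_integral => x _; rewrite pnormN. Qed.

Lemma energyB f g : sm f -> sm g ->
  (energy (fun x => (f x - g x)%R) <= (2 `^ p)%:E * (energy f + energy g))%E.
Proof.
move=> mf mg; have mNg : sm (fun x => - g x).
  by under eq_fun do rewrite -scaleN1r; exact: strongly_measurableZ.
by have := energyD mf mNg; rewrite energyN.
Qed.

Lemma Lp_norm_energy f : (Lp_norm mu p%:E f `^ p)%E = energy f.
Proof.
have pN0 : p != 0 by rewrite gt_eqF.
rewrite /Lp_norm [LHS]powR_Lnorm //; apply: eq_integral => x _ /=.
by rewrite ger0_norm // vnorm_ge0.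
Qed.

Let i0 (x : \bar R) : (0 <= x)%E -> x \in `[0%E, +oo%E].
Proof. by move=> x0; rewrite in_itv /= x0 leey. Qed.

Lemma Lp_norm_le (c : R) f g : 0 <= c ->
  (Lp_norm mu p%:E f <= c%:E * Lp_norm mu p%:E g)%E
    <-> (energy f <= (c `^ p)%:E * energy g)%E.
Proof.
move=> c0; rewrite -!Lp_norm_energy -poweR_EFin -poweRM ?lee_fin ?Lnorm_ge0 //.
have h0 : (0 <= c%:E * Lp_norm mu p%:E g)%E by rewrite mule_ge0 ?lee_fin ?Lnorm_ge0.
split=> H.
  by apply: gt0_ler_poweR => //; rewrite ?(ltW p0) ?i0 // Lnorm_ge0.
have := @gt0_ler_poweR R p^-1; rewrite invr_ge0 (ltW p0) => /(_ isT) Q.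
have := Q _ _ _ _ H; rewrite -!poweRrM mulfV ?gt_eqF // !poweRe1 ?Lnorm_ge0 //.
by apply; rewrite i0 // poweR_ge0.
Qed.

Lemma Lp_norm_lt (e : R) f : 0 < e ->
  (Lp_norm mu p%:E f < e%:E)%E <-> (energy f < (e `^ p)%:E)%E.
Proof.
move=> e0; rewrite -Lp_norm_energy -poweR_EFin.
have pp := @gt0_ler_poweR R.
have N0 : (0 <= Lp_norm mu p%:E f)%E by exact: Lnorm_ge0.
split=> H; rewrite ltNge; apply/negP => H'; move: H; apply/negP; rewrite -leNgt.
  have := @gt0_ler_poweR R p^-1; rewrite invr_ge0 (ltW p0) => /(_ isT) Q.
  have := Q _ _ _ _ H'; rewrite -!poweRrM mulfV ?gt_eqF // !poweRe1 //.
    by apply; apply: i0; exact: poweR_ge0.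
  by rewrite lee_fin ltW.
by apply: pp (ltW p0) _ _ _ _ H'; rewrite i0 // lee_fin ltW.
Qed.

Lemma Lp_norm_lty f : (Lp_norm mu p%:E f < +oo)%E <-> (energy f < +oo)%E.
Proof.
rewrite -Lp_norm_energy; split; first exact: poweR_lty.
by apply: lty_poweRy; rewrite gt_eqF.
Qed.

End energy.

(** * The UMD inequality and finite measure spaces *)

(** The UMD inequality raised to the power p, so that both sides are integrals and
    can be averaged over signs. *)
Definition umd_constant (R : realType) (k : scalar_kind)
    (E : normedModType (scalars R k)) (p beta : R) : Prop :=
  forall (disp : measure_display) (T : measurableType disp)
    (mu : {measure set T -> \bar R}) (n : nat)
    (F : 'I_n -> set (set T)) (d : 'I_n -> T -> E),
  martingale_difference mu p (fun i j : 'I_n => (i <= j)%N) F d ->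
  forall s : 'I_n -> bool,
  (energy mu p (fun x => (\sum_(i < n) (-1) ^+ s i *: d i x)%R)
    <= beta%:E * energy mu p (fun x => (\sum_(i < n) d i x)%R))%E.

Lemma umd_constant_exists (R : realType) (k : scalar_kind)
    (E : completeNormedModType (scalars R k)) (p : R) :
  umd E -> 1 < p -> exists2 beta : R, 1 <= beta & umd_constant E p beta.
Proof.
move=> E_umd p1; have [b0 Hb0] := E_umd p p1; have p1' := ltW p1.
pose b := Num.max b0 1; have b1 : 1 <= b by rewrite le_max lexx orbT.
have b_ge0 : 0 <= b by rewrite (le_trans _ b1).
exists (b `^ p).
  by have := powR_homo p1' ler01 b1; rewrite powR1.
move=> disp T mu n F d md s; apply/(Lp_norm_le mu p1') => //.
rewrite (le_trans (Hb0 _ _ _ _ _ _ md s)) // lee_wpmul2r ?Lnorm_ge0 //.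
by rewrite lee_fin le_max lexx.
Qed.

(** A finite set with the discrete sigma-algebra; the point makes it a
    measurable type. *)
Definition discrete_fintype (T : finType) (pt : T) : Type := T.

Section discrete_fintype.
Variables (T : finType) (pt : T).
HB.instance Definition _ := Choice.on (discrete_fintype pt).
HB.instance Definition _ := isPointed.Build (discrete_fintype pt) pt.
HB.instance Definition _ := @isMeasurable.Build default_measure_display
  (discrete_fintype pt) discrete_measurable discrete_measurable0
  discrete_measurableC discrete_measurableU.
End discrete_fintype.

Section weighted_measure.
Context (R : realType) (T : finType) (pt : T) (w : T -> {nonneg R}).
Local Notation D := (discrete_fintype pt).

Definition point_masses (i : nat) : {measure set D -> \bar R} :=
  mscale (w (nth pt (enum T) i)) (dirac (nth pt (enum T) i : D)).

Definition weighted_measure : {measure set D -> \bar R} := msum point_masses #|T|.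

Lemma big_enum_nth (F : T -> \bar R) :
  (\sum_(i < #|T|) F (nth pt (enum T) i) = \sum_x F x)%E.
Proof.
rewrite -[RHS]big_enum /= (big_nth pt) -cardE big_mkord.
by apply: eq_bigr.
Qed.

Lemma integral_weighted (B : set D) (f : D -> \bar R) :
  (forall x, 0 <= f x)%E ->
  (\int[weighted_measure]_(x in B) f x
    = \sum_(x : T | (x : D) \in B) (w x)%:num%:E * f x)%E.
Proof.
move=> f0; rewrite [LHS]ge0_integral_measure_sum //.
pose G (x : T) := if (x : D) \in B then ((w x)%:num%:E * f x)%E else 0%E.
transitivity (\sum_(i < #|T|) G (nth pt (enum T) i))%E; last first.
  by rewrite (big_enum_nth G) [RHS]big_mkcond.
apply: eq_bigr => i _; rewrite /G [LHS]ge0_integral_mscale // integral_dirac //.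
by rewrite diracE; case: ifP => _; rewrite ?mul1e // mul0e mule0.
Qed.

Lemma weighted_measureE (B : set D) :
  (weighted_measure B = (\sum_(x : T | (x : D) \in B) (w x)%:num)%:E)%E.
Proof.
rewrite -sumEFin -[LHS]mul1e -integral_cst // integral_weighted //.
by apply: eq_bigr => x _; rewrite mule1.
Qed.

Lemma weighted_measure_fin (B : set D) : (weighted_measure B < +oo)%E.
Proof. by rewrite weighted_measureE ltry. Qed.

Context (k : scalar_kind) (E : normedModType (scalars R k)).

Lemma energy_weighted (p : R) (f : D -> E) :
  energy weighted_measure p f
    = (\sum_(x : T) (w x)%:num * pnorm p (f x))%:E.
Proof.
rewrite /energy integral_weighted; last by move=> x; rewrite lee_fin pnorm_ge0.
rewrite -sumEFin; apply: eq_big => [x|x _]; last by rewrite EFinM.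
by rewrite in_setT.
Qed.

Section key.
Variables (Key : finType).
Implicit Types (ky : T -> Key) (f : T -> E).

(** The algebra of the partition of T into the fibres of a map. *)
Definition key_algebra ky : set (set D) :=
  [set B | forall x y, ky x = ky y -> B x -> B y].

Lemma key_algebra_sigma_finite ky :
  sigma_finite_subalgebra weighted_measure (key_algebra ky).
Proof.
split => //; last first.
  exists (fun=> setT); first by rewrite bigcup_const.
  by move=> n; split => //; exact: weighted_measure_fin.
split => //.
- move=> A HA; rewrite setTD => x y xy nAx Ay; apply: nAx.
  exact: HA (esym xy) Ay.
- move=> A HA x y xy [n _ An]; exists n => //; exact: HA xy An.
Qed.

Lemma key_algebra_measurable ky f :
  (forall x y, ky x = ky y -> f x = f y) ->
  @strongly_measurable R k E D (key_algebra ky) f.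
Proof.
move=> Hf; pose v (q : Key) := if [pick x | ky x == q] is Some x then f x else 0.
exists (fun=> [seq ([set x : D | ky x = q], v q) | q <- enum Key]).
  by move=> _ _ /mapP[q _ ->] x y /= ->.
move=> x; rewrite [X in X @ _](_ : _ = fun=> f x); first exact: cvg_cst.
apply/funext => _; rewrite /step_fun big_map big_enum /= (bigD1 (ky x)) //=.
rewrite big1 ?addr0.
  rewrite indicE mem_set //= scale1r /v; case: pickP => [y /eqP/Hf //|].
  by move=> /(_ x); rewrite eqxx.
move=> q qx; rewrite indicE memNset ?scale0r //= => xq.
by rewrite xq eqxx in qx.
Qed.

End key.

Lemma discrete_strongly_measurable (f : T -> E) :
  @strongly_measurable R k E D measurable f.
Proof.
have [s sF sf] := @key_algebra_measurable T id f (fun x y xy => congr1 f xy).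
by exists s.
Qed.

Lemma discrete_in_Lp (p : R) (f : T -> E) : 1 <= p ->
  in_Lp weighted_measure p (f : D -> E).
Proof.
move=> p1; split; first exact: discrete_strongly_measurable.
by apply/(Lp_norm_lty weighted_measure p1); rewrite energy_weighted ltry.
Qed.

(** On a finite set every function is its own approximating step function. *)
Lemma discrete_bochner_integral (B : set D) (f : T -> E) :
  is_bochner_integral weighted_measure B f
    (\sum_(x : T | (x : D) \in B) ofreal k (w x)%:num *: f x).
Proof.
split; first exact: discrete_strongly_measurable.
exists (fun=> [seq ([set x : D], f x) | x <- enum T]).
have sE x : step_fun [seq ([set y : D], f y) | y <- enum T] x = f x.
  rewrite /step_fun big_map big_enum /= (bigD1 (x : T)) //= big1 ?addr0.
    by rewrite indicE mem_set //= scale1r.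
  move=> y yx; rewrite indicE memNset ?scale0r //= => xy.
  by rewrite xy eqxx in yx.
split.
- by move=> _ _ /mapP[x _ ->]; split => //; exact: weighted_measure_fin.
- rewrite [X in X @ _](_ : _ = fun=> 0%E); first exact: cvg_cst.
  apply/funext => _; apply: integral0_eq => x _; rewrite sE subrr vnorm0 //.
- rewrite [X in X @ _](_ : _ = fun=>
    \sum_(x : T | (x : D) \in B) ofreal k (w x)%:num *: f x); first exact: cvg_cst.
  apply/funext => _; rewrite big_map big_enum /= [RHS]big_mkcond.
  apply: eq_bigr => x _; rewrite weighted_measureE /=.
  case: ifPn => xB.
    rewrite (big_pred1 x) // => y /=; apply/idP/eqP => [|->].
      by rewrite inE => -[].
    by rewrite inE; split => //; exact: set_mem.
  rewrite big1 ?ofreal0 ?scale0r // => y; rewrite inE => -[yx By].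
  by move: xB; rewrite -yx mem_set.
Qed.

End weighted_measure.

(** * Martingales on finite sets *)

Section finite_martingale.
Context (R : realType) (k : scalar_kind) (E : normedModType (scalars R k)).
Context (T Key : finType) (pt : T) (w : T -> {nonneg R}).
Implicit Types (f : T -> E) (ky : T -> Key).
Local Notation ofr := (@ofreal R k).

(** The conditional expectation on the fibres of ky; it vanishes on fibres of
    weight zero, where the inverse of 0 is 0. *)
Definition cond_mean ky f (x : T) : E :=
  (ofr (\sum_(y | ky y == ky x) (w y)%:num))^-1 *:
    \sum_(y | ky y == ky x) ofr (w y)%:num *: f y.

Lemma cond_mean_key ky f x y : ky x = ky y -> cond_mean ky f x = cond_mean ky f y.
Proof. by rewrite /cond_mean => ->. Qed.

(** Exchanging the two sums leaves, at each y, the quotient of the weight of the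
    fibre of y by itself; where it is 0 / 0 the point y has no weight. *)
Lemma cond_mean_integral ky f (B : pred T) :
  (forall x y, ky x = ky y -> B x -> B y) ->
  \sum_(x | B x) ofr (w x)%:num *: cond_mean ky f x
    = \sum_(x | B x) ofr (w x)%:num *: f x.
Proof.
move=> HB; pose W x := \sum_(y | ky y == ky x) (w y)%:num.
have -> : \sum_(x | B x) ofr (w x)%:num *: cond_mean ky f x =
    \sum_(x | B x) \sum_(y | ky y == ky x)
       ofr ((w x)%:num / W x) *: (ofr (w y)%:num *: f y).
  apply: eq_bigr => x _; rewrite /cond_mean -/(W x) scalerA scaler_sumr.
  by apply: eq_bigr => y _; rewrite ofrealM ofrealV.
rewrite (exchange_big_dep B) /=; last first.
  by move=> x y Bx /eqP yx; exact: HB (esym yx) Bx.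
apply: eq_bigr => y By; rewrite -scaler_suml -ofreal_sum scalerA -ofrealM.
congr (ofr _ *: _).
have -> : \sum_(x | B x && (ky y == ky x)) (w x)%:num / W x = W y / W y.
  rewrite /W mulr_suml; apply: eq_big => x.
    rewrite eq_sym; case: eqP => [yx|]; rewrite ?andbF // andbT.
    exact: HB (esym yx) By.
  by move=> /andP[_ /eqP->].
have [W0|W0] := eqVneq (W y) 0; last by rewrite divff // mul1r.
have -> : (w y)%:num = 0 by apply: (psumr_eq0P _ W0) => //=.
by rewrite mulr0.
Qed.

Lemma cond_mean_inj ky f x : injective ky -> (w x)%:num != 0 ->
  cond_mean ky f x = f x.
Proof.
move=> kyI wx; rewrite /cond_mean.
rewrite (big_pred1 x) => [|y]; last by rewrite /= (inj_eq kyI).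
rewrite (big_pred1 x) => [|y]; last by rewrite /= (inj_eq kyI).
by rewrite scalerA -ofrealV -ofrealM mulVf // ofreal1 scale1r.
Qed.

Variable key : nat -> T -> Key.
Hypothesis key_refines : forall i j x y, (i <= j)%N -> key j x = key j y ->
  key i x = key i y.

Definition mean_increment f (i : nat) : T -> E := fun x =>
  cond_mean (key i) f x - if i is j.+1 then cond_mean (key j) f x else 0.

Lemma sum_mean_increment f n x :
  \sum_(i < n.+1) mean_increment f i x = cond_mean (key n) f x.
Proof.
elim: n => [|n IH]; first by rewrite big_ord1 /mean_increment subr0.
by rewrite big_ord_recr /= IH /mean_increment addrC subrK.
Qed.

Lemma mean_increment_mds p f n : 1 <= p ->
  martingale_difference (weighted_measure pt w) p
    (fun i j : 'I_n => (i <= j)%N)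
    (fun i : 'I_n => key_algebra (pt := pt) (key i))
    (fun i : 'I_n => mean_increment f i).
Proof.
move=> p1.
have adapted i : @strongly_measurable R k E (discrete_fintype pt)
    (key_algebra (pt := pt) (key i)) (mean_increment f i).
  apply: key_algebra_measurable => x y xy; rewrite /mean_increment.
  rewrite (cond_mean_key f xy); congr (_ - _); case: i xy => // i xy.
  exact/cond_mean_key/(key_refines _ xy).
split.
- by move=> i; exact: key_algebra_sigma_finite.
- by move=> i j ij B HB x y xy; apply: HB; exact: key_refines xy.
- by move=> i; exact: discrete_in_Lp.
- by move=> i; exact: adapted.
move=> i j ij nij; split; first exact: strongly_measurable0.
move=> B HB _; exists 0; last first.
  have := @discrete_bochner_integral R T pt w k E B (fun=> 0).
  by rewrite big1 // => x _; rewrite scaler0.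
have {nij} ij1 : (i < j)%N.
  by rewrite ltn_neqAle ij andbT; apply/negP => /eqP/val_inj.
have := @discrete_bochner_integral R T pt w k E B (mean_increment f j).
rewrite [X in is_bochner_integral _ _ _ X](_ : _ = 0) //.
case: (nat_of_ord j) ij1 => // j' ij'; rewrite /mean_increment.
under eq_bigr do rewrite scalerBr.
have HBi m x y : (i <= m)%N -> key m x = key m y ->
    (x : discrete_fintype pt) \in B -> (y : discrete_fintype pt) \in B.
  move=> im xy /set_mem Bx; apply/mem_set; apply: HB Bx.
  exact: key_refines im xy.
rewrite sumrB (@cond_mean_integral (key j'.+1)); last first.
  by move=> x y; apply: HBi; rewrite ltnW.
rewrite (@cond_mean_integral (key j')) ?subrr //.
by move=> x y; exact: HBi.
Qed.

Variables (p beta : R).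
Hypotheses (p1 : 1 <= p) (beta0 : 0 <= beta) (Hbeta : umd_constant E p beta).

(** Half the difference of the plain and of the alternating sum of the
    increments keeps the increments of odd index. *)
Lemma odd_increments f N : injective (key N.*2) ->
  \sum_x (w x)%:num * pnorm p (\sum_(i < N)
     (cond_mean (key i.*2.+1) f x - cond_mean (key i.*2) f x))
  <= (1 + beta) * \sum_x (w x)%:num * pnorm p (f x).
Proof.
move=> key_inj.
have := Hbeta (mean_increment_mds f N.*2.+1 p1) (fun i => odd i).
rewrite !energy_weighted -EFinM lee_fin => umd_odd.
have telescope (a b c d : E) : a + c + d - (b - c + d) = a - b + (c + c).
  by rewrite !opprD opprK addrACA subrr addr0 addrACA.
pose full x := \sum_(i < N.*2.+1) mean_increment f i x.
pose alt x := \sum_(i < N.*2.+1) (-1) ^+ odd i *: mean_increment f i x.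
have oddE x : ofr 2 *: \sum_(i < N)
   (cond_mean (key i.*2.+1) f x - cond_mean (key i.*2) f x) = full x - alt x.
  rewrite /full /alt; elim: N {key_inj umd_odd full alt} => [|N IH].
    by rewrite big_ord0 scaler0 !big_ord1 /= expr0 scale1r subrr.
  rewrite doubleS big_ord_recr /= scalerDr IH.
  rewrite 2![in X in _ = X - _]big_ord_recr /= 2![in X in _ = _ - X]big_ord_recr /=.
  rewrite negbK odd_double /= expr0 expr1 scale1r scaleN1r.
  set a := \sum_(i < _) _; set b := \sum_(i < _) _; set c := mean_increment f _ x.
  set d := mean_increment f _ x.
  rewrite telescope.
  congr (_ + _); rewrite (ofreal_nat R k 2) scaler_nat mulr2n.
  by rewrite /c /mean_increment.
have fullE : \sum_x (w x)%:num * pnorm p (full x) = \sum_x (w x)%:num * pnorm p (f x).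
  apply: eq_bigr => x _; have [->|wx] := eqVneq (w x)%:num 0; first by rewrite !mul0r.
  by rewrite /full sum_mean_increment cond_mean_inj.
rewrite mulrDl mul1r -fullE.
apply: (le_trans _ (lerD (lexx _) umd_odd)).
rewrite -big_split /=; apply: ler_sum => x _; rewrite -mulrDr ler_wpM2l //.
have c0 : 0 < 2 `^ p :> R by rewrite powR_gt0.
rewrite -(ler_pM2l c0) (le_trans _ (pnormB p1 (full x) (alt x))) //.
by rewrite -oddE pnormZr ger0_norm.
Qed.

End finite_martingale.

(** * Stein's inequality for laminar families *)

Section finite_stein.
Context (R : realType) (k : scalar_kind) (E : normedModType (scalars R k)).
Context (P : finType) (pt : P) (u : P -> {nonneg R}).
Variables (p beta : R).
Hypotheses (p1 : 1 <= p) (beta0 : 0 <= beta) (Hbeta : umd_constant E p beta).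
Local Notation ofr := (@ofreal R k).

Section sorted.
Variables (N : nat) (D W : 'I_N -> {set P}) (v : 'I_N -> E).
Hypothesis WD : forall i, W i \subset D i.
Hypothesis D_sorted : forall i j : 'I_N, (i < j)%N ->
  D j \subset D i \/ fintype.disjoint (mem (D i)) (mem (D j)).

Local Notation Sgn := {ffun 'I_N -> bool}.
Local Notation T := (Sgn * P)%type.

(** At even time 2 i the signs before i and the sets up to i are known; the
    next time reveals the i-th sign only.  The final time reveals everything. *)
Definition stein_key (t : nat) (x : T) : Sgn * Sgn * option P :=
  ([ffun j : 'I_N => (j < uphalf t)%N && x.1 j],
   [ffun j : 'I_N => (j < t./2.+1)%N && (x.2 \in D j)],
   if (t < N.*2)%N then None else Some x.2).

Definition same_signs (m : nat) (s s' : Sgn) :=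
  [forall j : 'I_N, (j < m)%N ==> (s' j == s j)].

Definition same_sets (m : nat) (x x' : P) :=
  [forall j : 'I_N, (j < m)%N ==> ((x' \in D j) == (x \in D j))].

Lemma stein_key_eq t (x y : T) : (t < N.*2)%N ->
  (stein_key t y == stein_key t x)
    = same_signs (uphalf t) x.1 y.1 && same_sets t./2.+1 x.2 y.2.
Proof.
move=> tN; rewrite /stein_key tN !xpair_eqE eqxx andbT; congr (_ && _).
  apply/eqP/forallP => [H j|H].
    have := congr1 (fun g : Sgn => g j) H; rewrite /= !ffunE.
    by case: ltnP => //= _ ->.
  by apply/ffunP => j; rewrite !ffunE; have := H j; case: ltnP => //= _ /eqP.
apply/eqP/forallP => [H j|H].
  have := congr1 (fun g : Sgn => g j) H; rewrite /= !ffunE.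
  by case: ltnP => //= _ ->.
by apply/ffunP => j; rewrite !ffunE; have := H j; case: ltnP => //= _ /eqP.
Qed.

Lemma stein_key_refines i j (x y : T) : (i <= j)%N ->
  stein_key j x = stein_key j y -> stein_key i x = stein_key i y.
Proof.
move=> ij [/ffunP H1 /ffunP H2 H3]; congr (_, _, _).
- apply/ffunP => l; have := H1 l; rewrite !ffunE.
  case: (ltnP l (uphalf i)) => //= li.
  by rewrite (leq_trans li) //; lia.
- apply/ffunP => l; have := H2 l; rewrite !ffunE.
  case: (ltnP l i./2.+1) => //= li.
  by rewrite (leq_trans li) //; lia.
case: ifP => // /negbT iN; move: H3; rewrite (_ : (j < N.*2)%N = false) //.
by apply/negbTE; apply: contra iN => jN; exact: leq_ltn_trans jN.
Qed.

Lemma stein_key_inj : injective (stein_key N.*2).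
Proof.
move=> [s x] [s' x'] [/ffunP H1 _]; rewrite ltnn => -[->]; congr (_, _).
apply/ffunP => j; have := H1 j; rewrite !ffunE.
by rewrite (_ : (j < _)%N) // uphalf_double.
Qed.

Definition sign_sum (m : nat) (s : Sgn) (j : 'I_N) : R :=
  \sum_(s' | same_signs m s s') (-1) ^+ s' j.

Lemma same_signs_refl m s : same_signs m s s.
Proof. by apply/forallP => j; rewrite eqxx implybT. Qed.

Lemma sign_sum_known m s (j : 'I_N) : (j < m)%N ->
  sign_sum m s j = #|[pred s' | same_signs m s s']|%:R * (-1) ^+ s j.
Proof.
move=> jm; rewrite /sign_sum -sum1_card natr_sum mulr_suml.
by apply: eq_bigr => s' /forallP/(_ j); rewrite jm => /eqP->; rewrite mul1r.
Qed.

(** Flipping the j-th sign is an involution of the class that changes the sign of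
    the sum. *)
Lemma sign_sum_unknown m s (j : 'I_N) : (m <= j)%N -> sign_sum m s j = 0.
Proof.
move=> mj; have H : sign_sum m s j = - sign_sum m s j.
  rewrite {1}/sign_sum (reindex_inj (can_inj (flipK j))) /= -sumrN.
  apply: eq_big => s'; last by rewrite !ffunE eqxx addbT signrN.
  apply: eq_forallb => l; have [lm|//] := ltnP l m.
  by rewrite ffunE; case: (eqVneq l j) lm => [->|]; rewrite ?addbF // ltnNge mj.
lra.
Qed.

Definition stein_fun (x : T) : E :=
  \sum_j (-1) ^+ x.1 j *: (if x.2 \in W j then v j else 0).

Definition pair_weight (x : T) : {nonneg R} := u x.2.

(** Signs and points are independent, so each conditional mean factors. *)
Lemma stein_cond_mean t (x : T) : (t < N.*2)%N ->
  cond_mean pair_weight (stein_key t) stein_fun x = \sum_j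
    ofr (sign_sum (uphalf t) x.1 j
        / #|[pred s | same_signs (uphalf t) x.1 s]|%:R
      * ((\sum_(y | same_sets t./2.+1 x.2 y && (y \in W j)) (u y)%:num)
         / \sum_(y | same_sets t./2.+1 x.2 y) (u y)%:num)) *: v j.
Proof.
move=> tN; rewrite /cond_mean.
under eq_bigl do rewrite stein_key_eq //.
under [X in _ *: X]eq_bigl do rewrite stein_key_eq //.
set A := same_signs _ x.1; set B := same_sets _ x.2.
have -> : \sum_(y | A y.1 && B y.2) (pair_weight y)%:num
    = #|[pred s | A s]|%:R * \sum_(y | B y) (u y)%:num.
  rewrite -(pair_big A B (fun _ y => (u y)%:num)) /= sumr_const.
  by rewrite mulr_natl.
have -> : \sum_(y | A y.1 && B y.2) ofr (pair_weight y)%:num *: stein_fun y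
    = \sum_j ofr ((sign_sum (uphalf t) x.1 j)
      * \sum_(y | B y && (y \in W j)) (u y)%:num) *: v j.
  under eq_bigr do rewrite scaler_sumr.
  rewrite exchange_big; apply: eq_bigr => j _ /=.
  rewrite -(pair_big A B (fun s y => ofr (u y)%:num *: ((-1) ^+ s j *:
    (if y \in W j then v j else 0)))) /=.
  rewrite ofrealM -scalerA /sign_sum ofreal_sum scaler_suml.
  apply: eq_bigr => s _; rewrite ofreal_sign ofreal_sum scaler_suml scaler_sumr.
  rewrite [RHS]big_mkcondr /=; apply: eq_bigr => y _.
  by case: ifP => _; rewrite ?scaler0 // !scalerA mulrC.
rewrite scaler_sumr; apply: eq_bigr => j _; rewrite scalerA -ofrealV -ofrealM.
congr (ofr _ *: _); rewrite invfM; ring.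
Qed.

(** Revealing the i-th sign changes only the i-th term: earlier signs are known
    before and after, later ones average out.  The class of a point of D i with
    respect to the sets up to i is D i itself, because the earlier sets contain
    D i or are disjoint from it. *)
Lemma stein_increment (i : 'I_N) (x : T) : (u x.2)%:num != 0 ->
  cond_mean pair_weight (stein_key i.*2.+1) stein_fun x
    - cond_mean pair_weight (stein_key i.*2) stein_fun x
  = (-1) ^+ x.1 i *: (ofr (if x.2 \in D i then
     (\sum_(y in W i) (u y)%:num) / \sum_(y in D i) (u y)%:num else 0) *: v i).
Proof.
move=> ux; have iN := ltn_ord i.
rewrite !stein_cond_mean; [|lia..].
rewrite /= uphalf_double doubleK -sumrB (bigD1 i) //= [X in _ + X]big1 ?addr0; last first.
  move=> j ji; rewrite -scalerBl -ofrealN -ofrealD.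
  have [ij|] := ltnP j i.
    have ij' : (j < i.+1)%N by rewrite ltnW.
    rewrite !sign_sum_known // !(mulrC _%:R) !mulfK ?subrr ?ofreal0 ?scale0r //.
      by rewrite pnatr_eq0 -lt0n; apply/card_gt0P; exists x.1; exact: same_signs_refl.
    by rewrite pnatr_eq0 -lt0n; apply/card_gt0P; exists x.1; exact: same_signs_refl.
  rewrite leq_eqVlt => /orP[/eqP/val_inj ij|ij]; first by rewrite ij eqxx in ji.
  by rewrite !sign_sum_unknown ?mul0r ?subrr ?ofreal0 ?scale0r // ltnW.
rewrite (@sign_sum_unknown i) // !mul0r ofreal0 scale0r subr0.
rewrite sign_sum_known // (mulrC _%:R) mulfK; last first.
  by rewrite pnatr_eq0 -lt0n; apply/card_gt0P; exists x.1; exact: same_signs_refl.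
rewrite ofrealM ofreal_sign -scalerA; congr (_ *: (ofr _ *: _)).
case: ifPn => xD.
  have setsE y : same_sets i.+1 x.2 y = (y \in D i).
    apply/forallP/idP => [/(_ i)|yD j]; first by rewrite ltnSn /= xD => /eqP.
    apply/implyP; rewrite ltnS leq_eqVlt => /orP[/eqP/val_inj->|ji].
      by rewrite xD yD.
    have [DD|] := D_sorted ji.
      by rewrite !(fintype.subsetP DD).
    by move=> dis; rewrite !(disjointFl dis).
  congr (_ / _); apply: eq_bigl => y; last by rewrite setsE.
  by rewrite setsE; apply: andb_idl; exact: (fintype.subsetP (WD i)).
rewrite big1 ?mul0r // => y /andP[/forallP/(_ i)]; rewrite ltnSn (negPf xD) /=.
by move=> /eqP yD /(fintype.subsetP (WD i)); rewrite yD.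
Qed.

(** The averages of the W i over the D i are at least delta, so the indicators of
    the D i are contractions, up to delta, of the increments kept. *)
Lemma stein_sorted (delta : R) : 0 < delta ->
  (forall i, delta * \sum_(y in D i) (u y)%:num <= \sum_(y in W i) (u y)%:num) ->
  \sum_x (u x)%:num * rademacher_norm p (fun i => if x \in D i then v i else 0)
    <= 2 `^ p * 2 * delta^-1 `^ p * (1 + beta) *
       \sum_x (u x)%:num * rademacher_norm p (fun i => if x \in W i then v i else 0).
Proof.
move=> delta0 HW.
pose c (i : 'I_N) := (\sum_(y in W i) (u y)%:num) / \sum_(y in D i) (u y)%:num.
pose Dc x i := ofr (if x \in D i then c i else 0) *: v i.
have step1 x : (u x)%:num * rademacher_norm p (fun i => if x \in D i then v i else 0)
    <= 2 `^ p * 2 * delta^-1 `^ p * ((u x)%:num * rademacher_norm p (Dc x)).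
  have [->|ux] := eqVneq (u x)%:num 0; first by rewrite !mul0r mulr0.
  rewrite mulrCA ler_wpM2l //.
  pose a (i : 'I_N) := if x \in D i then (c i)^-1 else 0.
  have cW i : x \in D i -> delta <= c i.
    move=> xD; rewrite /c ler_pdivlMr //.
    apply: (@lt_le_trans _ _ (u x)%:num); first by rewrite lt0r ux /=.
    by rewrite (bigD1 x) //= lerDl sumr_ge0.
  rewrite (@eq_rademacher_norm _ _ _ _ _ _ (fun i => ofr (a i) *: Dc x i)); last first.
    move=> i; rewrite /a /Dc scalerA -ofrealM; case: ifPn => xD.
      by rewrite mulVf ?ofreal1 ?scale1r // gt_eqF // (lt_le_trans delta0) ?cW.
    by rewrite mulr0 ofreal0 scale0r.
  apply: contraction => // i; rewrite /vnorm norm_ofreal ofrealK /a.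
  case: ifPn => xD; last by rewrite normr0 invr_ge0 ltW.
  have ci : 0 < c i by rewrite (lt_le_trans delta0) ?cW.
  by rewrite ger0_norm ?invr_ge0 ?(ltW ci) // lef_pV2 ?cW.
apply: (le_trans (ler_sum _ (fun x _ => step1 x))).
rewrite -mulr_sumr -[X in _ <= X]mulrA ler_wpM2l //.
  by rewrite !mulr_ge0 // powR_ge0.
have := @odd_increments R k E T _ ([ffun=> false], pt) pair_weight stein_key
  stein_key_refines p beta p1 Hbeta stein_fun N stein_key_inj.
have swap (F : T -> R) : \sum_x F x = \sum_x \sum_s F (s, x).
  by rewrite [RHS]exchange_big pair_bigA; apply: eq_bigr => -[].
rewrite !swap => H.
rewrite (_ : \sum_x _ = \sum_x \sum_s (pair_weight (s, x))%:num * pnorm p (\sum_(i < N)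
   (cond_mean pair_weight (stein_key i.*2.+1) stein_fun (s, x)
    - cond_mean pair_weight (stein_key i.*2) stein_fun (s, x)))).
  apply: (le_trans H); rewrite le_eqVlt; apply/orP; left; apply/eqP.
  by congr (_ * _); apply: eq_bigr => x _; rewrite mulr_sumr; apply: eq_bigr.
apply: eq_bigr => x _; rewrite mulr_sumr; apply: eq_bigr => s _ /=.
have [ux|ux] := eqVneq (u x)%:num 0; first by rewrite /pair_weight /= ux !mul0r.
congr (_ * pnorm _ _); apply: eq_bigr => i _.
by rewrite (@stein_increment i (s, x)).
Qed.

End sorted.
End finite_stein.
Section reindex.
Context (R : realType) (k : scalar_kind) (E : normedModType (scalars R k)).

Lemma rademacher_norm_perm (I : finType) (s : {perm I}) (p : R) (v : I -> E) :
  rademacher_norm p (fun i => v (s i)) = rademacher_norm p v.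
Proof.
pose h (e : {ffun I -> bool}) : {ffun I -> bool} := [ffun i => e (s i)].
have hI : injective h.
  move=> e e' /ffunP H; apply/ffunP => i; have := H (s^-1%g i).
  by rewrite !ffunE permKV.
rewrite {1}/rademacher_norm (reindex_inj hI); apply: eq_bigr => e _.
congr pnorm; rewrite /rademacher_sum [RHS](reindex_inj (@perm_inj _ s)).
by apply: eq_bigr => i _; rewrite ffunE.
Qed.

Lemma sorting_perm (N : nat) (f : 'I_N -> nat) :
  exists s : {perm 'I_N}, forall i j : 'I_N, (i < j)%N -> (f (s j) <= f (s i))%N.
Proof.
pose le (i j : 'I_N) := (f j <= f i)%N.
pose t := sort le (enum 'I_N).
have szt : size t = N by rewrite size_sort size_enum_ord.
have ut : uniq t by rewrite sort_uniq enum_uniq.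
have leT : total le by move=> i j; exact: leq_total.
have le_tr : transitive le by move=> i j l; rewrite /le => H1 H2; exact: leq_trans H2 H1.
have st : sorted le t by exact: sort_sorted.
pose g (i : 'I_N) := nth i t i.
have gI : injective g.
  move=> i j; rewrite /g (set_nth_default i j) ?szt //.
  by move=> /eqP; rewrite nth_uniq ?szt // => /eqP/val_inj.
exists (perm gI) => i j ij; rewrite !permE /g (set_nth_default i j) ?szt //.
apply: (sorted_leq_nth le_tr _ i st) => //; rewrite ?inE ?szt //.
- by move=> l; rewrite /le.
- exact: ltnW.
Qed.

End reindex.

Definition laminar (T I : Type) (D : I -> set T) : Prop :=
  forall i j, [\/ D i `<=` D j, D j `<=` D i | D i `&` D j = set0].

Section stein.
Context (R : realType) (k : scalar_kind) (E : normedModType (scalars R k)).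
Variables (p beta : R).
Hypotheses (p1 : 1 <= p) (beta0 : 0 <= beta) (Hbeta : umd_constant E p beta).

(** In the order of decreasing cardinality an inclusion between two members of the
    family always goes from the later to the earlier. *)
Lemma stein_finite (P : finType) (pt : P) (u : P -> {nonneg R}) (N : nat)
    (D W : 'I_N -> {set P}) (v : 'I_N -> E) (delta : R) :
  (forall i, W i \subset D i) ->
  (forall i j, [\/ D i \subset D j, D j \subset D i
     | fintype.disjoint (mem (D i)) (mem (D j))]) ->
  0 < delta ->
  (forall i, delta * \sum_(y in D i) (u y)%:num <= \sum_(y in W i) (u y)%:num) ->
  \sum_x (u x)%:num * rademacher_norm p (fun i => if x \in D i then v i else 0)
    <= 2 `^ p * 2 * delta^-1 `^ p * (1 + beta) *
       \sum_x (u x)%:num * rademacher_norm p (fun i => if x \in W i then v i else 0).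
Proof.
move=> WD lamD delta0 HW.
have [s Hs] := sorting_perm (fun i => #|D i|).
have E1 (F : 'I_N -> {set P}) : \sum_x (u x)%:num *
      rademacher_norm p (fun i => if x \in F i then v i else 0)
   = \sum_x (u x)%:num *
      rademacher_norm p (fun i => if x \in F (s i) then v (s i) else 0).
  apply: eq_bigr => x _; congr (_ * _).
  by rewrite -[LHS](rademacher_norm_perm s).
rewrite !E1; apply: stein_sorted => //.
move=> i j ij; case: (lamD (s i) (s j)) => [DD|DD|dis]; [left|by left|by right].
have /eqP -> : D (s i) == D (s j) by rewrite eqEcard DD Hs.
exact: fintype.subxx.
Qed.

Context (disp : measure_display) (T : measurableType disp).
Variable mu : {measure set T -> \bar R}.

Section patterns.
Variables (N : nat) (D W : 'I_N -> set T).
Hypothesis WD : forall i, W i `<=` D i.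
Hypotheses (mD : forall i, measurable (D i)) (mW : forall i, measurable (W i)).
Hypothesis D_fin : forall i, (mu (D i) < +oo)%E.

Local Notation P := {ffun 'I_N -> bool * bool}.

Definition pattern (x : T) : P := [ffun i => (x \in D i, x \in W i)].

Definition pattern_weight (c : P) : {nonneg R} :=
  NngNum (fine_ge0 (measure_ge0 mu (pattern @^-1` [set c]))).

Lemma measurable_pattern c : measurable (pattern @^-1` [set c]).
Proof.
have -> : pattern @^-1` [set c] = \bigcap_(i in [set: 'I_N])
   ((if (c i).1 then D i else ~` D i) `&` (if (c i).2 then W i else ~` W i)).
  apply/seteqP; split => x /=.
    move=> <- i _; rewrite ffunE /=; split; case: ifPn => h;
    by [exact: set_mem | move=> /mem_set; rewrite (negPf h)].
  move=> H; apply/ffunP => i; rewrite ffunE; have [] := H i I.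
  case: (c i) => a b /= H1 H2; congr (_, _).
    by case: a H1 => H1; [exact: mem_set | exact: memNset].
  by case: b H2 => H2; [exact: mem_set | exact: memNset].
apply: fin_bigcap_measurable; first exact: finite_finset.
by move=> i _; apply: measurableI; case: ifP => _ //; exact: measurableC.
Qed.

(** A pattern that meets none of the sets may have infinite measure, and is given
    the junk weight 0; hence the condition that phi vanishes there. *)
Lemma integral_pattern (phi : P -> R) : (forall c, 0 <= phi c) ->
  (forall c : P, (forall i, (c i).1 = false /\ (c i).2 = false) -> phi c = 0) ->
  (\int[mu]_x (phi (pattern x))%:E = (\sum_c (pattern_weight c)%:num * phi c)%:E)%E.
Proof.
move=> phi0 phiZ.
transitivity (\int[mu]_x \sum_c ((phi c)%:E * (\1_(pattern @^-1` [set c]) x)%:E))%E.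
  apply: eq_integral => x _; rewrite (bigD1 (pattern x)) //= big1 ?adde0.
    by rewrite indicE mem_set //= mule1.
  by move=> c cx; rewrite indicE memNset ?mule0 //= => xc; rewrite xc eqxx in cx.
rewrite ge0_integral_sum //; last 2 first.
- move=> c; apply: measurable_funeM; apply/measurable_EFinP.
  exact/measurable_indic/measurable_pattern.
- by move=> c x _; rewrite mule_ge0 // lee_fin.
rewrite -sumEFin; apply: eq_bigr => c _.
rewrite ge0_integralZl_EFin //; last first.
  by apply/measurable_EFinP; exact/measurable_indic/measurable_pattern.
rewrite integral_indic ?setIT //; last exact: measurable_pattern.
have [->|phic] := eqVneq (phi c) 0; first by rewrite mul0e mulr0.
rewrite EFinM muleC /= fineK // ge0_fin_numE //.
have [i Hi] : exists i, (c i).1 || (c i).2.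
  apply: contrapT => /forallNP H; move/eqP: phic; apply; apply: phiZ => i.
  by have /negP := H i; rewrite negb_or => /andP[/negbTE-> /negbTE->].
apply: le_lt_trans (D_fin i); apply: le_measure; rewrite ?inE //.
  exact: measurable_pattern.
move=> x /= xc; move: Hi; rewrite -xc ffunE /= => /orP[/set_mem//|/set_mem].
exact: WD.
Qed.

(** The inequality only involves the patterns of membership in the D i and W i.
    Empty patterns are excluded from the finite sets, which keeps them laminar. *)
Lemma stein (v : 'I_N -> E) (delta : R) :
  laminar D -> 0 < delta ->
  (forall i, delta%:E * mu (D i) <= mu (W i))%E ->
  (\int[mu]_x (rademacher_norm p (fun i => \1_(D i) x *: v i))%:E
    <= (2 `^ p * 2 * delta^-1 `^ p * (1 + beta))%:E *
    \int[mu]_x (rademacher_norm p (fun i => \1_(W i) x *: v i))%:E)%E.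
Proof.
move=> lamD delta0 HW.
(* the patterns realised by some point *)
pose inh (c : P) := `[< exists x, pattern x = c >].
have inhx x : inh (pattern x) by apply/asboolP; exists x.
pose DP i : {set P} := [set c : P | (c i).1 && inh c]%SET.
pose WP i : {set P} := [set c : P | (c i).2 && inh c]%SET.
have DPx i x : (pattern x \in DP i) = (x \in D i) by rewrite inE ffunE inhx andbT.
have WPx i x : (pattern x \in WP i) = (x \in W i) by rewrite inE ffunE inhx andbT.
have DPn (c : P) i : c i = (false, false) -> (c \in DP i) = false.
  by move=> ci; rewrite inE ci.
have WPn (c : P) i : c i = (false, false) -> (c \in WP i) = false.
  by move=> ci; rewrite inE ci.
have reduce (F : 'I_N -> set T) (FP : 'I_N -> {set P}) :
    (forall i x, (pattern x \in FP i) = (x \in F i)) ->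
    (forall (c : P) i, c i = (false, false) -> (c \in FP i) = false) ->
    (\int[mu]_x (rademacher_norm p (fun i => \1_(F i) x *: v i))%:E
    = (\sum_c (pattern_weight c)%:num *
        rademacher_norm p (fun i => if c \in FP i then v i else 0))%:E)%E.
  move=> Fx Fn; rewrite -integral_pattern.
  - apply: eq_integral => x _; congr EFin; apply: eq_rademacher_norm => i.
    by rewrite Fx indicE; case: ifP => _; rewrite ?scale1r ?scale0r.
  - by move=> c; exact: rademacher_norm_ge0.
  - move=> c Hc; apply: big1 => s _; rewrite /rademacher_sum big1 ?pnorm0 // => i _.
    rewrite Fn ?scaler0 //; have [] := Hc i; case: (c i) => a b /= -> -> //.
have measureE (F : set T) (FP : {set P}) i : measurable F ->
    (forall x, (pattern x \in FP) = (x \in F)) ->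
    (forall c : P, c i = (false, false) -> (c \in FP) = false) ->
    (mu F = (\sum_(c in FP) (pattern_weight c)%:num)%:E)%E.
  move=> mF Fx Fn; transitivity (\int[mu]_x (\1_F x)%:E)%E.
    by rewrite integral_indic // setIT.
  rewrite (_ : \sum_(c in FP) _ =
    \sum_c (pattern_weight c)%:num * (c \in FP)%:R); last first.
    by rewrite big_mkcond; apply: eq_bigr => c _; case: ifP; rewrite ?mulr1 ?mulr0.
  rewrite -integral_pattern //.
    by apply: eq_integral => x _; rewrite indicE Fx.
  move=> c Hc; rewrite Fn //; have [] := Hc i; case: (c i) => a b /= -> -> //.
rewrite (reduce D DP) // (reduce W WP) // -EFinM lee_fin.
apply: stein_finite => //.
- by exact: [ffun=> (false, false)].
- move=> i; apply/fintype.subsetP => c; rewrite !inE => /andP[c2 ic].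
  rewrite ic andbT; move/asboolP: ic c2 => [x <-]; rewrite ffunE /=.
  by move=> /set_mem/WD/mem_set.
- move=> i j; case: (lamD i j) => [ij|ij|ij].
  + constructor 1; apply/fintype.subsetP => c; rewrite !inE => /andP[c2 ic].
    rewrite ic andbT; move/asboolP: ic c2 => [x <-]; rewrite !ffunE /=.
    by move=> /set_mem/ij/mem_set.
  + constructor 2; apply/fintype.subsetP => c; rewrite !inE => /andP[c2 ic].
    rewrite ic andbT; move/asboolP: ic c2 => [x <-]; rewrite !ffunE /=.
    by move=> /set_mem/ij/mem_set.
  + constructor 3; rewrite disjoint_subset; apply/fintype.subsetP => c.
    rewrite !inE => /andP[c2 ic]; rewrite ic andbT; apply/negP => c1.
    move/asboolP: ic c2 c1 => [x <-]; rewrite !ffunE /= => /set_mem xi /set_mem xj.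
    by have : (D i `&` D j) x by []; rewrite ij.
- move=> i; have := HW i.
  rewrite (measureE _ _ i (mD i) (DPx i)); last by move=> c; exact: DPn.
  rewrite (measureE _ _ i (mW i) (WPx i)); last by move=> c; exact: WPn.
  by rewrite -EFinM lee_fin.
Qed.

End patterns.
End stein.

(** * Randomisation of martingale difference families *)

Definition rademacher_energy (R : realType) (k : scalar_kind)
    (E : normedModType (scalars R k)) (disp : measure_display)
    (T : measurableType disp) (mu : {measure set T -> \bar R}) (p : R)
    (I : finType) (y : I -> T -> E) : \bar R :=
  (\int[mu]_x (rademacher_norm p (fun i => y i x))%:E)%E.

Section rademacher_energy.
Context (R : realType) (k : scalar_kind) (E : normedModType (scalars R k)).
Context (disp : measure_display) (T : measurableType disp).
Variables (mu : {measure set T -> \bar R}) (p : R).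
Hypothesis p1 : 1 <= p.
Local Notation sm := (@strongly_measurable R k E T measurable).
Variable I : finType.
Implicit Types y z : I -> T -> E.

Lemma strongly_measurable_rademacher y (s : {ffun I -> bool}) :
  (forall i, sm (y i)) -> sm (fun x => rademacher_sum (fun i => y i x) s).
Proof.
by move=> my; apply: strongly_measurable_sum => i; exact: strongly_measurableZ.
Qed.

Lemma rademacher_energyE y : (forall i, sm (y i)) ->
  (rademacher_energy mu p y
    = \sum_s energy mu p (fun x => rademacher_sum (fun i => y i x) s))%E.
Proof.
move=> my; rewrite -ge0_integral_sum //.
- by apply: eq_integral => x _; rewrite sumEFin.
- by move=> s; exact/measurable_epnorm/strongly_measurable_rademacher.
- by move=> s x _; rewrite lee_fin pnorm_ge0.
Qed.

Lemma measurable_rademacher_norm y : (forall i, sm (y i)) ->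
  measurable_fun setT (fun x => (rademacher_norm p (fun i => y i x))%:E).
Proof.
move=> my; apply/measurable_EFinP; apply: measurable_sum => s.
exact/measurable_pnorm/strongly_measurable_rademacher.
Qed.

Lemma rademacher_energy_contraction y z (c : R) :
  (forall i, sm (y i)) -> (forall i, sm (z i)) ->
  {ae mu, forall x, forall i, exists2 a : scalars R k,
     vnorm (a : (scalars R k)^o) <= c & y i x = a *: z i x} ->
  (rademacher_energy mu p y
    <= (2 `^ p * 2 * c `^ p)%:E * rademacher_energy mu p z)%E.
Proof.
move=> my mz H.
have c0 : 0 <= 2 `^ p * 2 * c `^ p by rewrite !mulr_ge0 // powR_ge0.
rewrite -ge0_integralZl_EFin //; last 2 first.
- by move=> x _; rewrite lee_fin rademacher_norm_ge0.
- exact: measurable_rademacher_norm.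
apply: ae_ge0_le_integral => //.
- by move=> x _; rewrite lee_fin rademacher_norm_ge0.
- exact: measurable_rademacher_norm.
- by move=> x _; rewrite mule_ge0 // lee_fin // rademacher_norm_ge0.
- by apply: measurable_funeM; exact: measurable_rademacher_norm.
apply: filterS H => x Hx _; rewrite -EFinM lee_fin.
pose a i := projT1 (cid2 (Hx i)).
rewrite (@eq_rademacher_norm _ _ _ _ _ _ (fun i => a i *: z i x)).
  by apply: contraction => // i; rewrite /a; case: cid2.
by move=> i; rewrite /a; case: cid2.
Qed.

End rademacher_energy.

Section randomization.
Context (R : realType) (k : scalar_kind) (E : normedModType (scalars R k)).
Local Notation K := (scalars R k).
Context (disp : measure_display) (T : measurableType disp).
Variables (mu : {measure set T -> \bar R}).

Lemma bochner_integral_tensor (B : set T) (f : T -> K^o) (v : K^o) (c : E) :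
  measurable B ->
  is_bochner_integral mu B f v ->
  is_bochner_integral mu B (tensor f c) ((v : K) *: c).
Proof.
move=> mB [mf [s [s1 s2 s3]]]; split; first exact: strongly_measurable_tensor.
exists (fun n => [seq (a.1, (a.2 : K) *: c) | a <- s n]).
have stepE n x : step_fun [seq (a.1, (a.2 : K) *: c) | a <- s n] x
    = (step_fun (s n) x : K) *: c.
  rewrite /step_fun big_map scaler_suml; apply: eq_bigr => a _ /=.
  by rewrite scalerA.
split.
- by move=> n _ /mapP[a /s1 ? ->].
- rewrite [X in X @ _](_ : _ = fun n => ((vnorm c)%:E *
     (\int[mu]_(x in B) (vnorm (f x - step_fun (s n) x)%R)%:E))%E); last first.
    apply/funext => n; rewrite -ge0_integralZl_EFin ?vnorm_ge0 //.
    + by apply: eq_integral => x _; rewrite stepE /tensor -scalerBl vnormZ EFinM muleC.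
    + by move=> x _; rewrite lee_fin vnorm_ge0.
    + apply: measurable_funTS; apply/measurable_EFinP/measurable_vnorm.
      apply: strongly_measurableB => //.
      exists (fun=> s n); first by move=> _ a /s1[].
      by move=> x; exact: cvg_cst.
  by rewrite -(mule0 (vnorm c)%:E); exact: cvgeZl.
- rewrite [X in X @ _](_ : _ = fun n =>
    (\sum_(a <- s n) ofreal k (fine (mu (a.1 `&` B))) *: a.2 : K) *: c).
    by apply: cvgZr_tmp; exact: s3.
  apply/funext => n; rewrite big_map scaler_suml; apply: eq_bigr => a _ /=.
  by rewrite scalerA.
Qed.

Variables (p beta : R).
Hypotheses (p1 : 1 <= p) (Hbeta : umd_constant E p beta).
Variables (I : eqType) (d : I -> T -> K^o).
Hypothesis d_mds : martingale_difference_family mu p d.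

Lemma mds_family_strongly_measurable i :
  @strongly_measurable R k K^o T measurable (d i).
Proof. by have [le [F [_ _ _ [_ _ HLp _ _]]]] := d_mds; have [] := HLp i. Qed.

Lemma in_Lp_tensor (f : T -> K^o) (c : E) :
  in_Lp mu p f -> in_Lp mu p (tensor f c).
Proof.
move=> [mf fLp]; have mt : strongly_measurable measurable (tensor f c).
  exact: strongly_measurable_tensor.
split => //; apply/(Lp_norm_lty _ p1); move/(Lp_norm_lty _ p1): fLp => fLp.
have -> : energy mu p (tensor f c) = ((pnorm p c)%:E * energy mu p f)%E.
  rewrite /energy -ge0_integralZl_EFin ?pnorm_ge0 //.
  - by apply: eq_integral => x _; rewrite /tensor pnormZ EFinM muleC.
  - by move=> x _; rewrite lee_fin pnorm_ge0.
  - exact: measurable_epnorm.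
by rewrite lte_mul_pinfty // lee_fin pnorm_ge0.
Qed.

Variables (J : finType) (A : J -> I).
Hypothesis A_inj : injective A.

(** A finite subfamily, listed in the order of the martingale and tensored with
    vectors, is an E-valued martingale difference sequence. *)
Lemma umd_signs (c : J -> E) (s : J -> bool) :
  (energy mu p (fun x => (\sum_j (-1) ^+ s j *: tensor (d (A j)) (c j) x)%R)
    <= beta%:E * energy mu p (fun x => (\sum_j tensor (d (A j)) (c j) x)%R))%E.
Proof.
have [le [F [le_tot le_tr le_asym [F_sf F_filt d_Lp d_ad d_ce]]]] := d_mds.
pose leJ i j := le (A i) (A j).
pose t := sort leJ (enum J).
have ut : uniq t by rewrite sort_uniq enum_uniq.
have pt : perm_eq t (enum J) by rewrite perm_sort.
have st : sorted leJ t by apply: sort_sorted => i j; exact: le_tot.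
pose g (i : 'I_(size t)) := tnth (in_tuple t) i.
have gI : injective g.
  move=> i j; rewrite /g !(tnth_nth (g i)) => /eqP; rewrite nth_uniq //.
  by move=> /eqP/val_inj.
have le_g (i j : 'I_(size t)) : (i <= j)%N -> leJ (g i) (g j).
  move=> ij; rewrite /g !(tnth_nth (g i)) /=.
  apply: (sorted_leq_nth _ _ _ st) => //; rewrite ?inE //.
    by move=> a b e; exact: le_tr.
  by move=> a; rewrite /leJ; have := le_tot (A a) (A a); rewrite orbb.
have sumE (u : J -> E) : \sum_j u j = \sum_(i < size t) u (g i).
  rewrite -[LHS]big_enum /= -(perm_big _ pt) /= big_tnth.
  by apply: eq_bigr.
have md : martingale_difference mu p (fun i j : 'I_(size t) => (i <= j)%N)
    (fun i => F (A (g i))) (fun i => tensor (d (A (g i))) (c (g i))).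
  split.
  - by move=> i; exact: F_sf.
  - by move=> i j /le_g; exact: F_filt.
  - by move=> i; exact/in_Lp_tensor/d_Lp.
  - by move=> i; exact: strongly_measurable_tensor.
  - move=> i j ij nij; split; first exact: strongly_measurable0.
    move=> B FB muB.
    have nA : A (g i) <> A (g j) by move=> /A_inj/gI.
    have [_ /(_ B FB muB)[v v1 v2]] := d_ce _ _ (le_g _ _ ij) nA.
    have mB : measurable B by have [_ + _] := F_sf (A (g i)); apply.
    exists ((v : K) *: c (g j)); first exact: bochner_integral_tensor.
    have := bochner_integral_tensor (c (g j)) mB v2.
    rewrite (_ : tensor _ _ = fun=> 0) //.
    by apply/funext => x; rewrite /tensor scale0r.
have := Hbeta md (fun i => s (g i)).
rewrite [X in (energy _ _ X <= _)%E](_ : _ =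
    fun x => \sum_j (-1) ^+ s j *: tensor (d (A j)) (c j) x); last first.
  by apply/funext => x; rewrite sumE.
rewrite [X in (_ <= _ * energy _ _ X)%E](_ : _ =
    fun x => \sum_j tensor (d (A j)) (c j) x) //.
by apply/funext => x; rewrite sumE.
Qed.

Hypothesis beta0 : 0 <= beta.
Local Notation signs := #|{ffun J -> bool}|.

(** Applying a sign pattern twice gives back the sum, so the UMD inequality can be
    used from the signed sums to the plain one; then average over the signs. *)
Lemma energy_le_rademacher (c : J -> E) :
  (signs%:R%:E * energy mu p (fun x => (\sum_j tensor (d (A j)) (c j) x)%R)
    <= beta%:E * rademacher_energy mu p (fun j => tensor (d (A j)) (c j)))%E.
Proof.
rewrite rademacher_energyE; last first.
  by move=> j; exact/strongly_measurable_tensor/mds_family_strongly_measurable.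
rewrite ge0_sume_distrr; last by move=> s _; exact: energy_ge0.
rewrite -sum1_card natr_sum -sumEFin ge0_sume_distrl //.
apply: lee_sum => s _; rewrite mul1e.
have := umd_signs (fun j => (-1) ^+ s j *: c j) s.
have sw x j : tensor (d (A j)) ((-1) ^+ s j *: c j) x
    = (-1) ^+ s j *: tensor (d (A j)) (c j) x.
  by rewrite /tensor !scalerA mulrC.
rewrite [X in (energy _ _ X <= _)%E -> _](_ : _ =
    fun x => \sum_j tensor (d (A j)) (c j) x); last first.
  apply/funext => x; apply: eq_bigr => j _.
  by rewrite sw scalerA -expr2 sqrr_sign scale1r.
rewrite [X in (_ <= _ * energy _ _ X)%E -> _](_ : _ =
    fun x => rademacher_sum (fun j => tensor (d (A j)) (c j) x) s) //.
by apply/funext => x; apply: eq_bigr => j _; rewrite sw.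
Qed.

Lemma rademacher_le_energy (c : J -> E) :
  (rademacher_energy mu p (fun j => tensor (d (A j)) (c j))
    <= beta%:E * (signs%:R%:E
         * energy mu p (fun x => (\sum_j tensor (d (A j)) (c j) x)%R)))%E.
Proof.
rewrite rademacher_energyE; last first.
  by move=> j; exact/strongly_measurable_tensor/mds_family_strongly_measurable.
rewrite muleCA -sum1_card natr_sum -sumEFin ge0_sume_distrl //.
by apply: lee_sum => s _; rewrite mul1e; exact: umd_signs.
Qed.

(** A sub-sum is half of the plain sum plus a signed sum. *)
Lemma energy_subsum (c : J -> E) (P : pred J) :
  (energy mu p (fun x => (\sum_(j | P j) tensor (d (A j)) (c j) x)%R)
    <= (1 + beta)%:E
      * energy mu p (fun x => (\sum_j tensor (d (A j)) (c j) x)%R))%E.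
Proof.
have mt j : strongly_measurable measurable (tensor (d (A j)) (c j)).
  exact/strongly_measurable_tensor/mds_family_strongly_measurable.
pose f x := \sum_j tensor (d (A j)) (c j) x.
pose g x := \sum_j (-1) ^+ (~~ P j) *: tensor (d (A j)) (c j) x.
have mf : strongly_measurable measurable f by exact: strongly_measurable_sum.
have mg : strongly_measurable measurable g.
  by apply: strongly_measurable_sum => j; exact: strongly_measurableZ.
have msub : strongly_measurable measurable
    (fun x => \sum_(j | P j) tensor (d (A j)) (c j) x).
  under eq_fun do rewrite big_mkcond.
  apply: (@strongly_measurable_sum R k E T measurable _ _
    (fun j x => if P j then tensor (d (A j)) (c j) x else 0)) => j.
  by case: (P j) => //; exact: strongly_measurable0.
have subE x : ofreal k 2 *: (\sum_(j | P j) tensor (d (A j)) (c j) x) = f x + g x.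
  rewrite /f /g -big_split big_mkcond scaler_sumr; apply: eq_bigr => j _ /=.
  case: (P j) => /=; last by rewrite scaler0 expr1 scaleN1r subrr.
  by rewrite expr0 scale1r (ofreal_nat R k 2) scaler_nat mulr2n.
have c0 : 0 < 2 `^ p :> R by rewrite powR_gt0.
have fin c1 : c1%:E \is a fin_num by [].
rewrite -(@lee_pmul2l _ (2 `^ p)%:E) // ?lte_fin //.
have := energyZr mu p 2 msub; rewrite ger0_norm // => <-.
under eq_fun do rewrite subE.
rewrite (le_trans (energyD mu p1 mf mg)) // lee_pmul2l ?lte_fin //.
rewrite EFinD ge0_muleDl ?lee_fin // mul1e leeD2l //.
exact: umd_signs.
Qed.

End randomization.

(** * Measures of finite unions *)

Section overlap.
Context (R : realType) (disp : measure_display) (T : measurableType disp).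
Variable mu : {measure set T -> \bar R}.
Variables (I : finType) (P : pred I) (F : I -> set T) (A : set T).
Hypotheses (mA : measurable A) (mF : forall i, P i -> measurable (F i)).

Let mF' i : measurable (if P i then F i else set0).
Proof. by case: ifP => // /mF. Qed.

Let sum_integral : (\sum_(i | P i) mu (F i)
  = \int[mu]_x (\sum_i (\1_(if P i then F i else set0) x : R))%:E)%E.
Proof.
under eq_integral do rewrite -sumEFin.
rewrite ge0_integral_sum //.
  rewrite big_mkcond; apply: eq_bigr => i _; rewrite integral_indic // setIT.
  by case: ifP => // _; rewrite measure0.
by move=> i; apply/measurable_EFinP; exact: measurable_indic.
Qed.

Let measurable_sum_indic :
  measurable_fun setT (fun x => (\sum_i (\1_(if P i then F i else set0) x : R))%:E).
Proof.
by apply/measurable_EFinP; apply: measurable_sum => i; exact: measurable_indic.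
Qed.

Lemma measure_le_sum : {ae mu, forall x, A x -> exists2 i, P i & F i x} ->
  (mu A <= \sum_(i | P i) mu (F i))%E.
Proof.
move=> H; rewrite sum_integral -[X in (mu X <= _)%E]setIT -integral_indic //.
apply: ae_ge0_le_integral => //.
- by apply/measurable_EFinP; exact: measurable_indic.
- by move=> x _; rewrite lee_fin sumr_ge0.
apply: filterS H => x Hx _; rewrite lee_fin indicE.
have [xA|xA] := boolP (x \in A); last exact: sumr_ge0.
have [i Pi Fi] := Hx (set_mem xA).
rewrite (bigD1 i) //= Pi indicE mem_set //= lerDl; exact: sumr_ge0.
Qed.

Lemma sum_measure_le :
  {ae mu, forall x, forall i j, P i -> P j -> i != j -> ~ (F i x /\ F j x)} ->
  (forall i, P i -> F i `<=` A) ->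
  (\sum_(i | P i) mu (F i) <= mu A)%E.
Proof.
move=> H FA; rewrite sum_integral -[X in (_ <= mu X)%E]setIT -integral_indic //.
apply: ae_ge0_le_integral => //.
- by move=> x _; rewrite lee_fin sumr_ge0.
- by apply/measurable_EFinP; exact: measurable_indic.
apply: filterS H => x Hx _; rewrite lee_fin.
have [[i [Pi Fi]]|nex] := pselect (exists i, P i /\ F i x); last first.
  rewrite big1 ?indicE ?ler0n // => i _; rewrite indicE memNset //.
  by case: ifP => Pi Fi //; apply: nex; exists i.
rewrite (bigD1 i) //= big1 ?addr0; last first.
  move=> j ji; rewrite indicE memNset //; case: ifP => Pj Fj //.
  by apply: (Hx i j) => //; rewrite eq_sym.
by rewrite !indicE mem_set ?Pi // mem_set //; exact: FA Fi.
Qed.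

End overlap.

(** * Dyadic cubes *)

Section cubes.
Context (R : realType) (disp : measure_display) (X : measurableType disp).
Context (H : homogeneous_space R X) (Q : dyadic_system H).
Local Notation mu := (vol H).
Implicit Types A B C : cube Q.

Lemma cube_at A : cubes_at Q (lev A) (carrier A).
Proof. by rewrite /lev /carrier; exact: (set_valP A). Qed.

Lemma measurable_carrier A : measurable (carrier A).
Proof.
rewrite (measurable_borel H); apply: sub_sigma_algebra.
exact: cube_open (cube_at A).
Qed.

Lemma countable_cubes : countable [set: cube Q].
Proof.
have /countable_injP[f fI] : countable [set c : int * set X | cubes_at Q c.1 c.2].
  have := countableXR (countableP [set: int]) (fun n _ => @cubes_countable _ _ _ _ Q n).
  by apply: sub_countable; apply: subset_card_le => -[n B] /= nB; split.
apply/countable_injP; exists (fun A => f (val A)) => A B _ _ /fI AB.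
by apply: val_inj; apply: AB; apply/mem_set; exact: set_valP.
Qed.

Lemma measurable_star (C : set (cube Q)) : measurable (star C).
Proof.
rewrite /star bigcup_mkcond; apply: countable_bigcupT_measurable.
  exact: countable_cubes.
by move=> A; case: ifP => // _; exact: measurable_carrier.
Qed.

Lemma vol_ball_lty x (r : R) : 0 < r -> (mu (qball (dist H) x r) < +oo)%E.
Proof.
move=> r0; have r2 : 0 < r / 2 by rewrite divr_gt0.
have := vol_doubling H x r2; rewrite mulrC divfK // => /le_lt_trans; apply.
exact: vol_ball_fin.
Qed.

Lemma measurable_ball x (r : R) : measurable (qball (dist H) x r).
Proof.
rewrite (measurable_borel H); apply: sub_sigma_algebra; exact: Defs.ball_open.
Qed.

Lemma vol_carrier_lty A : (mu (carrier A) < +oo)%E.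
Proof.
have q0 := ratio_gt0 Q; have C0 := C_out_gt0 Q.
have r0 : 0 < C_out Q * Defs.ratio Q ^ lev A by rewrite mulr_gt0 // exprz_gt0.
have Hb := vol_ball_lty (Defs.center Q (lev A) (carrier A)) r0.
apply: (le_lt_trans _ Hb).
apply: le_measure; rewrite ?inE; [exact: measurable_carrier|exact: measurable_ball|].
exact: cube_ball_out (cube_at A).
Qed.

Lemma vol_carrier_gt0 A : (0 < mu (carrier A))%E.
Proof.
have q0 := ratio_gt0 Q; have C0 := C_in_gt0 Q.
have r0 : 0 < C_in Q * Defs.ratio Q ^ lev A by rewrite mulr_gt0 // exprz_gt0.
have r2 : 0 < C_in Q * Defs.ratio Q ^ lev A / 2 by rewrite divr_gt0.
have := vol_ball_gt0 H (Defs.center Q (lev A) (carrier A)) r2.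
rewrite mulrC divfK // => /lt_le_trans; apply.
apply: le_measure; rewrite ?inE; [exact: measurable_ball|exact: measurable_carrier|].
exact: cube_ball_in (cube_at A).
Qed.

(** Uniqueness of the ancestor of level k of a cube, used at its own level. *)
Lemma same_level_carrier A B x : lev A = lev B -> carrier A x -> carrier B x ->
  A = B.
Proof.
move=> AB Ax Bx; have HA := cube_at A; have HB := cube_at B.
have leAB : lev A <= lev B by rewrite AB.
have [BA|] := cubes_nested leAB HA HB; last by move=> /seteqP[/(_ x)]; case.
have [C [_ CU]] := cubes_parent leAB HB.
have C1 := CU _ (conj HA BA).
have C2 : C = carrier B by apply: CU; rewrite AB; split.
move: AB C1 C2; rewrite /lev /carrier => AB -> BC; apply: val_inj.
by rewrite [LHS]surjective_pairing [RHS]surjective_pairing AB -BC.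
Qed.

Lemma ancestor (n : int) B : n <= lev B ->
  exists2 A : cube Q, lev A = n & carrier B `<=` carrier A.
Proof.
move=> nB; have [C [[QC BC] _]] := cubes_parent nB (cube_at B).
by exists (exist _ (n, C) (mem_set QC)).
Qed.

(** A cube sitting at least as deep as the cubes of a collection of one level
    does not cut the union of that collection. *)
Lemma star_uncut (n : int) (C : set (cube Q)) B :
  (forall A, C A -> lev A = n) -> n <= lev B ->
  carrier B `<=` star C \/ carrier B `&` star C = set0.
Proof.
move=> Cn nB; have [A An BA] := ancestor nB.
have [CA|nCA] := pselect (C A); [left|right].
  by move=> x /BA Ax; exists A.
apply/seteqP; split => // x [/BA Ax [A' CA' A'x]]; apply: nCA.
by rewrite (@same_level_carrier A A' x) // An Cn.
Qed.

Definition block (lambda : nat) (B : cube Q) : int := (lev B %/ lambda%:Z)%Z.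

Lemma block_eq_lev (lambda : nat) B B' : (0 < lambda)%N ->
  block lambda B = block lambda B' -> lev B' - lev B < lambda%:Z.
Proof.
rewrite /block => lambda_gt0; have l0 : 0 < lambda%:Z by [].
have := divz_eq (lev B) lambda%:Z; have := divz_eq (lev B') lambda%:Z.
have := modz_ge0 (lev B) (lt0r_neq0 l0); have := ltz_pmod (lev B') l0.
by move=> h1 h2 h3 h4 bb; move: bb h3 h4 => ->; lia.
Qed.

(** Distinct blocks of the same parity are at least two apart, which leaves a full
    block between them. *)
Lemma block_lt_lev (lambda : nat) B B' : (0 < lambda)%N ->
  (block lambda B = block lambda B' %[mod 2])%Z ->
  block lambda B < block lambda B' -> lev B + lambda%:Z <= lev B'.
Proof.
rewrite /block => lambda_gt0 bmod; have l0 : 0 < lambda%:Z by [].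
have := divz_eq (lev B) lambda%:Z; have := divz_eq (lev B') lambda%:Z.
have := ltz_pmod (lev B) l0; have := modz_ge0 (lev B') (lt0r_neq0 l0).
move: bmod; set b := (lev B %/ _)%Z; set b' := (lev B' %/ _)%Z.
move=> bmod; set r := (lev B %% _)%Z; set r' := (lev B' %% _)%Z => r'0 rl -> -> bb'.
have b2 : b + 2 <= b' by lia.
have : (b + 2) * lambda%:Z <= b' * lambda%:Z by rewrite ler_wpM2r // ltW.
by rewrite mulrDl; lia.
Qed.

End cubes.

(** * Geometry of the stripes *)

Definition fvol (R : realType) (disp : measure_display) (T : measurableType disp)
  (mu : {measure set T -> \bar R}) (A : set T) : R := fine (mu A).

Section fvol.
Context (R : realType) (disp : measure_display) (T : measurableType disp).
Variable mu : {measure set T -> \bar R}.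
Implicit Types A B : set T.

Lemma fvol_ge0 A : 0 <= fvol mu A.
Proof. exact: fine_ge0. Qed.

Lemma fvolE A : (mu A < +oo)%E -> mu A = (fvol mu A)%:E.
Proof. by move=> A_fin; rewrite /fvol fineK // ge0_fin_numE. Qed.

Variables (I : finType) (P : pred I) (F : I -> set T) (A : set T).
Hypotheses (mA : measurable A) (mF : forall i, P i -> measurable (F i)).

Lemma fvol_le_sum : (forall i, P i -> (mu (F i) < +oo)%E) ->
  {ae mu, forall x, A x -> exists2 i, P i & F i x} ->
  fvol mu A <= \sum_(i | P i) fvol mu (F i).
Proof.
move=> F_fin H; have := measure_le_sum mA mF H.
have -> : (\sum_(i | P i) mu (F i) = (\sum_(i | P i) fvol mu (F i))%:E)%E.
  by rewrite -sumEFin; apply: eq_bigr => i Pi; rewrite fvolE // F_fin.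
move=> HA; rewrite -lee_fin -fvolE //; exact: le_lt_trans HA (ltry _).
Qed.

Lemma sum_fvol_le : (mu A < +oo)%E ->
  {ae mu, forall x, forall i j, P i -> P j -> i != j -> ~ (F i x /\ F j x)} ->
  (forall i, P i -> F i `<=` A) ->
  \sum_(i | P i) fvol mu (F i) <= fvol mu A.
Proof.
move=> A_fin H FA; have := sum_measure_le mA mF H FA.
have F_fin i : P i -> (mu (F i) < +oo)%E.
  move=> Pi; apply: (le_lt_trans _ A_fin).
  by apply: le_measure; rewrite ?inE //; [exact: mF | exact: FA].
have -> : (\sum_(i | P i) mu (F i) = (\sum_(i | P i) fvol mu (F i))%:E)%E.
  by rewrite -sumEFin; apply: eq_bigr => i Pi; rewrite fvolE // F_fin.
by rewrite fvolE // lee_fin.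
Qed.

End fvol.

Lemma ae_forall_finType (R : realType) (disp : measure_display)
    (T : measurableType disp) (mu : {measure set T -> \bar R}) (I : finType)
    (P : I -> T -> Prop) :
  (forall i, {ae mu, forall x, P i x}) -> {ae mu, forall x, forall i, P i x}.
Proof.
move=> H; have H' (r : seq I) : {ae mu, forall x, forall i, i \in r -> P i x}.
  elim: r => [|i r IH]; first by apply/nearW => x i.
  apply: filterS2 (H i) IH => x Pi Pr j; rewrite inE => /orP[/eqP->//|]; exact: Pr.
by apply: filterS (H' (enum I)) => x Hx i; apply: Hx; rewrite mem_enum.
Qed.

Section stripe_geometry.
Context (R : realType) (disp : measure_display) (X : measurableType disp).
Context (H : homogeneous_space R X) (Q : dyadic_system H).
Local Notation mu := (vol H).
Local Notation fv := (fvol mu).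
Variables (K1 K2 eps : R) (lambda M : nat) (S : 'I_M -> cube Q -> set (cube Q)).
Hypothesis HS : stripes K1 K2 eps lambda S.
Variable K : R.
Hypotheses (K_ge1 : 1 <= K) (K1K : K1 <= K) (K2K : K2 <= K).
Hypothesis eps_gt0 : 0 < eps.
Implicit Types (A B : cube Q) (c : 'I_M).

Lemma star_sub_carrier c A : star (S c A) `<=` carrier A.
Proof. by move=> x [B SB Bx]; have [+ _] := stripe_sub HS SB; apply. Qed.

Lemma star_lty c A : (mu (star (S c A)) < +oo)%E.
Proof.
apply: le_lt_trans (vol_carrier_lty A).
apply: le_measure; rewrite ?inE; [exact: measurable_star|exact: measurable_carrier|].
exact: star_sub_carrier.
Qed.

Lemma stripe_comparableK A c c' : fv (star (S c A)) <= K * fv (star (S c' A)).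
Proof.
have := stripe_comparable HS A c c'.
rewrite (fvolE (star_lty c A)) (fvolE (star_lty c' A)) -EFinM lee_fin => /le_trans.
by apply; rewrite ler_wpM2r // fvol_ge0.
Qed.

(** The M stripes of a cube are disjoint and comparable, so each of them has
    measure about 1 / M of the cube; the factor M cancels in the end. *)
Lemma stripe_fvol_le c A : M%:R * fv (star (S c A)) <= K * fv (carrier A).
Proof.
have sum_le : \sum_(c' < M) fv (star (S c' A)) <= fv (carrier A).
  apply: sum_fvol_le; first exact: measurable_carrier.
  - by move=> i _; exact: measurable_star.
  - exact: vol_carrier_lty.
  - apply: ae_forall_finType => i; apply: ae_forall_finType => j.
    have [->|ij] := eqVneq i j; first by apply/nearW => x.
    apply: negligibleS (stripe_disjoint HS A ij) => x /= Hx.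
    by apply: contrapT => nx; apply: Hx => _ _ _ [? ?]; apply: nx; split.
  - by move=> i _; exact: star_sub_carrier.
apply: (@le_trans _ _ (K * \sum_(c' < M) fv (star (S c' A)))); last first.
  by rewrite ler_wpM2l // (le_trans ler01).
rewrite mulr_sumr (_ : M%:R * _ = \sum_(c' < M) fv (star (S c A))).
  by apply: ler_sum => c' _; exact: stripe_comparableK.
by rewrite sumr_const card_ord mulr_natl.
Qed.

Lemma stripe_fvol_ge c A : fv (carrier A) <= M%:R * K * fv (star (S c A)).
Proof.
apply: (@le_trans _ _ (\sum_(c' < M) fv (star (S c' A)))).
  apply: fvol_le_sum; first exact: measurable_carrier.
  - by move=> i _; exact: measurable_star.
  - by move=> i _; exact: star_lty.
  - apply: negligibleS (stripe_cover HS A) => x /= Hx.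
    apply: contrapT => nx; apply: Hx => Ax; apply: contrapT => nS; apply: nx.
    by left; split => // -[c' _ Sx]; apply: nS; exists c'.
rewrite -mulrA mulr_natl -[X in _ *+ X](card_ord M) -sumr_const.
by apply: ler_sum => c' _; exact: stripe_comparableK.
Qed.

Lemma fvol_carrier_gt0 A : 0 < fv (carrier A).
Proof. by rewrite /fvol fine_gt0 // vol_carrier_gt0 vol_carrier_lty. Qed.

Lemma fvol_star_gt0 c A : 0 < fv (star (S c A)).
Proof.
have := stripe_fvol_ge c A; have := fvol_carrier_gt0 A.
rewrite [_ < fv (star _)]lt_neqAle fvol_ge0 andbT => A0 h; apply/negP => /eqP s0.
by move: h; rewrite -s0 mulr0 leNgt A0.
Qed.

(** The stripes of A are made of cubes lambda levels below A. *)
Lemma stripe_uncut c A B : lev A + lambda%:Z <= lev B ->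
  carrier B `<=` star (S c A) \/ carrier B `&` star (S c A) = set0.
Proof.
by apply: star_uncut => A' SA'; have [_ +] := stripe_sub HS SA'.
Qed.

Section group.
Variables (J : finType) (A : J -> cube Q) (L : nat).
Hypotheses (A_inj : injective A) (L_gt0 : (0 < L)%N) (lambda_gt0 : (0 < lambda)%N).
Local Notation block := (block lambda).
Hypothesis lev_mod : forall i j, (lev (A i) = lev (A j) %[mod L%:Z])%Z.
Hypothesis block_mod : forall i j, (block (A i) = block (A j) %[mod 2])%Z.
Variables m n : 'I_M.

Definition deeper (i j : J) : bool :=
  (block (A i) == block (A j)) && (lev (A i) < lev (A j)).

Definition removed (i : J) : set X :=
  \bigcup_(j in [set j | deeper i j]) (star (S m (A j)) `|` star (S n (A j))).

Definition core (i : J) : set X :=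
  (star (S m (A i)) `|` star (S n (A i))) `\` removed i.

Lemma measurable_removed i : measurable (removed i).
Proof.
apply: fin_bigcup_measurable; first exact: finite_finset.
by move=> j _; apply: measurableU; exact: measurable_star.
Qed.

Lemma core_sub i : core i `<=` carrier (A i).
Proof. by move=> x [[/star_sub_carrier//|/star_sub_carrier//] _]. Qed.

(** Within a block the cores are disjoint because the deeper stripes have been
    removed; a cube of a later block lies at least lambda levels below every
    cube of an earlier one, so it cuts neither a stripe nor a removed set. *)
Lemma core_laminar : laminar core.
Proof using HS A_inj lambda_gt0 block_mod.
have later i j : block (A i) < block (A j) ->
    core j `<=` core i \/ core i `&` core j = set0.
  move=> ij.
  have uncut c l : block (A l) = block (A i) ->
     carrier (A j) `<=` star (S c (A l)) \/ carrier (A j) `&` star (S c (A l)) = set0.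
    by move=> li; apply: stripe_uncut; apply: (block_lt_lev lambda_gt0) => //; rewrite li.
  have [[x [Ajx [l dil UVx]]]|disj] :=
      pselect (exists x, carrier (A j) x /\ removed i x).
    have /andP[/eqP li _] := dil.
    right; apply/seteqP; split => // y [[_ nry] /core_sub Ajy]; apply: nry.
    have [c [cmn Sx]] : exists c, (c = m \/ c = n) /\ star (S c (A l)) x.
      by case: UVx => ?; [exists m|exists n]; split => //; [left|right].
    have [AS|AS] := uncut c l (esym li); last first.
      by have : (carrier (A j) `&` star (S c (A l))) x by []; rewrite AS.
    exists l => //.
    by case: cmn AS => -> AS; [left|right]; exact: AS.
  have [[x [Ajx UVx]]|disj'] := pselect (exists x, carrier (A j) x /\
      (star (S m (A i)) `|` star (S n (A i))) x).
    left; have [c [cmn Sx]] : exists c, (c = m \/ c = n) /\ star (S c (A i)) x.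
      by case: UVx => ?; [exists m|exists n]; split => //; [left|right].
    have [AS|AS] := uncut c i erefl; last first.
      by have : (carrier (A j) `&` star (S c (A i))) x by []; rewrite AS.
    move=> y /core_sub Ajy; split; last by move=> ry; apply: disj; exists y.
    by case: cmn AS => -> AS; [left|right]; exact: AS.
  right; apply/seteqP; split => // y [[UVy _] /core_sub Ajy].
  by apply: disj'; exists y.
have same i j : block (A i) = block (A j) -> lev (A i) < lev (A j) ->
    core i `&` core j = set0.
  move=> bij lij; apply/seteqP; split => // y [[_ nry] [UVy _]]; apply: nry.
  by exists j => //; apply/andP; split => //; exact/eqP.
move=> i j; have [bij|bij|bij] := ltgtP (block (A i)) (block (A j)).
- by case: (later i j bij); [constructor 2|constructor 3].
- case: (later j i bij); [by constructor 1|by rewrite setIC; constructor 3].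
have [lij|lij|lij] := ltgtP (lev (A i)) (lev (A j)).
- by constructor 3; exact: same.
- by constructor 3; rewrite setIC; exact: same.
have [->|ij] := eqVneq i j; first by constructor 1.
constructor 3; apply/seteqP; split => // y [/core_sub Aiy /core_sub Ajy].
by move/eqP: ij; apply; apply: A_inj; exact: same_level_carrier lij Aiy Ajy.
Qed.

Lemma deeper_level i j : deeper i j -> exists t : 'I_lambda,
  lev (A j) = lev (A i) + (t.+1 * L)%:Z /\ (t.+1 * L < lambda)%N.
Proof.
move=> /andP[/eqP bij lij].
have dl := block_eq_lev lambda_gt0 bij.
have : (L%:Z %| lev (A j) - lev (A i))%Z by rewrite -eqz_mod_dvd; apply/eqP/lev_mod.
move=> /dvdzP[z zE].
have z0 : 0 < z.
  have : 0 < z * L%:Z by rewrite -zE subr_gt0.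
  by rewrite pmulr_lgt0.
case: z z0 zE => // -[//|t] _ zE.
have tL : (t.+1 * L < lambda)%N by rewrite -ltz_nat PoszM -zE.
have tl : (t < lambda)%N by apply: leq_ltn_trans tL; rewrite ltnW // leq_pmulr.
by exists (Ordinal tl); split => //=; rewrite PoszM -zE addrC subrK.
Qed.

Local Notation rho := (Defs.ratio Q `^ (L%:R * eps)).

Lemma rho_lt1 : 0 < rho /\ rho < 1.
Proof.
have q0 := ratio_gt0 Q; have q1 := ratio_lt1 Q.
split; first exact: powR_gt0.
have e0 : 0 < L%:R * eps by rewrite mulr_gt0 // ltr0n.
by have := gt0_ltr_powR e0 _ _ q1; rewrite powR1; apply; rewrite ?nnegrE ltW.
Qed.

(** Sorting the cubes below A by level, those of the level t.+1 * L below A that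
    meet the stripe are disjoint members of its hull of that level, and the hulls
    decay geometrically. *)
Lemma deeper_sum i c :
  \sum_(j | deeper i j && `[< carrier (A j) `&` star (S c (A i)) !=set0 >])
     fv (carrier (A j)) <= K * (rho / (1 - rho)) * fv (carrier (A i)).
Proof.
have [r0 r1] := rho_lt1.
pose P j := deeper i j && `[< carrier (A j) `&` star (S c (A i)) !=set0 >].
pose Pt (t : 'I_lambda) j := P j && (lev (A j) == lev (A i) + (t.+1 * L)%:Z).
apply: (@le_trans _ _ (\sum_(t < lambda) \sum_(j | Pt t j) fv (carrier (A j)))).
  rewrite (exchange_big_dep P) /=; last by move=> t j _ /andP[].
  apply: ler_sum => j Pj; have /andP[/deeper_level[t [tE _]] _] := Pj.
  rewrite (bigD1 t) /=; last by apply/andP; split => //; apply/eqP.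
  by rewrite lerDl sumr_ge0 // => ? _; exact: fvol_ge0.
have level t : \sum_(j | Pt t j) fv (carrier (A j))
    <= K * (fv (carrier (A i))) * rho ^+ t.+1.
  have nn : 0 <= K * (fv (carrier (A i))) * rho ^+ t.+1.
    by rewrite !mulr_ge0 ?fvol_ge0 ?exprn_ge0 ?(ltW r0) // (le_trans ler01).
  have [tL|tL] := ltnP (t.+1 * L) lambda; last first.
    rewrite big_pred0 // => j; apply/negbTE/negP => /andP[Pj /eqP tE].
    have /andP[/deeper_level[t' [t'E t'L]] _] := Pj.
    move: tE; rewrite t'E => /addrI[tt']; move: t'L; rewrite tt' ltnNge tL //.
  have hull_le := stripe_hull_le HS c (A i) tL.
  have hull_fin : (mu (star (stripe_hull (S c) (t.+1 * L) (A i))) < +oo)%E.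
    by apply: (le_lt_trans hull_le); rewrite (fvolE (vol_carrier_lty _)) -EFinM ltry.
  apply: (@le_trans _ _ (fv (star (stripe_hull (S c) (t.+1 * L) (A i))))).
    apply: sum_fvol_le => //; first exact: measurable_star.
    - by move=> j _; exact: measurable_carrier.
    - apply/nearW => x j j' /andP[_ /eqP jt] /andP[_ /eqP jt'] jj' [Ajx Ajx'].
      move/eqP: jj'; apply; apply: A_inj; apply: same_level_carrier Ajx Ajx'.
      by rewrite jt jt'.
    - move=> j /andP[/andP[_ /asboolP ne] /eqP jt] x Ajx.
      by exists (A j).
  move: hull_le; rewrite (fvolE hull_fin) (fvolE (vol_carrier_lty _)) -EFinM lee_fin.
  move=> /le_trans; apply.
  have -> : Defs.ratio Q `^ ((t.+1 * L)%:R * eps) = rho ^+ t.+1.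
    rewrite -powR_mulrn; last exact: powR_ge0.
    by rewrite -powRrM natrM -mulrA mulrC.
  rewrite mulrAC ler_wpM2r ?exprn_ge0 ?(ltW r0) // ler_wpM2r ?fvol_ge0 //.
apply: (le_trans (ler_sum _ (fun t _ => level t))).
rewrite -mulr_sumr mulrAC ler_wpM2r ?fvol_ge0 // ler_wpM2l ?(le_trans ler01) //.
rewrite ler_pdivlMr ?subr_gt0 //.
have -> : (\sum_(t < lambda) rho ^+ t.+1) * (1 - rho) = rho - rho ^+ lambda.+1.
  elim: lambda => [|l IH]; first by rewrite big_ord0 mul0r expr1 subrr.
  by rewrite big_ord_recr /= mulrDl IH mulrBr mulr1 -exprSr addrA subrK.
by rewrite lerBlDr lerDl exprn_ge0 // ltW.
Qed.

(** The stripes of deeper cubes of the same block cover only a small part of a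
    stripe: this is where the decay of the hulls enters. *)
Lemma removed_small c i :
  fv (star (S c (A i)) `&` removed i)
    <= 2 * K ^+ 3 * (rho / (1 - rho)) * fv (star (S c (A i))).
Proof.
have [r0 r1] := rho_lt1; have K0 : 0 < K by rewrite (lt_le_trans ltr01).
have M0 : 0 < M%:R :> R by rewrite ltr0n; case: (M) c => // -[].
pose P j := deeper i j && `[< carrier (A j) `&` star (S c (A i)) !=set0 >].
have mUV j : measurable (star (S m (A j)) `|` star (S n (A j))).
  by apply: measurableU; exact: measurable_star.
have UV_le j : (mu (star (S m (A j)) `|` star (S n (A j)))
    <= (fv (star (S m (A j))) + fv (star (S n (A j))))%:E)%E.
  rewrite EFinD -!fvolE; [|exact: star_lty..].
  by apply: measureU2; exact: measurable_star.
have UV_fin j : (mu (star (S m (A j)) `|` star (S n (A j))) < +oo)%E.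
  exact: le_lt_trans (UV_le j) (ltry _).
have step1 : fv (star (S c (A i)) `&` removed i)
    <= \sum_(j | P j) (fv (star (S m (A j))) + fv (star (S n (A j)))).
  apply: (@le_trans _ _ (\sum_(j | P j) fv (star (S m (A j)) `|` star (S n (A j))))).
    apply: fvol_le_sum => //.
      by apply: measurableI; [exact: measurable_star|exact: measurable_removed].
    apply/nearW => x [Sx [j dij UVx]]; exists j => //.
    apply/andP; split => //; apply/asboolP; exists x; split => //.
    by case: UVx => /star_sub_carrier.
  by apply: ler_sum => j _; rewrite -lee_fin -fvolE.
rewrite -(ler_pM2l M0) (le_trans (ler_wpM2l (ltW M0) step1)) // mulr_sumr.
apply: (@le_trans _ _ (\sum_(j | P j) 2 * K * fv (carrier (A j)))).
  apply: ler_sum => j _; rewrite mulrDr -mulrA (mulr_natl _ 2) mulr2n.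
  by apply: lerD; exact: stripe_fvol_le.
have K2_ge0 : 0 <= 2 * K by rewrite mulr_ge0 // ltW.
rewrite -mulr_sumr (le_trans (ler_wpM2l K2_ge0 (deeper_sum i c))) //.
have rr0 : 0 <= rho / (1 - rho) by apply: divr_ge0; rewrite ?subr_ge0 ltW.
have h := stripe_fvol_ge c (A i).
have c0 : 0 <= 2 * K * (K * (rho / (1 - rho))) by apply: mulr_ge0 => //; apply: mulr_ge0 rr0; exact: ltW.
rewrite [X in X <= _]mulrA (le_trans (ler_wpM2l c0 h)) // le_eqVlt; apply/orP; left; apply/eqP.
ring.
Qed.

End group.
End stripe_geometry.

(** * Means of the functions on the stripes *)

Section stripe_averages.
Context (R : realType) (disp : measure_display) (X : measurableType disp).
Context (H : homogeneous_space R X) (Q : dyadic_system H) (k : scalar_kind).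
Local Notation mu := (vol H).
Local Notation fv := (fvol mu).
Local Notation SK := ((scalars R k)^o).
Variables (p K1 K2 eps Cg : R) (lambda M : nat).
Variables (S : 'I_M -> cube Q -> set (cube Q)) (g : 'I_M -> cube Q -> X -> SK).
Hypotheses (p1 : 1 <= p) (Cg_ge1 : 1 <= Cg).
Hypotheses (HS : stripes K1 K2 eps lambda S) (Hg : stripe_functions p Cg S g).
Implicit Types (A : cube Q) (c : 'I_M).

Let Cg0 : 0 < Cg. Proof. by rewrite (lt_le_trans ltr01). Qed.

Lemma stripe_fun_Lp c A : in_Lp mu p (g c A).
Proof.
have [le [F [_ _ _ [_ _ HLp _ _]]]] := stripe_fun_mds Hg.
exact: HLp (c, A).
Qed.

Lemma stripe_fun_measurable c A : strongly_measurable measurable (g c A).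
Proof. by have [] := stripe_fun_Lp c A. Qed.

Lemma measurable_stripe_fun c A :
  measurable_fun setT (fun x => (vnorm (g c A x))%:E).
Proof. exact/measurable_EFinP/measurable_vnorm/stripe_fun_measurable. Qed.

Definition stripe_int c A : \bar R := (\int[mu]_x (vnorm (g c A x))%:E)%E.

Lemma integral_star_indic c A (t : R) : 0 <= t ->
  (\int[mu]_x (t * \1_(star (S c A)) x)%:E = (t * fv (star (S c A)))%:E)%E.
Proof.
move=> t0; under eq_integral do rewrite EFinM.
rewrite ge0_integralZl_EFin //; last first.
  by apply/measurable_EFinP/measurable_indic; exact: measurable_star.
rewrite integral_indic ?setIT //; last exact: measurable_star.
by rewrite EFinM -fvolE //; exact: (star_lty HS).
Qed.

Lemma measurable_star_indic c A (t : R) :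
  measurable_fun setT (fun x => (t * \1_(star (S c A)) x)%:E).
Proof.
apply/measurable_EFinP/measurable_funM => //.
by apply/measurable_indic; exact: measurable_star.
Qed.

(** On a set of finite measure, |g| <= 1 + |g|^p. *)
Lemma stripe_int_lty c A : (stripe_int c A < +oo)%E.
Proof.
have HLp : (energy mu p (g c A) < +oo)%E.
  by have [_ /(Lp_norm_lty _ p1)] := stripe_fun_Lp c A.
apply: (@le_lt_trans _ _ (\int[mu]_x ((1 * \1_(star (S c A)) x)%:E
    + (pnorm p (g c A x))%:E))%E).
  apply: ae_ge0_le_integral => //.
  - by move=> x _; rewrite lee_fin vnorm_ge0.
  - exact: measurable_stripe_fun.
  - by move=> x _; rewrite -EFinD lee_fin addr_ge0 ?pnorm_ge0 // mul1r.
  - apply: emeasurable_funD; first exact: measurable_star_indic.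
    exact/measurable_epnorm/stripe_fun_measurable.
  apply: filterS (stripe_fun_supp Hg c A) => x Hx _; rewrite -EFinD lee_fin mul1r.
  have [xS|xS] := pselect (star (S c A) x); last first.
    by rewrite Hx // vnorm0 addr_ge0 // pnorm_ge0.
  rewrite indicE mem_set //=; have [v1|v1] := leP (vnorm (g c A x)) 1.
    by rewrite (le_trans v1) // lerDl pnorm_ge0.
  by rewrite ler_wpDl // /pnorm le1r_powR // ltW.
rewrite ge0_integralD //; last 3 first.
- exact: measurable_star_indic.
- by move=> x _; rewrite lee_fin pnorm_ge0.
- exact/measurable_epnorm/stripe_fun_measurable.
by rewrite integral_star_indic // lte_add_pinfty ?ltry.
Qed.

Definition stripe_avg c A : R := fine (stripe_int c A) / fv (star (S c A)).

Lemma stripe_intE c A : stripe_int c A = (stripe_avg c A * fv (star (S c A)))%:E.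
Proof.
rewrite /stripe_avg divfK ?fineK //.
  by rewrite ge0_fin_numE ?stripe_int_lty // integral_ge0 // => x _; rewrite lee_fin vnorm_ge0.
by rewrite gt_eqF // (fvol_star_gt0 HS (K := Num.max K1 1)) // le_max lexx ?orbT.
Qed.

Lemma stripe_avg_ge0 c A : 0 <= stripe_avg c A.
Proof.
by rewrite divr_ge0 ?fvol_ge0 // fine_ge0 // integral_ge0 // => x _; rewrite lee_fin vnorm_ge0.
Qed.

Lemma stripe_fun_le_avg c c' A : c != c' ->
  {ae mu, forall x, vnorm (g c A x) <= Cg * stripe_avg c' A}.
Proof.
move=> cc'; have := stripe_fun_bound Hg A cc'.
rewrite -/(stripe_int c' A) stripe_intE -EFinM.
have -> : Cg / fine (mu (star (S c' A))) * (stripe_avg c' A * fv (star (S c' A)))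
    = Cg * stripe_avg c' A.
  rewrite -/(fv (star (S c' A))).
  have s0 : fv (star (S c' A)) != 0.
    by rewrite gt_eqF // (fvol_star_gt0 HS (K := Num.max K1 1)) // le_max lexx ?orbT.
  by field.
rewrite /Lp_norm unlock ifT; last first.
  apply: (lt_le_trans (vol_carrier_gt0 A)); apply: le_measure; rewrite ?inE //.
  exact: measurable_carrier.
move=> /ess_supP; apply: filterS => x /=.
by rewrite lee_fin ger0_norm // vnorm_ge0.
Qed.

(** The comparison is used twice: from the stripe c to the stripe c' and back. *)
Lemma stripe_fun_le_own_avg c c' A : c != c' ->
  {ae mu, forall x, vnorm (g c A x) <= Cg ^+ 2 * stripe_avg c A}.
Proof.
move=> cc'; have c'c : c' != c by rewrite eq_sym.
have avg_le : stripe_avg c' A <= Cg * stripe_avg c A.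
  have b0 : 0 <= Cg * stripe_avg c A by rewrite mulr_ge0 ?stripe_avg_ge0 ?(ltW Cg0).
  have s0 : 0 < fv (star (S c' A)).
    by rewrite (fvol_star_gt0 HS (K := Num.max K1 1)) // le_max lexx ?orbT.
  rewrite -(ler_pM2r s0) -lee_fin -stripe_intE -integral_star_indic //.
  apply: ae_ge0_le_integral => //.
  - by move=> x _; rewrite lee_fin vnorm_ge0.
  - exact: measurable_stripe_fun.
  - by move=> x _; rewrite lee_fin mulr_ge0.
  - exact: measurable_star_indic.
  apply: filterS2 (stripe_fun_le_avg A c'c) (stripe_fun_supp Hg c' A) => x H1 H2 _.
  rewrite lee_fin indicE; case: (boolP (x \in _)) => [_|/negP xS]; first by rewrite mulr1.
  by rewrite H2 ?vnorm0 ?mulr0 // => xS'; apply: xS; exact: mem_set.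
apply: filterS (stripe_fun_le_avg A cc') => x /le_trans; apply.
by rewrite expr2 -mulrA ler_wpM2l // ltW.
Qed.

Definition large_part c A : set X :=
  star (S c A) `&` [set x | stripe_avg c A / 2 <= vnorm (g c A x)].

Lemma measurable_large_part c A : measurable (large_part c A).
Proof.
apply: measurableI; first exact: measurable_star.
rewrite -[X in measurable X]setTI; apply: measurable_fun_le => //.
exact/measurable_vnorm/stripe_fun_measurable.
Qed.

(** A function bounded by a multiple of its mean is comparable with it on a
    fixed portion of the stripe. *)
Lemma large_part_fvol c c' A : c != c' ->
  fv (star (S c A)) <= 2 * Cg ^+ 2 * fv (large_part c A).
Proof.
move=> cc'; set b := stripe_avg c A; have b0 : 0 <= b := stripe_avg_ge0 c A.
have CC : 1 <= Cg ^+ 2 by rewrite exprn_ege1.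
have [bz|bz] := eqVneq b 0.
  have -> : large_part c A = star (S c A).
    apply/seteqP; split=> x; first by case.
    by move=> Sx; split => //=; rewrite -/b bz mul0r vnorm_ge0.
  by rewrite ler_peMl ?fvol_ge0 //; lra.
have bp : 0 < b by rewrite lt0r bz.
have mW := measurable_large_part c A.
have W_fin : (mu (large_part c A) < +oo)%E.
  apply: le_lt_trans (star_lty HS c A); apply: le_measure; rewrite ?inE //.
    exact: measurable_star.
  exact: subIsetl.
have C0 : 0 <= Cg ^+ 2 * b by rewrite mulr_ge0 // (le_trans ler01).
have b20 : 0 <= b / 2 by rewrite divr_ge0.
have mI : measurable_fun setT (fun x => (Cg ^+ 2 * b * \1_(large_part c A) x)%:E).
  by apply/measurable_EFinP/measurable_funM => //; exact: measurable_indic.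
have : (stripe_int c A <= \int[mu]_x ((Cg ^+ 2 * b * \1_(large_part c A) x)%:E
    + (b / 2 * \1_(star (S c A)) x)%:E))%E.
  apply: ae_ge0_le_integral => //.
  - by move=> x _; rewrite lee_fin vnorm_ge0.
  - exact: measurable_stripe_fun.
  - by move=> x _; rewrite -EFinD lee_fin addr_ge0 // mulr_ge0.
  - by apply: emeasurable_funD => //; exact: measurable_star_indic.
  apply: filterS2 (stripe_fun_le_own_avg A cc') (stripe_fun_supp Hg c A) => x H1 H2 _.
  rewrite -EFinD lee_fin.
  have [xS|xS] := pselect (star (S c A) x); last first.
    by rewrite H2 // vnorm0 addr_ge0 // mulr_ge0.
  have [xW|xW] := pselect (large_part c A x).
    by rewrite !indicE !mem_set //= !mulr1 (le_trans H1) // lerDl.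
  rewrite !indicE memNset // mem_set //= mulr0 add0r mulr1 leNgt.
  by apply/negP => lt; apply: xW; split => //=; exact: ltW.
rewrite ge0_integralD //; last 3 first.
- by move=> x _; rewrite lee_fin mulr_ge0.
- by move=> x _; rewrite lee_fin mulr_ge0.
- exact: measurable_star_indic.
rewrite integral_star_indic // stripe_intE -/b.
under eq_integral do rewrite EFinM.
rewrite ge0_integralZl_EFin //; last first.
  by apply/measurable_EFinP; exact: measurable_indic.
rewrite integral_indic // setIT fvolE // -EFinM -EFinD lee_fin => h.
rewrite -(ler_pM2l bp); lra.
Qed.

End stripe_averages.

(** * Comparison for finite families of cubes *)

Section comparison.
Context (R : realType) (disp : measure_display) (X : measurableType disp).
Context (H : homogeneous_space R X) (Q : dyadic_system H) (k : scalar_kind).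
Context (E : normedModType (scalars R k)).
Local Notation mu := (vol H).
Local Notation fv := (fvol mu).
Local Notation SK := ((scalars R k)^o).
Local Notation ofr := (@ofreal R k).
Variables (p K1 K2 eps Cg beta K : R) (lambda M : nat).
Variables (S : 'I_M -> cube Q -> set (cube Q)) (g : 'I_M -> cube Q -> X -> SK).
Hypotheses (p1 : 1 <= p) (Cg_ge1 : 1 <= Cg) (beta_ge1 : 1 <= beta).
Hypotheses (Hbeta : umd_constant E p beta) (eps_gt0 : 0 < eps).
Hypotheses (K_ge1 : 1 <= K) (K1K : K1 <= K) (K2K : K2 <= K).
Hypotheses (HS : stripes K1 K2 eps lambda S) (Hg : stripe_functions p Cg S g).
Hypothesis lambda_gt0 : (0 < lambda)%N.
Variable L : nat.
Hypothesis L_gt0 : (0 < L)%N.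
Local Notation rho := (Defs.ratio Q `^ (L%:R * eps)).
Hypothesis rho_small : 2 * K ^+ 3 * (rho / (1 - rho)) <= (4 * Cg ^+ 2)^-1.
Variables m n : 'I_M.
Hypothesis mn : m != n.

Let beta0 : 0 <= beta. Proof. by rewrite (le_trans ler01). Qed.
Let Cg2_ge1 : 1 <= Cg ^+ 2. Proof. by rewrite exprn_ege1. Qed.

Let Cg4_gt0 : 0 < 4 * Cg ^+ 2.
Proof. by apply: mulr_gt0 => //; exact: lt_le_trans Cg2_ge1. Qed.

Definition contraction_const (c : R) : R := 2 `^ p * 2 * c `^ p.
Definition stein_const (delta : R) : R := 2 `^ p * 2 * delta^-1 `^ p * (1 + beta).

(** One factor for each replacement made in the proof of the comparison within a
    group, in the order in which they are made. *)
Definition rademacher_const : R :=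
  contraction_const Cg * (stein_const 2^-1 * (contraction_const 1 *
    (stein_const (4 * Cg ^+ 2 * (1 + K))^-1 * contraction_const 2))).

Lemma rademacher_const_ge0 : 0 <= rademacher_const.
Proof.
have b1 : 0 <= 1 + beta by rewrite addr_ge0.
by rewrite !mulr_ge0 ?powR_ge0.
Qed.

Lemma in_Lp_stripe_tensor c A (e : E) : in_Lp mu p (tensor (g c A) e).
Proof. exact: (in_Lp_tensor p1 e (stripe_fun_Lp Hg c A)). Qed.

Lemma stripe_tensor_measurable c A (e : E) :
  strongly_measurable measurable (tensor (g c A) e).
Proof. by have [] := in_Lp_stripe_tensor c A e. Qed.

Section group.
Variables (N : nat) (A : 'I_N -> cube Q).
Hypothesis A_inj : injective A.
Hypothesis lev_mod : forall i j, (lev (A i) = lev (A j) %[mod L%:Z])%Z.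
Hypothesis block_mod : forall i j,
  (block lambda (A i) = block lambda (A j) %[mod 2])%Z.

Local Notation removed := (removed lambda S A m n).
Local Notation core := (core lambda S A m n).

Lemma star_removed_small c i :
  (mu (star (S c (A i)) `&` removed i)
     <= ((4 * Cg ^+ 2)^-1 * fv (star (S c (A i))))%:E)%E.
Proof.
have fin : (mu (star (S c (A i)) `&` removed i) < +oo)%E.
  apply: le_lt_trans (star_lty HS c (A i)); apply: le_measure; rewrite ?inE //.
  - by apply: measurableI; [exact: measurable_star|exact: measurable_removed].
  - exact: measurable_star.
rewrite (fvolE fin) lee_fin.
apply: le_trans (removed_small HS K_ge1 K1K K2K eps_gt0 A_inj L_gt0 lambda_gt0 lev_mod m n c i) _.
by rewrite ler_wpM2r ?fvol_ge0.
Qed.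

Lemma trimmed_stripe_large i :
  ((2^-1)%:E * mu (star (S m (A i))) <= mu (star (S m (A i)) `\` removed i))%E.
Proof.
have mS := measurable_star (S m (A i)); have mR := measurable_removed lambda S A m n i.
have fS := star_lty HS m (A i).
have splitS : mu (star (S m (A i)))
    = (mu (star (S m (A i)) `\` removed i) + mu (star (S m (A i)) `&` removed i))%E.
  by rewrite -measureDI.
have fin1 : (mu (star (S m (A i)) `\` removed i) < +oo)%E.
  apply: le_lt_trans fS; apply: le_measure; rewrite ?inE //; exact: measurableD.
have := star_removed_small m i; have fin2 := le_lt_trans (star_removed_small m i) (ltry _).
rewrite (fvolE fin2) lee_fin => h.
move: splitS; rewrite (fvolE fS) (fvolE fin1) (fvolE fin2) -EFinD => -[e].
rewrite -EFinM lee_fin.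
have : (4 * Cg ^+ 2)^-1 * fv (star (S m (A i))) <= 4^-1 * fv (star (S m (A i))).
  by rewrite ler_wpM2r ?fvol_ge0 // lef_pV2 ?posrE ?Cg4_gt0 // ler_peMr.
by have := fvol_ge0 mu (star (S m (A i))); lra.
Qed.

Definition trimmed_large_part i : set X := large_part S g n (A i) `\` removed i.

Lemma measurable_trimmed_large_part i : measurable (trimmed_large_part i).
Proof.
apply: measurableD; last exact: measurable_removed.
exact: measurable_large_part Hg n (A i).
Qed.

Lemma measurable_core i : measurable (core i).
Proof.
apply: measurableD; last exact: measurable_removed.
by apply: measurableU; exact: measurable_star.
Qed.

Lemma core_lty i : (mu (core i) < +oo)%E.
Proof.
apply: le_lt_trans (vol_carrier_lty (A i)); apply: le_measure; rewrite ?inE.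
- exact: measurable_core.
- exact: measurable_carrier.
- by move=> x; exact: (core_sub HS).
Qed.

(** The part W of V has a proportion 1 / (2 Cg ^ 2) of its measure and at most half
    of that is removed; the core is at most 1 + K times as large as V. *)
Lemma trimmed_large_part_large i :
  (((4 * Cg ^+ 2 * (1 + K))^-1)%:E * mu (core i) <= mu (trimmed_large_part i))%E.
Proof.
have nm : n != m by rewrite eq_sym.
have C0 : 0 < Cg ^+ 2 by rewrite (lt_le_trans ltr01).
have K0 : 0 < 1 + K by rewrite addr_gt0 // (lt_le_trans ltr01).
have mW := measurable_large_part Hg n (A i); have mR := measurable_removed lambda S A m n i.
have mS := measurable_star (S n (A i)).
have fS := star_lty HS n (A i).
have WS : large_part S g n (A i) `<=` star (S n (A i)) by exact: subIsetl.
have fW : (mu (large_part S g n (A i)) < +oo)%E.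
  by apply: le_lt_trans fS; apply: le_measure; rewrite ?inE.
have fT : (mu (trimmed_large_part i) < +oo)%E.
  apply: le_lt_trans fW; apply: le_measure; rewrite ?inE //.
    exact: measurable_trimmed_large_part.
  exact: subDsetl.
have WR : (mu (large_part S g n (A i) `&` removed i)
    <= ((4 * Cg ^+ 2)^-1 * fv (star (S n (A i))))%:E)%E.
  apply: le_trans (star_removed_small n i); apply: le_measure; rewrite ?inE.
  - exact: measurableI.
  - exact: measurableI.
  - exact: setSI.
have fWR := le_lt_trans WR (ltry _).
have splitW : mu (large_part S g n (A i))
    = (mu (trimmed_large_part i) + mu (large_part S g n (A i) `&` removed i))%E.
  by rewrite -measureDI.
have core_le : (mu (core i) <= (fv (star (S m (A i))) + fv (star (S n (A i))))%:E)%E.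
  rewrite EFinD -!fvolE ?(star_lty HS) //.
  apply: (@le_trans _ _ (mu (star (S m (A i)) `|` star (S n (A i))))).
    apply: le_measure; rewrite ?inE; [exact: measurable_core| |exact: subDsetl].
    by apply: measurableU; exact: measurable_star.
  by apply: measureU2; exact: measurable_star.
have large := large_part_fvol p1 Cg_ge1 HS Hg (A i) nm.
have cmp := stripe_comparableK HS K1K (A i) m n.
move: splitW WR; rewrite (fvolE fW) (fvolE fT) (fvolE fWR) -EFinD => -[e].
rewrite lee_fin => WR.
move: core_le; rewrite (fvolE (core_lty i)) lee_fin => core_le.
rewrite -EFinM lee_fin mulrC ler_pdivrMr; last exact: mulr_gt0.
have s4 : (4 * Cg ^+ 2) * ((4 * Cg ^+ 2)^-1 * fv (star (S n (A i))))
    = fv (star (S n (A i))) by rewrite mulVKf // gt_eqF.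
have WR4 : 4 * Cg ^+ 2 * fv (large_part S g n (A i) `&` removed i)
    <= fv (star (S n (A i))) by rewrite -s4 ler_wpM2l // ltW.
have T4 : fv (star (S n (A i))) <= 4 * Cg ^+ 2 * fv (trimmed_large_part i).
  have -> : fv (trimmed_large_part i) = fv (large_part S g n (A i))
    - fv (large_part S g n (A i) `&` removed i) by rewrite e addrK.
  by rewrite mulrBr; lra.
have T5 : (1 + K) * fv (star (S n (A i)))
    <= (1 + K) * (4 * Cg ^+ 2 * fv (trimmed_large_part i)) by rewrite ler_wpM2l // ltW.
rewrite [leRHS](_ : _ = (1 + K) * (4 * Cg ^+ 2 * fv (trimmed_large_part i))).
  by apply: (le_trans core_le); apply: le_trans T5; lra.
ring.
Qed.

Lemma star_laminar c : laminar (fun i => star (S c (A i))).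
Proof.
move=> i j.
have [h|h|h] := @stripe_nested _ _ _ _ _ _ _ _ _ _ _ HS c (star (S c (A i)))
    (star (S c (A j))) (ex_intro2 _ _ (A i) I erefl) (ex_intro2 _ _ (A j) I erefl).
- by constructor 1; rewrite -h; exact: subIsetr.
- by constructor 2; rewrite -h; exact: subIsetl.
- by constructor 3.
Qed.

(** The chain of replacements: functions on U, indicators of U, of U trimmed, of
    the core, of the trimmed part of V where the function is large, functions on
    V. *)
Lemma group_rademacher (c : 'I_N -> E) :
  (rademacher_energy mu p (fun j => tensor (g m (A j)) (c j))
   <= rademacher_const%:E
      * rademacher_energy mu p (fun j => tensor (g n (A j)) (c j)))%E.
Proof.
have nm : n != m by rewrite eq_sym.
pose v j := ofr (stripe_avg S g n (A j)) *: c j.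
have cc0 t : 0 <= contraction_const t by rewrite !mulr_ge0 ?powR_ge0.
have sc0 t : 0 <= stein_const t.
  by rewrite !mulr_ge0 ?powR_ge0 // addr_ge0.
pose ind (B : 'I_N -> set X) j x := \1_(B j) x *: v j.
have mind (B : 'I_N -> set X) j : measurable (B j) ->
  strongly_measurable measurable (ind B j) by exact: strongly_measurable_indic.
have step0 : (rademacher_energy mu p (fun j => tensor (g m (A j)) (c j))
   <= (contraction_const Cg)%:E
      * rademacher_energy mu p (ind (fun j => star (S m (A j)))))%E.
  apply: rademacher_energy_contraction => //.
  - by move=> j; exact: stripe_tensor_measurable.
  - by move=> j; apply: mind; exact: measurable_star.
  apply: ae_forall_finType => j.
  apply: filterS2 (stripe_fun_le_avg p1 HS Hg (A j) mn) (stripe_fun_supp Hg m (A j)).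
  move=> x le_avg supp; set b := stripe_avg S g n (A j) in le_avg *.
  have b0 : 0 <= b by exact: stripe_avg_ge0.
  have Cg0 : 0 <= Cg by rewrite (le_trans ler01).
  have [bz|bz] := eqVneq b 0.
    exists 0; first by rewrite vnorm0.
    move: le_avg; rewrite bz mulr0 => le0.
    have /eqP : vnorm (g m (A j) x) == 0 by rewrite eq_le le0 vnorm_ge0.
    by move/eqP; rewrite vnorm_eq0 /tensor => /eqP->; rewrite !scale0r.
  exists (g m (A j) x / ofr b).
    have bp : 0 < b by rewrite lt0r bz.
    have := @vnormZr R k SK b^-1 (g m (A j) x).
    rewrite /GRing.scale /= mulrC ofrealV => ->.
    by rewrite ger0_norm ?invr_ge0 // mulrC ler_pdivrMr.
  rewrite /ind /tensor /v -/b scalerA scalerA.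
  have [xS|xS] := pselect (star (S m (A j)) x); last first.
    by rewrite supp // mul0r !mul0r.
  by rewrite indicE mem_set // mulr1 divfK // ofreal_eq0.
have step1 : (rademacher_energy mu p (ind (fun j => star (S m (A j))))
   <= (stein_const 2^-1)%:E
      * rademacher_energy mu p (ind (fun j => star (S m (A j)) `\` removed j)))%E.
  apply: stein => //.
  - by move=> j; exact: measurable_star.
  - by move=> j; apply: measurableD; [exact: measurable_star|exact: measurable_removed].
  - by move=> j; exact: (star_lty HS).
  - exact: star_laminar.
  - exact: trimmed_stripe_large.
have step2 : (rademacher_energy mu p (ind (fun j => star (S m (A j)) `\` removed j))
   <= (contraction_const 1)%:E * rademacher_energy mu p (ind core))%E.
  apply: rademacher_energy_contraction => //.
  - move=> j; apply: mind.
    by apply: measurableD; [exact: measurable_star|exact: measurable_removed].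
  - by move=> j; apply: mind; exact: measurable_core.
  apply/nearW => x j; have [xF|xF] := pselect ((star (S m (A j)) `\` removed j) x).
    exists 1; first by rewrite /vnorm normr1 -(ofreal1 R k) ofrealK.
    rewrite scale1r /ind !indicE !mem_set //.
    by case: xF => xm nr; split => //; left.
  exists 0; first by rewrite vnorm0.
  by rewrite /ind indicE memNset // !scale0r.
have step3 : (rademacher_energy mu p (ind core)
   <= (stein_const (4 * Cg ^+ 2 * (1 + K))^-1)%:E
      * rademacher_energy mu p (ind trimmed_large_part))%E.
  apply: stein => //.
  - by move=> j x [[xS _] nr]; split => //; right.
  - exact: measurable_core.
  - exact: measurable_trimmed_large_part.
  - exact: core_lty.
  - exact: (core_laminar HS A_inj lambda_gt0 block_mod).
  - rewrite invr_gt0; apply: mulr_gt0 => //.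
    by rewrite addr_gt0 // (lt_le_trans ltr01).
  - exact: trimmed_large_part_large.
have step4 : (rademacher_energy mu p (ind trimmed_large_part)
   <= (contraction_const 2)%:E
      * rademacher_energy mu p (fun j => tensor (g n (A j)) (c j)))%E.
  apply: rademacher_energy_contraction => //.
  - by move=> j; apply: mind; exact: measurable_trimmed_large_part.
  - by move=> j; exact: stripe_tensor_measurable.
  apply/nearW => x j; set b := stripe_avg S g n (A j).
  have b0 : 0 <= b by exact: stripe_avg_ge0.
  have [xW|xW] := pselect (trimmed_large_part j x); last first.
    exists 0; first by rewrite vnorm0.
    by rewrite /ind indicE memNset // !scale0r.
  have [bz|bz] := eqVneq b 0.
    exists 0; first by rewrite vnorm0.
    by rewrite /ind /v -/b bz ofreal0 !scale0r scaler0.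
  have bp : 0 < b by rewrite lt0r bz.
  have [[_ /= b_le] _] := xW; rewrite -/b in b_le.
  have g0 : 0 < vnorm (g n (A j) x) by rewrite (lt_le_trans _ b_le) // divr_gt0.
  have gn0 : g n (A j) x != 0 by rewrite -vnorm_eq0 gt_eqF.
  exists (ofr b / g n (A j) x); last first.
    by rewrite /ind /tensor /v -/b indicE mem_set // scale1r scalerA divfK.
  have /(congr1 (@toreal R k)) : `|ofr b / g n (A j) x| =
      ofr (b / vnorm (g n (A j) x)).
    rewrite normrM normfV norm_ofreal ger0_norm // ofrealM ofrealV.
    by congr (_ / _); exact: (@vnormK R k SK).
  rewrite ofrealK /vnorm => ->.
  by rewrite ler_pdivrMr //; move: b_le; rewrite /vnorm; lra.
have chain (t s : R) (x y z : \bar R) : 0 <= t ->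
    (x <= t%:E * y)%E -> (y <= s%:E * z)%E -> (x <= (t * s)%:E * z)%E.
  move=> t0 xy yz; apply: (le_trans xy); rewrite EFinM -muleA.
  by apply: lee_wpmul2l => //; rewrite lee_fin.
have := chain _ _ _ _ _ (cc0 1) step2 (chain _ _ _ _ _ (sc0 _) step3 step4).
move=> /(chain _ _ _ _ _ (sc0 _) step1)/(chain _ _ _ _ _ (cc0 _) step0).
by rewrite /rademacher_const.
Qed.

Lemma group_energy (c : 'I_N -> E) :
  (energy mu p (fun x => (\sum_j tensor (g m (A j)) (c j) x)%R)
   <= (beta ^+ 2 * rademacher_const)%:E
      * energy mu p (fun x => (\sum_j tensor (g n (A j)) (c j) x)%R))%E.
Proof.
have gmds := stripe_fun_mds Hg.
have inj c' : injective (fun j => (c', A j) : 'I_M * cube Q).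
  by move=> i j [/A_inj].
have h1 := energy_le_rademacher p1 Hbeta gmds (inj m) c.
have h2 := rademacher_le_energy p1 Hbeta gmds (inj n) c.
have s0 : (0 < #|{ffun 'I_N -> bool}|%:R%:E :> \bar R)%E.
  by rewrite lte_fin ltr0n; apply/card_gt0P; exists [ffun=> true].
rewrite -(@lee_pmul2l _ #|{ffun 'I_N -> bool}|%:R%:E) //.
apply: (le_trans h1).
have b0 : (0 <= beta%:E)%E by rewrite lee_fin.
apply: (le_trans (lee_wpmul2l b0 (group_rademacher c))).
have br0 : (0 <= (beta * rademacher_const)%:E)%E.
  by rewrite lee_fin mulr_ge0 // rademacher_const_ge0.
rewrite muleA -EFinM (le_trans (lee_wpmul2l br0 h2)) //.
rewrite muleA -EFinM muleCA [in leLHS]mulrAC -expr2.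
rewrite le_eqVlt; apply/orP; left; apply/eqP; congr (_ * _)%E.
Qed.

End group.

Local Notation group := ('I_L.-1.+1 * 'I_2)%type.

Definition group_of (B : cube Q) : group :=
  (inord `|(lev B %% L%:Z)%Z|, inord `|(block lambda B %% 2)%Z|).

Lemma group_of_mod B B' : group_of B = group_of B' ->
  (lev B = lev B' %[mod L%:Z])%Z /\
  (block lambda B = block lambda B' %[mod 2])%Z.
Proof.
have inord_mod (d : nat) (x y : int) : (0 < d)%N ->
    inord `|(x %% d%:Z)%Z| = inord `|(y %% d%:Z)%Z| :> 'I_d.-1.+1 ->
    (x = y %[mod d%:Z])%Z.
  move=> d0 /(congr1 val); have dz : d%:Z != 0 by rewrite eqz_nat -lt0n.
  have lt z : (`|(z %% d%:Z)%Z| < d.-1.+1)%N.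
    by rewrite prednK // -ltz_nat gez0_abs ?modz_ge0 //; exact: ltz_pmod.
  rewrite /= !inordK // => xy.
  by rewrite -(gez0_abs (modz_ge0 x dz)) -(gez0_abs (modz_ge0 y dz)) xy.
move=> [H1 H2]; split; first exact: inord_mod.
exact: (inord_mod 2).
Qed.

Definition comparison_const : R :=
  #|{: group}|%:R `^ p *
    (#|{: group}|%:R * (beta ^+ 2 * rademacher_const * (1 + beta))).

(** The sum is split into its groups; each group of the image is a sub-sum, hence
    controlled by the whole sum. *)
Lemma finite_energy (J : finType) (A : J -> cube Q) (c : J -> E) :
  injective A ->
  (energy mu p (fun x => (\sum_j tensor (g m (A j)) (c j) x)%R)
   <= comparison_const%:E
      * energy mu p (fun x => (\sum_j tensor (g n (A j)) (c j) x)%R))%E.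
Proof.
move=> A_inj; have gmds := stripe_fun_mds Hg.
have inj : injective (fun j => (n, A j) : 'I_M * cube Q) by move=> i j [/A_inj].
pose kappa j := group_of (A j).
pose part c' (q : group) x := \sum_(j | kappa j == q) tensor (g c' (A j)) (c j) x.
have mpart c' q : strongly_measurable measurable (part c' q).
  rewrite /part; under eq_fun do rewrite big_mkcond.
  apply: (@strongly_measurable_sum R k E X measurable _ _
    (fun j x => if kappa j == q then tensor (g c' (A j)) (c j) x else 0)) => j.
  by case: (kappa j == q); [exact: stripe_tensor_measurable | exact: strongly_measurable0].
have split_sum : (fun x => \sum_j tensor (g m (A j)) (c j) x)
    = (fun x => \sum_(q <- enum {: group}) part m q x).
  by apply/funext => x; rewrite [RHS]big_enum [LHS](partition_big kappa predT).
have part_le q : (energy mu p (part m q)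
    <= (beta ^+ 2 * rademacher_const * (1 + beta))%:E
       * energy mu p (fun x => (\sum_j tensor (g n (A j)) (c j) x)%R))%E.
  have partE c' : part c' q = fun x =>
      \sum_(i < #|[pred j | kappa j == q]|)
         tensor (g c' (A (enum_val i))) (c (enum_val i)) x.
    apply/funext => x; rewrite /part.
    by rewrite (big_enum_val (A := [pred j | kappa j == q])
      (fun j => tensor (g c' (A j)) (c j) x)).
  have kq (i : 'I_#|[pred j | kappa j == q]|) : kappa (enum_val i) = q.
    by apply/eqP; exact: (enum_valP i).
  have := @group_energy _ (fun i : 'I_#|[pred j | kappa j == q]| => A (enum_val i))
    _ _ _ (fun i => c (enum_val i)).
  rewrite -!partE => h; apply: le_trans (h _ _ _) _.
  - by move=> i j /A_inj/enum_val_inj.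
  - by move=> i j; have [] := group_of_mod (etrans (kq i) (esym (kq j))).
  - by move=> i j; have [] := group_of_mod (etrans (kq i) (esym (kq j))).
  rewrite [X in (_ <= X * _)%E]EFinM -muleA; apply: lee_wpmul2l.
    by rewrite lee_fin mulr_ge0 ?rademacher_const_ge0 // exprn_ge0.
  exact: (energy_subsum p1 Hbeta gmds inj).
rewrite split_sum; apply: (le_trans (energy_sum mu p1 (enum {: group}) (mpart m))).
rewrite -cardE /comparison_const EFinM -muleA; apply: lee_wpmul2l.
  by rewrite lee_fin powR_ge0.
rewrite big_enum /=.
apply: (le_trans (lee_sum _ (fun q _ => part_le q))).
rewrite [X in (_ <= X * _)%E]EFinM -[leRHS]muleA -sum1_card natr_sum -sumEFin ge0_sume_distrl //.
by apply: lee_sum => q _; rewrite mul1e.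
Qed.

Lemma comparison_const_ge0 : 0 <= comparison_const.
Proof.
have b1 : 0 <= 1 + beta by rewrite addr_ge0.
rewrite mulr_ge0 ?powR_ge0 // mulr_ge0 // mulr_ge0 // mulr_ge0 ?exprn_ge0 //.
exact: rademacher_const_ge0.
Qed.

End comparison.

(** * Limits of strongly measurable functions *)

Section limits.
Context (R : realType) (k : scalar_kind) (E : normedModType (scalars R k)).
Context (disp : measure_display) (T : measurableType disp).
Local Notation sm := (@strongly_measurable R k E T measurable).

Section approximation.
Variables (f : T -> E) (v : nat -> E).

(** The n-th list represents the function sending x to a point nearest to f x
    among 0, v 0, ..., v (n - 1). *)
Fixpoint nearest (n : nat) : seq (set T * E) :=
  if n is n'.+1 then
    let B := [set x | vnorm (f x - v n') < vnorm (f x - step_fun (nearest n') x)] in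
    (B, v n') :: [seq (a.1 `\` B, a.2) | a <- nearest n']
  else [::].

Lemma step_nearestS n x : step_fun (nearest n.+1) x =
  if vnorm (f x - v n) < vnorm (f x - step_fun (nearest n) x)
  then v n else step_fun (nearest n) x.
Proof.
rewrite [LHS]/step_fun /= big_cons big_map /= indicE.
set B := [set y | _]; have [xB|xB] := pselect (B x).
  rewrite mem_set // scale1r (xB : _ < _) big1 ?addr0 // => a _ /=.
  by rewrite indicE memNset ?scale0r //= => -[_]; exact.
rewrite memNset // scale0r add0r ifF; last by apply/negP.
apply: eq_bigr => a _ /=; rewrite !indicE; congr (_%:R *: _).
by congr nat_of_bool; apply/idP/idP => /set_mem; [case=> ? _|move=> ?]; apply/mem_set.
Qed.

Lemma strongly_measurable_nearest :
  (forall g, sm g -> measurable_fun setT (fun x => vnorm (f x - g x))) ->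
  (forall (x : T) (e : R), 0 < e -> exists i, vnorm (f x - v i) < e) -> sm f.
Proof.
move=> mf dense.
have mnearest n : forall a, a \in nearest n -> measurable a.1.
  elim: n => //= n IH.
  have mB : measurable
      [set x | vnorm (f x - v n) < vnorm (f x - step_fun (nearest n) x)].
    suff [mg1 mg2] : measurable_fun setT (fun x => vnorm (f x - v n)) /\
        measurable_fun setT (fun x => vnorm (f x - step_fun (nearest n) x)).
      have := measurable_fun_ltr mg1 mg2 measurableT (Y := [set true]).
      by rewrite setTI; apply.
    split; apply: mf.
      exists (fun=> [:: (setT, v n)]).
        by move=> ? a; rewrite inE => /eqP->; exact: measurableT.
      move=> x; rewrite /step_fun; under eq_fun do rewrite big_seq1 /= indicE in_setT scale1r.
      exact: cvg_cst.
    by exists (fun=> nearest n) => // x; exact: cvg_cst.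
  move=> a; rewrite inE => /orP[/eqP->//|/mapP[b /IH mb ->]] /=.
  exact: measurableD.
exists nearest => // x; apply/cvg_vnormP => e e0.
have [i vi] := dense x e e0; exists i.+1 => n; elim: n => // n IH.
rewrite step_nearestS ltnS leq_eqVlt => /orP[/eqP<-|ni].
  case: ifP => [//|/negbT]; rewrite -leNgt => h; exact: le_lt_trans h vi.
by case: ifP => [h|_]; [exact: lt_trans h (IH ni)|exact: IH].
Qed.

End approximation.

(** The values of the step functions approximating the members of the sequence
    form a countable set that is dense near every value of the limit. *)
Lemma strongly_measurable_lim (F : nat -> T -> E) (f : T -> E) :
  (forall i, sm (F i)) -> (forall x, F i x @[i --> \oo] --> f x) -> sm f.
Proof.
move=> mF Ff.
pose s i := projT1 (cid2 (mF i)).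
have sF i : forall x, step_fun (s i n) x @[n --> \oo] --> F i x.
  by rewrite /s; case: cid2.
pose v (c : nat) : E := if (choice.unpickle c : option (nat * nat * bitseq)) is Some (i, n, b)
  then \sum_(a <- mask b (s i n)) a.2 else 0.
have stepE i n x : exists c, step_fun (s i n) x = v c.
  exists (choice.pickle (i, n, [seq x \in a.1 | a : set T * E <- s i n])).
  rewrite /v choice.pickleK /step_fun; elim: (s i n) => [|a r IH] /=.
    by rewrite !big_nil.
  rewrite big_cons IH indicE; case: (x \in a.1) => /=.
    by rewrite big_cons scale1r.
  by rewrite scale0r add0r.
apply: (@strongly_measurable_nearest f v).
  move=> g mg; apply: (measurable_fun_cvg (h := fun i x => vnorm (F i x - g x))) => //.
    by move=> i; apply/measurable_vnorm/strongly_measurableB.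
  move=> x _; apply/cvgrPdist_lt => e e0.
  have [N HN] := (cvg_vnormP _ _).1 (Ff x) e e0.
  exists N => // n /= /HN; apply: le_lt_trans.
  by rewrite (le_trans (vnorm_lip _ _)) // opprB addrA subrK.
move=> x e e0; have e2 : 0 < e / 2 by rewrite divr_gt0.
have [N HN] := (cvg_vnormP _ _).1 (Ff x) _ e2.
have [N' HN'] := (cvg_vnormP _ _).1 (sF N x) _ e2.
have [c cE] := stepE N N' x; exists c; rewrite -cE.
rewrite -(subrK (F N x) (f x)) -addrA (le_lt_trans (vnormD _ _)) //.
by rewrite [e]splitr ltrD // ?HN // HN'.
Qed.

Lemma strongly_measurable_restrict (A : set T) (f : T -> E) : measurable A -> sm f ->
  sm (fun x => if x \in A then f x else 0).
Proof.
move=> mA [s sm_ sf]; exists (fun n => [seq (a.1 `&` A, a.2) | a <- s n]).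
  by move=> n _ /mapP[a /sm_ ? ->]; exact: measurableI.
move=> x; have stepE n : step_fun [seq (a.1 `&` A, a.2) | a <- s n] x
    = if x \in A then step_fun (s n) x else 0.
  rewrite /step_fun big_map; case: ifPn => xA; last first.
    rewrite big1 // => a _; rewrite indicE memNset ?scale0r //= => -[_].
    by move=> /mem_set; rewrite (negPf xA).
  apply: eq_bigr => a _; rewrite !indicE; congr (_%:R *: _); congr nat_of_bool.
  apply/idP/idP => /set_mem; first by case=> ? _; apply/mem_set.
  by move=> ?; apply/mem_set; split => //; exact: set_mem.
under eq_fun do rewrite stepE.
by case: (x \in A); [exact: sf | exact: cvg_cst].
Qed.

End limits.

Lemma cauchy_vnorm_cvg (R : realType) (k : scalar_kind)
    (E : completeNormedModType (scalars R k)) (s : nat -> E) :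
  (forall e : R, 0 < e -> exists N, forall n, (N <= n)%N -> vnorm (s N - s n) < e) ->
  exists l : E, s n @[n --> \oo] --> l.
Proof.
move=> Hs; apply/cvg_ex/cauchy_cvgP/cauchy_exP => e e0.
have eE : ofreal k (toreal e) = e by rewrite torealK // ltW.
have e0' : 0 < toreal e by rewrite -(@ofreal_lt R k) eE ofreal0.
have [N HN] := Hs _ e0'; exists (s N), N => // n /= /HN.
by rewrite -ball_normE /= vnormK -{2}eE ofreal_lt.
Qed.

(** * Completeness and unconditional convergence *)

Section unconditional.
Context (R : realType) (k : scalar_kind) (E : completeNormedModType (scalars R k)).
Context (disp : measure_display) (T : measurableType disp).
Variables (mu : {measure set T -> \bar R}) (p : R).
Hypothesis p1 : 1 <= p.
Local Notation sm := (@strongly_measurable R k E T measurable).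
Local Notation energy := (energy mu p).

Let p0 : 0 < p. Proof. by rewrite (lt_le_trans _ p1). Qed.

(** Completeness of the Bochner space, for a sequence whose increments decay so
    fast that a weighted sum of their p-th powers is integrable; this sum
    dominates the tails pointwise. *)
Lemma fast_cauchy_lim (S : nat -> T -> E) :
  (forall i, sm (S i)) ->
  (forall i, energy (fun x => (S i.+1 x - S i x)%R)
     <= ((4 ^- i) `^ p)%:E)%E ->
  exists2 G, sm G & exists2 D : R, 0 <= D &
    forall i, (energy (fun x => (G x - S i x)%R) <= ((2 * 2 ^- i) `^ p * D)%:E)%E.
Proof.
move=> mS fast; pose u i x := S i.+1 x - S i x.
have mu_ i : sm (u i) by exact: strongly_measurableB.
pose t i x := ((2 ^+ i * vnorm (u i x)) `^ p)%:E.
have tE i x : t i x = ((2 ^+ i) `^ p * pnorm p (u i x))%:E.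
  by rewrite /t powRM // ?exprn_ge0 // vnorm_ge0.
have t0 i x : (0 <= t i x)%E by rewrite lee_fin powR_ge0.
have mt i : measurable_fun setT (t i).
  rewrite (_ : t i = fun x => (((2 ^+ i) `^ p)%:E * (pnorm p (u i x))%:E)%E).
    by apply: measurable_funeM; exact: measurable_epnorm.
  by apply/funext => x; rewrite tE EFinM.
(* the increments have energy 4^-i to the power p, so weighting them by
   2^i to the power p still leaves a convergent series *)
pose H x := (\sum_(0 <= i <oo) t i x)%E.
have mH : measurable_fun setT H.
  apply: (@ge0_emeasurable_sum _ _ _ setT t xpredT) => [i x _ _|i _]; last exact: mt.
  exact: t0.
have int_t i : (\int[mu]_x t i x <= (2 ^- i)%:E)%E.
  under eq_integral do rewrite tE EFinM.
  rewrite ge0_integralZl_EFin ?powR_ge0 //; last 2 first.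
  - by move=> x _; rewrite lee_fin pnorm_ge0.
  - exact: measurable_epnorm.
  have c0 : (0 <= ((2 ^+ i) `^ p)%:E :> \bar R)%E by rewrite lee_fin powR_ge0.
  apply: (le_trans (lee_wpmul2l c0 (fast i))).
  rewrite -EFinM lee_fin -powRM ?invr_ge0 ?exprn_ge0 //.
  rewrite (_ : 2 ^+ i * 4 ^- i = 2 ^- i :> R); last first.
    rewrite (_ : 4 = 2 * 2 :> R) ?exprMn; last by rewrite -natrM.
    by field; rewrite expf_neq0.
  apply: ge1r_powR => //; rewrite invr_gt0 exprn_gt0 //= invf_le1 ?exprn_gt0 //.
  by rewrite exprn_ege1 // ler1n.
have intH : (\int[mu]_x H x <= 2%:E)%E.
  rewrite integral_nneseries //.
  apply: (@le_trans _ _ (\sum_(0 <= i <oo) (2 ^- i)%:E)%E).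
    apply: lee_nneseries => // i _ _; apply: integral_ge0 => x _; exact: t0.
  apply: lime_le; first by apply: is_cvg_nneseries => i _ _; rewrite lee_fin invr_ge0 exprn_ge0.
  apply/nearW => n; rewrite sumEFin lee_fin.
  suff -> : \sum_(0 <= i < n) 2 ^- i = 2 - 2 * 2 ^- n :> R.
    by rewrite gerBl mulr_ge0 // invr_ge0 exprn_ge0.
  elim: n => [|n IH]; first by rewrite big_nil expr0 invr1 mulr1 subrr.
  by rewrite big_nat_recr //= IH exprS invfM mulrA mulfV // mul1r; lra.
pose A := [set x | (H x < +oo)%E].
have mA : measurable A.
  by rewrite -[A]setTI; exact: emeasurable_fun_infty_o.
have H0 x : (0 <= H x)%E by apply: nneseries_ge0 => i _ _; exact: t0.
have pointwise x : A x -> forall i, vnorm (u i x) <= 2 ^- i * (fine (H x)) `^ p^-1.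
  move=> Ax i; have Hx : H x = (fine (H x))%:E by rewrite fineK // ge0_fin_numE.
  have : (t i x <= H x)%E.
    apply: (@le_trans _ _ (\sum_(0 <= j < i.+1) t j x)%E).
      by rewrite big_nat_recr //= leeDr // sume_ge0.
    by apply: nneseries_lim_ge => j _ _; exact: t0.
  rewrite Hx lee_fin => h.
  have := @ge0_ler_powR R p^-1; rewrite invr_ge0 (ltW p0) => /(_ isT) mono.
  have v0 : 0 <= 2 ^+ i * vnorm (u i x) by rewrite mulr_ge0 ?exprn_ge0 ?vnorm_ge0.
  have := mono _ _ _ _ h; rewrite !nnegrE powR_ge0 fine_ge0 // => /(_ isT isT).
  by rewrite -powRrM mulfV ?gt_eqF // powRr1 // ler_pdivlMl // exprn_gt0.
(* summing the geometric bounds of the increments *)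
have tail x : A x -> forall i j, vnorm (S (i + j)%N x - S i x)
    <= 2 * 2 ^- i * (fine (H x)) `^ p^-1.
  move=> Ax i j; set h := _ `^ _; have h0 : 0 <= h by exact: powR_ge0.
  suff : vnorm (S (i + j)%N x - S i x) <= (2 * 2 ^- i - 2 * 2 ^- (i + j)) * h.
    move=> /le_trans; apply; rewrite ler_wpM2r // gerBl.
    by rewrite mulr_ge0 // invr_ge0 exprn_ge0.
  elim: j => [|j IH]; first by rewrite addn0 !subrr vnorm0 mul0r.
  rewrite addnS -(subrK (S (i + j)%N x) (S (i + j).+1 x)) -addrA.
  rewrite (le_trans (vnormD _ _)) // (le_trans (lerD (pointwise x Ax _) IH)) //.
  rewrite -/h -mulrDl ler_wpM2r // exprS invfM.
  by rewrite mulrA mulfV // mul1r; lra.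
have small (h e : R) : 0 < e -> exists N, 2 * 2 ^- N * h < e.
  move=> e0; have [h0|h0] := leP h 0.
    by exists 0; rewrite (le_lt_trans _ e0) // expr0 invr1 mulr1 pmulr_rle0.
  have c0 : 0 < e / (2 * h) by rewrite divr_gt0 // mulr_gt0.
  have [N HN] : exists N, 2 ^- N < e / (2 * h).
    have : (2^-1 : R) ^+ n @[n --> \oo] --> 0.
      by apply: cvg_expr; rewrite ger0_norm ?invr_ge0 // invf_lt1 // ltr1n.
    move=> /cvgrPdist_lt/(_ _ c0)[N _ HN]; exists N.
    have := HN N (leqnn N); rewrite /= sub0r normrN exprVn ger0_norm //.
  exists N; move: HN; rewrite ltr_pdivlMr ?mulr_gt0 // => /le_lt_trans; apply.
  by rewrite le_eqVlt; apply/orP; left; apply/eqP; ring.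
have lim_ex x : exists l : E, A x -> S i x @[i --> \oo] --> l.
  have [Ax|nA] := pselect (A x); last by exists 0 => /nA.
  have [l Hl] : exists l : E, S i x @[i --> \oo] --> l; last by exists l.
  apply: cauchy_vnorm_cvg => e e0; have [N HN] := small ((fine (H x)) `^ p^-1) e e0.
  exists N => n Nn; rewrite vnormC -(subnKC Nn).
  exact: le_lt_trans (tail x Ax _ _) HN.
pose lim_ x := projT1 (cid (lim_ex x)).
have limP x : A x -> S i x @[i --> \oo] --> lim_ x by rewrite /lim_; case: cid.
pose G x := if x \in A then lim_ x else 0.
have mG : sm G.
  apply: (@strongly_measurable_lim _ _ _ _ _ (fun i x => if x \in A then S i x else 0)).
    by move=> i; exact: strongly_measurable_restrict.
  by move=> x; rewrite /G; case: ifP => [/set_mem/limP//|_]; exact: cvg_cst.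
exists G => //; exists 2 => // i.
have lim_le x : A x -> vnorm (G x - S i x) <= 2 * 2 ^- i * (fine (H x)) `^ p^-1.
  move=> Ax; rewrite /G mem_set //; apply/ler_addgt0Pr => e e0.
  have [N HN] := (cvg_vnormP _ _).1 (limP x Ax) e e0.
  rewrite -(subrK (S (i + N)%N x) (lim_ x)) -addrA (le_trans (vnormD _ _)) //.
  by rewrite [leLHS]addrC lerD ?tail // ltW // HN // leq_addl.
have c0 : 0 <= (2 * 2 ^- i) `^ p :> R by exact: powR_ge0.
have c1 : 0 <= 2 * 2 ^- i :> R by rewrite mulr_ge0 // invr_ge0 exprn_ge0.
rewrite EFinM (@le_trans _ _ (((2 * 2 ^- i) `^ p)%:E * \int[mu]_x H x)%E) //; last first.
  by apply: lee_wpmul2l => //; rewrite lee_fin.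
rewrite -ge0_integralZl_EFin //.
apply: ae_ge0_le_integral => //.
- by move=> x _; rewrite lee_fin pnorm_ge0.
- by apply: measurable_epnorm; exact: strongly_measurableB.
- by move=> x _; rewrite mule_ge0 // lee_fin.
- exact: measurable_funeM.
apply/nearW => x _; have [Ax|nA] := pselect (A x).
  have Hx : H x = (fine (H x))%:E by rewrite fineK // ge0_fin_numE.
  rewrite Hx -EFinM lee_fin /pnorm.
  apply: (le_trans (powR_homo p1 (vnorm_ge0 _) (lim_le x Ax))).
  rewrite powRM ?powR_ge0 // -powRrM mulVf ?gt_eqF // powRr1 // fine_ge0 //.
have -> : H x = +oo%E.
  by apply/eqP; move/negP: nA; rewrite /A /= -leNgt leye_eq.
by rewrite gt0_muley ?leey // lte_fin powR_gt0 // mulr_gt0 // invr_gt0 exprn_gt0.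
Qed.

End unconditional.
Section unconditional_comparison.
Context (R : realType) (k : scalar_kind) (E : completeNormedModType (scalars R k)).
Context (disp : measure_display) (T : measurableType disp).
Variables (mu : {measure set T -> \bar R}) (p : R).
Hypothesis p1 : 1 <= p.
Local Notation energy := (energy mu p).
Local Open Scope fset_scope.
Local Open Scope ring_scope.

Let p0 : 0 < p. Proof. by rewrite (lt_le_trans _ p1). Qed.

Variables (I : choiceType) (u w : I -> T -> E) (C : R).
Hypotheses (u_Lp : forall i, in_Lp mu p (u i)) (w_Lp : forall i, in_Lp mu p (w i)).
Hypothesis C_ge0 : 0 <= C.
Hypothesis w_le_u : forall J : {fset I},
  (energy (fun x => (\sum_(i <- J) w i x)%R)
    <= C%:E * energy (fun x => (\sum_(i <- J) u i x)%R))%E.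

Let mu_ i : strongly_measurable measurable (u i). Proof. by have [] := u_Lp i. Qed.
Let mw i : strongly_measurable measurable (w i). Proof. by have [] := w_Lp i. Qed.

Lemma energy_sum_lty (J : {fset I}) : (energy (fun x => (\sum_(i <- J) w i x)%R) < +oo)%E.
Proof.
apply: (le_lt_trans (energy_sum mu p1 J mw)).
apply: lte_mul_pinfty; [by rewrite lee_fin powR_ge0|by []|].
apply: lte_sum_pinfty => i _.
by have [_ /(Lp_norm_lty _ p1)] := w_Lp i.
Qed.

Variable F : T -> E.
Hypothesis uF : unconditional_sum mu p u F.

Let mF : strongly_measurable measurable F. Proof. by have [[]] := uF. Qed.

Lemma unconditional_energy (e : R) : 0 < e -> exists J0 : {fset I},
  forall J : {fset I}, J0 `<=` J ->
  (energy (fun x => (F x - \sum_(i <- J) u i x)%R) < e%:E)%E.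
Proof.
move=> e0; have e0' : 0 < e `^ p^-1 by exact: powR_gt0.
have [_ /(_ _ e0')[J0 HJ0]] := uF; exists J0 => J /HJ0.
by move=> /(Lp_norm_lt mu p1 _ e0'); rewrite -powRrM mulVf ?gt_eqF // powRr1 // ltW.
Qed.

Lemma sum_disjoint (v : I -> T -> E) (J0 J : {fset I}) x :
  (forall i, i \in J -> i \notin J0) ->
  \sum_(i <- J0 `|` J) v i x = \sum_(i <- J0) v i x + \sum_(i <- J) v i x.
Proof.
move=> dis; rewrite (big_fsetID _ (mem J0)) /=; congr (_ + _);
  apply: eq_fbigl => i; rewrite !inE /=.
  by case: (i \in J0) => //=; rewrite andbF.
by have := dis i; case: (i \in J); case: (i \in J0) => //= /(_ isT).
Qed.

Lemma fsubset_split (J0 J : {fset I}) : J0 `<=` J ->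
  J = J0 `|` (J `\` J0) /\ forall i, i \in J `\` J0 -> i \notin J0.
Proof.
move=> /fsubsetP J0J; split; last by move=> i; rewrite inE => /andP[].
apply/fsetP => i; rewrite !inE; have := J0J i.
by case: (i \in J0) => // ->.
Qed.

(** A block away from J0 is a difference of two partial sums near the sum; the
    estimate for finite sums carries its smallness over to w. *)
Lemma small_blocks (e : R) : 0 < e -> exists J0 : {fset I},
  forall J : {fset I}, (forall i, i \in J -> i \notin J0) ->
  (energy (fun x => (\sum_(i <- J) w i x)%R) <= e%:E)%E.
Proof.
move=> e0; pose c := C * (2 `^ p * 2).
have c0 : 0 <= c by rewrite !mulr_ge0 // powR_ge0.
have d0 : 0 < e / (c + 1) by rewrite divr_gt0 // ltr_wpDl.
have [J0 HJ0] := unconditional_energy d0; exists J0 => J dis.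
have ms J' : strongly_measurable measurable (fun x => F x - \sum_(i <- J') u i x).
  by apply: strongly_measurableB => //; exact: strongly_measurable_sum.
have uE x : \sum_(i <- J) u i x = (F x - \sum_(i <- J0) u i x)
    - (F x - \sum_(i <- J0 `|` J) u i x).
  by rewrite sum_disjoint // opprB [RHS]addrC subrKA addrAC subrr add0r.
apply: (le_trans (w_le_u J)); rewrite (_ : energy _ =
  energy (fun x => (F x - \sum_(i <- J0) u i x)
    - (F x - \sum_(i <- J0 `|` J) u i x))); last first.
  by apply: eq_integral => x _; rewrite uE.
have CE : (0 <= C%:E)%E by rewrite lee_fin.
have pE : (0 <= (2 `^ p)%:E :> \bar R)%E by rewrite lee_fin powR_ge0.
apply: (le_trans (lee_wpmul2l CE (energyB mu p1 (ms J0) (ms (J0 `|` J))))).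
apply: (@le_trans _ _ (C%:E * ((2 `^ p)%:E * ((e / (c + 1))%:E + (e / (c + 1))%:E)))%E).
  apply: lee_wpmul2l => //; apply: lee_wpmul2l => //.
  by apply: leeD; apply: ltW; apply: HJ0 => //; exact: fsubsetUl.
rewrite -EFinD -!EFinM lee_fin.
have -> : C * (2 `^ p * (e / (c + 1) + e / (c + 1))) = c / (c + 1) * e.
  by rewrite /c; ring.
by rewrite ler_piMl ?(ltW e0) // ler_pdivrMr ?mul1r ?lerDl // ltr_wpDl.
Qed.

(** The partial sums over a fast increasing sequence of finite sets converge, and
    the remaining blocks are small. *)
Lemma unconditional_comparison : exists2 G, unconditional_sum mu p w G &
  (energy G <= (4 `^ p * C)%:E * energy F)%E.
Proof.
have e0 i : 0 < (4 ^- i) `^ p :> R by rewrite powR_gt0 // invr_gt0 exprn_gt0.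
pose j0 i := projT1 (cid (small_blocks (e0 i))).
have j0P i : forall J : {fset I}, (forall j, j \in J -> j \notin j0 i) ->
    (energy (fun x => (\sum_(j <- J) w j x)%R) <= ((4 ^- i) `^ p)%:E)%E.
  by rewrite /j0; case: cid.
pose Jk := fix Jk (i : nat) : {fset I} :=
  if i is i'.+1 then Jk i' `|` j0 i else j0 0.
have j0Jk i : j0 i `<=` Jk i by case: i => [|i] /=; [exact: fsubset_refl|exact: fsubsetUr].
have JkP i (J : {fset I}) : (forall j, j \in J -> j \notin Jk i) ->
    (energy (fun x => (\sum_(j <- J) w j x)%R) <= ((4 ^- i) `^ p)%:E)%E.
  move=> dis; apply: j0P => j /dis; apply: contra; exact: (fsubsetP (j0Jk i)).
pose S i x := \sum_(j <- Jk i) w j x.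
have mS i : strongly_measurable measurable (S i) by exact: strongly_measurable_sum.
have mwJ (J : {fset I}) : strongly_measurable measurable (fun x => \sum_(j <- J) w j x).
  exact: strongly_measurable_sum.
have splitw (J0 J : {fset I}) x : J0 `<=` J -> \sum_(j <- J) w j x =
    \sum_(j <- J0) w j x + \sum_(j <- J `\` J0) w j x.
  by move=> /fsubset_split[JE dis]; rewrite {1}JE sum_disjoint.
have fast i : (energy (fun x => (S i.+1 x - S i x)%R) <= ((4 ^- i) `^ p)%:E)%E.
  have sub : Jk i `<=` Jk i.+1 by exact: fsubsetUl.
  rewrite (_ : energy _ = energy (fun x => \sum_(j <- Jk i.+1 `\` Jk i) w j x)).
    by apply: JkP => j; rewrite inE => /andP[].
  apply: eq_integral => x _; rewrite /S (splitw _ _ _ sub).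
  by rewrite [X in X - _]addrC addrK.
have [G mG [D D0 GS]] := fast_cauchy_lim p1 mS fast.
have two0 : (0 <= (2 `^ p)%:E :> \bar R)%E by rewrite lee_fin powR_ge0.
have tail i (J : {fset I}) : Jk i `<=` J ->
    (energy (fun x => (G x - \sum_(j <- J) w j x)%R)
      <= (2 `^ p * ((2 * 2 ^- i) `^ p * D + (4 ^- i) `^ p))%:E)%E.
  move=> sub; rewrite (_ : energy _ = energy (fun x =>
      (G x - S i x) - \sum_(j <- J `\` Jk i) w j x)); last first.
    apply: eq_integral => x _; rewrite (splitw _ _ _ sub) /S opprD addrA //.
  have m1 := strongly_measurableB mG (mS i).
  apply: (le_trans (energyB mu p1 m1 (mwJ _))); rewrite EFinM.
  apply: lee_wpmul2l => //; rewrite EFinD leeD // JkP // => j.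
  by rewrite inE => /andP[].
have small (e : R) : 0 < e -> exists i,
    2 `^ p * ((2 * 2 ^- i) `^ p * D + (4 ^- i) `^ p) < e.
  move=> epos.
  pose b := 2 `^ p * (2 `^ p * D + 1); have b0 : 0 <= b.
    by rewrite mulr_ge0 ?powR_ge0 // addr_ge0 // mulr_ge0 // powR_ge0.
  have d0 : 0 < e / (b + 1) by rewrite divr_gt0 // ltr_wpDl.
  have [i Hi] : exists i, 2 ^- i < e / (b + 1) :> R.
    have : (2^-1 : R) ^+ n @[n --> \oo] --> 0.
      by apply: cvg_expr; rewrite ger0_norm ?invr_ge0 // invf_lt1 // ltr1n.
    move=> /cvgrPdist_lt/(_ _ d0)[N _ HN]; exists N.
    by have := HN N (leqnn N); rewrite /= sub0r normrN exprVn ger0_norm.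
  exists i; have i0 : 0 < 2 ^- i :> R by rewrite invr_gt0 exprn_gt0.
  have i1 : 2 ^- i <= 1 :> R by rewrite invf_le1 ?exprn_gt0 // exprn_ege1 // ler1n.
  have pow_le : (2 ^- i) `^ p <= 2 ^- i :> R by apply: ge1r_powR => //; rewrite i0.
  have four : (4 ^- i) `^ p <= (2 ^- i) `^ p :> R.
    apply: powR_homo => //.
    by rewrite lef_pV2 ?posrE ?exprn_gt0 // lerXn2r ?nnegrE // ler_nat.
  rewrite powRM ?(ltW i0) //; apply: (@le_lt_trans _ _ (b * 2 ^- i)).
    rewrite [leRHS](_ : _ = 2 `^ p * (2 `^ p * 2 ^- i * D + 2 ^- i)); last first.
      by rewrite /b; ring.
    rewrite ler_wpM2l ?powR_ge0 // lerD ?(le_trans four) //.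
    by rewrite ler_wpM2r // ler_wpM2l ?powR_ge0.
  rewrite (@le_lt_trans _ _ ((b + 1) * 2 ^- i)) //.
    by rewrite ler_wpM2r ?(ltW i0) // lerDl.
  by rewrite mulrC -ltr_pdivlMr // ltr_wpDl.
have unc (e : R) : 0 < e -> exists J0 : {fset I}, forall J : {fset I}, J0 `<=` J ->
    (energy (fun x => (G x - \sum_(j <- J) w j x)%R) < e%:E)%E.
  move=> /small[i Hi]; exists (Jk i) => J /tail/le_lt_trans; apply.
  by rewrite lte_fin.
exists G.
  split.
    split => //; apply/(Lp_norm_lty mu p1).
    have mGS := strongly_measurableB mG (mS 0).
    rewrite (_ : energy G = energy (fun x => (G x - S 0 x) + S 0 x)); last first.
      by apply: eq_integral => x _; rewrite subrK.
    apply: (le_lt_trans (energyD mu p1 mGS (mS 0))).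
    apply: lte_mul_pinfty; [by []|by []|].
    by rewrite lte_add_pinfty ?(energy_sum_lty (Jk 0)) // (le_lt_trans (GS 0)) // ltry.
  move=> e epos; have [J0 HJ0] := unc _ (powR_gt0 p epos).
  by exists J0 => J /HJ0; move=> /(Lp_norm_lt mu p1 _ epos).
apply/lee_addgt0Pr => e epos.
pose b := 2 `^ p * (1 + C * 2 `^ p).
have b0 : 0 < b.
  by rewrite mulr_gt0 ?powR_gt0 // ltr_wpDr // mulr_ge0 // powR_ge0.
have d0 : 0 < e / b by rewrite divr_gt0.
have [J1 HJ1] := unc _ d0; have [J2 HJ2] := unconditional_energy d0.
pose J := J1 `|` J2.
have mu_J : strongly_measurable measurable (fun x => \sum_(j <- J) u j x).
  exact: strongly_measurable_sum.
have mFJ := strongly_measurableB mF mu_J.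
have mGJ := strongly_measurableB mG (mwJ J).
have hu : (energy (fun x => (\sum_(j <- J) u j x)%R)
    <= (2 `^ p)%:E * (energy F + (e / b)%:E))%E.
  rewrite (_ : energy _ = energy (fun x => F x - (F x - \sum_(j <- J) u j x))); last first.
    by apply: eq_integral => x _; rewrite opprB addrC subrK.
  apply: (le_trans (energyB mu p1 mF mFJ)); apply: lee_wpmul2l => //.
  by rewrite leeD2l // ltW // HJ2 // fsubsetUr.
rewrite (_ : energy G = energy (fun x => (G x - \sum_(j <- J) w j x)
    + \sum_(j <- J) w j x)); last by apply: eq_integral => x _; rewrite subrK.
apply: (le_trans (energyD mu p1 mGJ (mwJ J))).
have C0 : (0 <= C%:E)%E by rewrite lee_fin.
apply: (@le_trans _ _ ((2 `^ p)%:E * ((e / b)%:E +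
    C%:E * ((2 `^ p)%:E * (energy F + (e / b)%:E))))%E).
  apply: lee_wpmul2l => //; apply: leeD.
    by rewrite ltW // HJ1 // fsubsetUl.
  by apply: (le_trans (w_le_u J)); exact: lee_wpmul2l.
have F_fin : energy F \is a fin_num.
  rewrite ge0_fin_numE ?energy_ge0 //.
  by have [[_ /(Lp_norm_lty mu p1)]] := uF.
rewrite -(fineK F_fin) -?EFinD -?EFinM -?EFinD -?EFinM -?EFinD -?EFinM lee_fin.
rewrite le_eqVlt; apply/orP; left; apply/eqP.
rewrite (_ : 4 = 2 * 2 :> R) ?powRM //; last by rewrite -natrM.
have -> : e = e / b * b by rewrite divfK // gt_eqF.
by rewrite mulfK ?gt_eqF //; move: (e / b) => d; rewrite /b; ring.
Qed.

End unconditional_comparison.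

(** * The comparison of stripe operators *)

Lemma small_ratio_power (R : realType) (q eps t c : R) :
  0 < q -> q < 1 -> 0 < eps -> 0 < t -> 0 < c ->
  exists2 L : nat, (0 < L)%N &
    c * (q `^ (L%:R * eps) / (1 - q `^ (L%:R * eps))) <= t.
Proof.
move=> q0 q1 eps0 t0 c0; pose r := q `^ eps.
have r0 : 0 < r by exact: powR_gt0.
have r1 : r < 1.
  by have := gt0_ltr_powR eps0 _ _ q1; rewrite powR1; apply; rewrite ?nnegrE ltW.
have s0 : 0 < t / (c + t) by rewrite divr_gt0 // addr_gt0.
have [N HN] : exists N, r ^+ N < t / (c + t).
  have : r ^+ n @[n --> \oo] --> 0 by apply: cvg_expr; rewrite gtr0_norm.
  move=> /cvgrPdist_lt/(_ _ s0)[N _ HN]; exists N.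
  by have := HN N (leqnn N); rewrite /= sub0r normrN ger0_norm // exprn_ge0 // ltW.
exists N.+1 => //; have -> : q `^ (N.+1%:R * eps) = r ^+ N.+1.
  by rewrite -powR_mulrn ?powR_ge0 // -powRrM mulrC.
have {HN} HN : r ^+ N.+1 < t / (c + t).
  apply: le_lt_trans HN; rewrite exprS ler_piMl ?exprn_ge0 // ltW //.
have rN1 : r ^+ N.+1 < 1 by rewrite exprn_ilt1 ?ltW.
rewrite mulrA ler_pdivrMr ?subr_gt0 //.
by move: HN; rewrite ltr_pdivlMr ?addr_gt0 // => HN; lra.
Qed.

Theorem theorem5p3 (R : realType) (disp : measure_display)
    (X : measurableType disp) (H : homogeneous_space R X)
    (Q : dyadic_system H) (k : scalar_kind)
    (E : completeNormedModType (scalars R k)) (p K1 K2 eps Cg : R)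
    (E_umd : umd E) (p_gt1 : 1 < p) (eps_gt0 : 0 < eps) (Cg_ge1 : 1 <= Cg) :
  exists2 C : R, 0 < C &
  forall (lambda M : nat), (0 < lambda)%N -> (0 < M)%N ->
  forall (S : 'I_M -> cube Q -> set (cube Q))
    (h : cube Q -> X -> (scalars R k)^o)
    (g : 'I_M -> cube Q -> X -> (scalars R k)^o),
  stripes K1 K2 eps lambda S ->
  base_system p h ->
  stripe_functions p Cg S g ->
  forall (m n : 'I_M) (f : X -> E),
  in_closed_span (vol H) p h f ->
  (transfer_norm (vol H) p h (g m) f
    <= C%:E * transfer_norm (vol H) p h (g n) f)%E.
Proof.
have p1 := ltW p_gt1; have p0 : 0 < p by rewrite (lt_le_trans ltr01).
have [beta beta_ge1 Hbeta] := umd_constant_exists E_umd p_gt1.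
pose K := Num.max 1 (Num.max K1 K2).
have K_ge1 : 1 <= K by rewrite le_max lexx.
have K1K : K1 <= K by rewrite !le_max lexx orbT.
have K2K : K2 <= K by rewrite !le_max lexx !orbT.
have Cg4 : 0 < (4 * Cg ^+ 2)^-1.
  by rewrite invr_gt0 mulr_gt0 // exprn_gt0 // (lt_le_trans ltr01).
have K3 : 0 < 2 * K ^+ 3 by rewrite mulr_gt0 // exprn_gt0 // (lt_le_trans ltr01).
(* L is the distance between the levels of a group that makes the removed parts
   small; it depends on the space and the constants only *)
have [L L_gt0 rho_small] :=
  small_ratio_power (ratio_gt0 Q) (ratio_lt1 Q) eps_gt0 Cg4 K3.
pose B := comparison_const p Cg beta K L.
have B_ge0 : 0 <= B by exact: comparison_const_ge0.
pose C := (4 `^ p * B) `^ p^-1 + 1.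
have C_ge0 : 0 <= (4 `^ p * B) `^ p^-1 by exact: powR_ge0.
have C_ge1 : 1 <= C by rewrite lerDr.
have C_gt0 : 0 < C by rewrite (lt_le_trans ltr01).
exists C => // lambda M lambda_gt0 _ S h g HS _ Hg m n f _.
have norm_ge0 c : (0 <= transfer_norm (vol H) p h (g c) f)%E.
  by apply/ereal_infP => _ [F _ <-]; exact: Lnorm_ge0.
have [->|mn] := eqVneq m n.
  rewrite -[leLHS]mul1e; apply: lee_wpmul2r => //; by rewrite lee_fin.
rewrite -lee_pdivrMl //; apply/ereal_infP => _ [F [c hc Fc] <-].
rewrite lee_pdivrMl //.
have finite_le (J : {fset cube Q}) :
    (energy (vol H) p (fun x => (\sum_(i <- J) tensor (g m i) (c i) x)%R)
     <= B%:E * energy (vol H) p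
          (fun x => (\sum_(i <- J) tensor (g n i) (c i) x)%R))%E.
  have sumE c' x : \sum_(i <- J) tensor (g c' i) (c i) x
      = \sum_(j : J) tensor (g c' (val j)) (c (val j)) x.
    by rewrite big_seq_fsetE.
  under eq_fun do rewrite sumE.
  under [X in (_ <= _ * energy _ _ X)%E]eq_fun do rewrite sumE.
  exact: (finite_energy p1 Cg_ge1 beta_ge1 Hbeta eps_gt0 K_ge1 K1K K2K HS Hg
    lambda_gt0 L_gt0 rho_small mn (fun j : J => c (val j)) val_inj).
have Lp c' i : in_Lp (vol H) p (tensor (g c' i) (c i)).
  exact: (in_Lp_stripe_tensor p1 Hg).
have [G Gc GF] := unconditional_comparison p1 (Lp n) (Lp m) B_ge0 finite_le Fc.
apply: (@le_trans _ _ (Lp_norm (vol H) p%:E G)).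
  by apply: ereal_inf_lbound; exists G => //; exists c.
apply: (@le_trans _ _ (((4 `^ p * B) `^ p^-1)%:E * Lp_norm (vol H) p%:E F)%E).
  apply/(Lp_norm_le (vol H) p1) => //.
  by rewrite -powRrM mulVf ?gt_eqF // powRr1 // mulr_ge0 // powR_ge0.
by apply: lee_wpmul2r; rewrite ?Lnorm_ge0 // lee_fin lerDl.
Qed.
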